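(* Let $F=\beta^m\alpha^{1-m}$ be an $m$-Kropina metric, where $m\neq 0,1$. Suppose $F$ is locally projectively flat with vanishing flag curvature. Then $F$ can be written as $F=\widetilde\alpha^{\,1-m}\widetilde\beta^{\,m}$, where $\widetilde\alpha$ is a flat Riemannian metric and $\widetilde\beta$ is a 1-form parallel with respect to $\widetilde\alpha$, and thus $\widetilde\alpha$ and $\widetilde\beta$ can be locally written (in suitable local coordinates) as $$\widetilde\alpha=|y|,\qquad \widetilde\beta=y^1.$$ Further, $\alpha,\beta$ are related with $\widetilde\alpha,\widetilde\beta$ by $$\alpha=\eta^{\frac{m}{m-1}}\,\widetilde\alpha,\qquad \beta=\eta\,\widetilde\beta,$$ where $\eta=\eta(x)>0$ is a scalar function. In particular $F$ is locally Minkowskian, but in general such $F$ is not flat-parallel.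
   Context: Here $\alpha=\sqrt{a_{ij}(x)y^iy^j}$ is a Riemannian metric and $\beta=b_i(x)y^i$ a 1-form on a manifold of dimension $n\ge 2$; $m$ is a constant, and $F=\beta^m\alpha^{1-m}$ is called an $m$-Kropina metric. $F$ is singular and is considered at those $(x,y)$ where the expression is defined. $|y|$ denotes the Euclidean norm of $y=(y^1,\dots,y^n)$. The spray coefficients of a Finsler metric $F$ are $G^i=\frac14 g^{il}\{[F^2]_{x^ky^l}y^k-[F^2]_{x^l}\}$, with $g_{ij}=\frac12[F^2]_{y^iy^j}$. $F$ is locally projectively flat if around each point there is a local coordinate system in which $G^i=P(x,y)y^i$ for some function $P$; then the flag curvature is the scalar $K=\frac{P^2-P_{x^k}y^k}{F^2}$, and vanishing flag curvature means $K=0$. $F$ is locally Minkowskian if around every point there are local coordinates in which $F=F(y)$ does not depend on $x$. $F$ is flat-parallel if $\alpha$ is flat and $\beta$ is parallel with respect to $\alpha$. *)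

(* Defs.v *)
From HB Require Import structures.
From mathcomp Require Import all_boot all_order all_algebra.
From mathcomp Require Import all_classical all_reals all_analysis.

Set Implicit Arguments.
Unset Strict Implicit.
Unset Printing Implicit Defensive.

Import Order.TTheory GRing.Theory Num.Theory.
Import numFieldNormedType.Exports.

Local Open Scope classical_set_scope.
Local Open Scope ring_scope.

Section Smooth.
Variables (R : realType) (n : nat).

Definition pd (i : 'I_n) (f : 'rV[R]_n -> R) (x : 'rV[R]_n) : R :=
  'D_(delta_mx 0 i) f x.

(* C^k on an open set U; f may take arbitrary values outside U. *)
Fixpoint Ck_on (k : nat) (U : set 'rV[R]_n) (f : 'rV[R]_n -> R) : Prop :=
  {in U, continuous f} /\
  if k is k'.+1 then
    forall i : 'I_n, {in U, forall x, derivable f x (delta_mx 0 i)} /\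
                     Ck_on k' U (pd i f)
  else True.

Definition smooth_on (U : set 'rV[R]_n) (f : 'rV[R]_n -> R) : Prop :=
  forall k, Ck_on k U f.

End Smooth.

Section Manifold.
Variables (R : realType) (n : nat).

(* A homeomorphism from an open set of M onto an open set of R^n. The maps are
   total; their values outside cdom and its image are irrelevant. *)
Record chart (M : topologicalType) := Chart {
  cdom : set M;
  cmap : M -> 'rV[R]_n;
  cinv : 'rV[R]_n -> M;
  cdom_open : open cdom;
  cran_open : open (cmap @` cdom);
  cmapK : {in cdom, cancel cmap cinv};
  cmap_continuous : {in cdom, continuous cmap};
  cinv_continuous : {in cmap @` cdom, continuous cinv} }.

Definition cran (M : topologicalType) (c : chart M) : set 'rV[R]_n :=
  cmap c @` cdom c.

(* The change of coordinates from c to d. *)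
Definition transition (M : topologicalType) (c d : chart M) :
  'rV[R]_n -> 'rV[R]_n := fun x => cmap d (cinv c x).

Definition smooth_transition (M : topologicalType) (c d : chart M) : Prop :=
  forall j : 'I_n, smooth_on (cmap c @` (cdom c `&` cdom d))
                             (fun x => transition c d x 0 j).

Definition compatible (M : topologicalType) (c d : chart M) : Prop :=
  smooth_transition c d /\ smooth_transition d c.

Record manifold := Manifold {
  mcarrier :> topologicalType;
  matlas : set (chart mcarrier);
  manifold_hausdorff : hausdorff_space mcarrier;
  manifold_second_countable : @second_countable mcarrier;
  matlas_cover : forall p, exists2 c, matlas c & cdom c p;
  matlas_compatible : forall c d, matlas c -> matlas d -> compatible c d;
  matlas_maximal : forall c, (forall d, matlas d -> compatible c d) ->
                   matlas c }.

(* Since the atlas is maximal, these are all local coordinates around p. *)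
Definition chart_at (M : manifold) (p : M) (c : chart M) : Prop :=
  matlas c /\ cdom c p.

Definition smooth_fun (M : manifold) (f : M -> R) : Prop :=
  forall c : chart M, matlas c -> smooth_on (cran c) (fun x => f (cinv c x)).

(* alpha^2 = a_ij(x) y^i y^j *)
Definition quad (a : 'M[R]_n) (y : 'rV[R]_n) : R :=
  \sum_i \sum_j a i j * y 0 i * y 0 j.

(* beta = b_i(x) y^i *)
Definition lin (b : 'rV[R]_n) (y : 'rV[R]_n) : R := \sum_i b 0 i * y 0 i.

(* Tensor fields are given by their components in every chart, subject to the
   transformation law.  'J (transition c d) x is the matrix of the differential
   acting on row vectors by right multiplication: y in the coordinates c is
   y *m 'J (transition c d) x in the coordinates d. *)
Record riemannian (M : manifold) := Riemannian {
  metric :> chart M -> 'rV[R]_n -> 'M[R]_n;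
  metric_smooth : forall (c : chart M) (i j : 'I_n), matlas c ->
    smooth_on (cran c) (fun x => metric c x i j);
  metric_sym : forall (c : chart M) x, matlas c -> cran c x ->
    (metric c x)^T = metric c x;
  metric_pos : forall (c : chart M) x y, matlas c -> cran c x -> y != 0 ->
    0 < quad (metric c x) y;
  metric_transform : forall (c d : chart M) (p : M),
    chart_at p c -> chart_at p d ->
    metric c (cmap c p) =
      'J (transition c d) (cmap c p) *m metric d (cmap d p)
        *m ('J (transition c d) (cmap c p))^T }.

Record oneform (M : manifold) := Oneform {
  form :> chart M -> 'rV[R]_n -> 'rV[R]_n;
  form_smooth : forall (c : chart M) (i : 'I_n), matlas c ->
    smooth_on (cran c) (fun x => form c x 0 i);
  form_transform : forall (c d : chart M) (p : M),
    chart_at p c -> chart_at p d ->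
    form c (cmap c p) =
      form d (cmap d p) *m ('J (transition c d) (cmap c p))^T }.

(* alpha(x, y) and beta(x, y) in the coordinates c. *)
Definition alpha_val (M : manifold) (alpha : riemannian M) (c : chart M)
  (x y : 'rV[R]_n) : R := Num.sqrt (quad (alpha c x) y).

Definition beta_val (M : manifold) (beta : oneform M) (c : chart M)
  (x y : 'rV[R]_n) : R := lin (beta c x) y.

Definition nowhere_zero (M : manifold) (beta : oneform M) : Prop :=
  forall (c : chart M) x, matlas c -> cran c x -> beta c x != 0.

Definition christoffel (a : 'rV[R]_n -> 'M[R]_n) (k i j : 'I_n)
  (x : 'rV[R]_n) : R :=
  2^-1 * \sum_l invmx (a x) k l *
    (pd i (fun z => a z j l) x + pd j (fun z => a z i l) x
     - pd l (fun z => a z i j) x).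

(* The component R^l_(k i j), i.e. the l-th component of
   R(e_i, e_j) e_k = nabla_i nabla_j e_k - nabla_j nabla_i e_k. *)
Definition riemann_curvature (a : 'rV[R]_n -> 'M[R]_n) (l k i j : 'I_n)
  (x : 'rV[R]_n) : R :=
  pd i (christoffel a l j k) x - pd j (christoffel a l i k) x
  + \sum_s (christoffel a l i s x * christoffel a s j k x
            - christoffel a l j s x * christoffel a s i k x).

Definition flat (M : manifold) (alpha : riemannian M) : Prop :=
  forall (c : chart M) x (l k i j : 'I_n), matlas c -> cran c x ->
    riemann_curvature (alpha c) l k i j x = 0.

Definition parallel (M : manifold) (alpha : riemannian M) (beta : oneform M) :
  Prop :=
  forall (c : chart M) x (i j : 'I_n), matlas c -> cran c x ->
    pd j (fun z => beta c z 0 i) x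
      - \sum_k christoffel (alpha c) k i j x * beta c x 0 k = 0.

Definition flat_parallel (M : manifold) (alpha : riemannian M)
  (beta : oneform M) : Prop := flat alpha /\ parallel alpha beta.

End Manifold.

Section Finsler.
Variables (R : realType) (n : nat).

(* A possibly singular Finsler metric: fin_val F c x y is F(x, y) in the
   coordinates c, meaningful only where fin_dom F c x y holds. *)
Record finsler (M : manifold R n) := Finsler {
  fin_dom : chart R n M -> 'rV[R]_n -> 'rV[R]_n -> Prop;
  fin_val : chart R n M -> 'rV[R]_n -> 'rV[R]_n -> R }.

(* F = beta^m alpha^(1-m) with a real exponent m: defined where beta > 0. *)
Definition kropina (M : manifold R n) (m : R) (alpha : riemannian M)
  (beta : oneform M) : finsler M :=
  Finsler
    (fun c x y => 0 < beta_val beta c x y)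
    (fun c x y =>
       beta_val beta c x y `^ m * alpha_val alpha c x y `^ (1 - m)).

Definition same_metric (M : manifold R n) (F F' : finsler M) : Prop :=
  forall (c : chart R n M) x y, matlas c -> cran c x ->
    (fin_dom F c x y <-> fin_dom F' c x y) /\
    (fin_dom F c x y -> fin_val F c x y = fin_val F' c x y).

Section Coordinates.
Variable F : 'rV[R]_n -> 'rV[R]_n -> R.

(* g_ij = 1/2 [F^2]_(y^i y^j) *)
Definition fundamental (x y : 'rV[R]_n) : 'M[R]_n :=
  \matrix_(i, j) (2^-1 * pd i (pd j (fun v => F x v ^+ 2)) y).

(* G^i = 1/4 g^il ([F^2]_(x^k y^l) y^k - [F^2]_(x^l)) *)
Definition spray (i : 'I_n) (x y : 'rV[R]_n) : R :=
  4^-1 * \sum_l invmx (fundamental x y) i l *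
    (\sum_k pd l (fun v => pd k (fun z => F z v ^+ 2) x) y * y 0 k
     - pd l (fun z => F z y ^+ 2) x).

(* K = (P^2 - P_(x^k) y^k) / F^2 *)
Definition flag_curvature (P : 'rV[R]_n -> 'rV[R]_n -> R)
  (x y : 'rV[R]_n) : R :=
  (P x y ^+ 2 - \sum_k pd k (fun z => P z y) x * y 0 k) / F x y ^+ 2.

End Coordinates.

(* The spray coefficients of F are defined at (x, y): F may degenerate in some
   directions of its domain. *)
Definition regular_at (M : manifold R n) (F : finsler M) (c : chart R n M)
  (x y : 'rV[R]_n) : Prop :=
  [/\ cran c x, fin_dom F c x y & fundamental (fin_val F c) x y \in unitmx].

Definition projectively_flat_in (M : manifold R n) (F : finsler M)
  (c : chart R n M) (P : 'rV[R]_n -> 'rV[R]_n -> R) : Prop :=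
  forall x y, regular_at F c x y ->
    forall i, spray (fin_val F c) i x y = P x y * y 0 i.

(* P is determined by F at the regular points, so the second conjunct says
   K = 0. *)
Definition locally_projectively_flat_K0 (M : manifold R n) (F : finsler M) :
  Prop :=
  forall p : M, exists (c : chart R n M) (P : 'rV[R]_n -> 'rV[R]_n -> R),
    [/\ chart_at p c, projectively_flat_in F c P
      & forall x y, regular_at F c x y ->
          flag_curvature (fin_val F c) P x y = 0].

Definition locally_minkowskian (M : manifold R n) (F : finsler M) : Prop :=
  forall p : M, exists2 c : chart R n M, chart_at p c &
    forall x x' y, cran c x -> cran c x' -> fin_dom F c x y ->
      fin_dom F c x' y /\ fin_val F c x' y = fin_val F c x y.

Definition enorm (y : 'rV[R]_n) : R := Num.sqrt (\sum_i y 0 i ^+ 2).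

(* In suitable coordinates around every point, alpha = |y| and beta = y^1. *)
Definition local_normal_form (M : manifold R n) (alpha : riemannian M)
  (beta : oneform M) : Prop :=
  forall p : M, exists2 c : chart R n M, chart_at p c &
    forall x y, cran c x ->
      alpha_val alpha c x y = enorm y /\
      (forall i1 : 'I_n, val i1 = 0%N -> beta_val beta c x y = y 0 i1).

(* alpha = eta^(m/(m-1)) alpha' and beta = eta beta' *)
Definition kropina_related (M : manifold R n) (m : R) (eta : M -> R)
  (alpha : riemannian M) (beta : oneform M)
  (alpha' : riemannian M) (beta' : oneform M) : Prop :=
  forall (p : M) (c : chart R n M) y, chart_at p c ->
    alpha_val alpha c (cmap c p) y =
      eta p `^ (m / (m - 1)) * alpha_val alpha' c (cmap c p) y /\
    beta_val beta c (cmap c p) y = eta p * beta_val beta' c (cmap c p) y.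

End Finsler.

(* Main.v *)
Require Import Defs.
From HB Require Import structures.
From mathcomp Require Import all_boot all_order all_algebra.
From mathcomp Require Import all_classical all_reals all_analysis.
From mathcomp Require Import ring lra.

Set Implicit Arguments.
Unset Strict Implicit.
Unset Printing Implicit Defensive.

Import Order.TTheory GRing.Theory Num.Theory.
Import numFieldNormedType.Exports.

Local Open Scope classical_set_scope.
Local Open Scope ring_scope.

(** Write A = a(y, y), be = b(y), B = |b|^2 for the norm of a, and let T_l, S_l be
    the partial derivatives of a and b, A0 = y^k T_k(y, y), be0 = y^k S_k(y).

    Since F^2 = exp (2 m ln be + (1 - m) ln A), the equation G = P y at a regular
    (x, y) is an identity between rational functions of y.  It forces
    4 P = 2 m be0 / be + (1 - m) A0 / A, and after clearing denominators it says
    that a polynomial in y, the [projective_defect], vanishes on the regular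
    directions, hence everywhere.  On the hyperplane be = 0 it is
    2 m (m - 1) be0 b_l A^2, so be divides be0.  Modulo A it is
    - (1 - m)(1 + m) A0 be^2 y_l, so the irreducible quadratic A divides A0; if
    m = -1 this coefficient is zero and the divisibility comes from K = 0 instead.
    Therefore P is linear in y, P = p(y), and comparing coefficients gives
      T_lij = p_i a_jl + p_j a_il + a_ij d_l,   S_li = p_i b_l + b_i c_l,
      2 m c + (1 - m) d = 2 p
    ([projective_structure]).

    Rescale: g = B^m a and w = B^((m-1)/2) b give the same F, |w| = 1, and
      d_l g_ij = p_i g_jl + p_j g_il + 2 p_l g_ij,   d_l w_i = p_i w_l + p_l w_i
    ([normal_structure]).  Now P = p(y), so K = 0 determines the symmetric part of
    the matrix of partial derivatives of p, and the symmetry of the second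
    derivatives of w kills its antisymmetric part: d_k p_j = p_k p_j
    ([normal_factor_derivative]).

    This closed system for (p, w, g) is solved explicitly.  With
    u = 1 - p(x0)(x - x0) and a coframe E of g(x0) whose first covector is w(x0),
    the solution is p = p(x0) / u, g = J J^T, w = first column of J, where J is the
    Jacobian of the projective map x |-> (x - x0) E / u; uniqueness is Gronwall's
    lemma on segments ([straightening]).  In the coordinates given by this map g is
    the Euclidean metric and w = y^1 ([euclidean_chart]), which gives flatness,
    parallelism ([pullback_curvature], [pullback_parallel]) and the Minkowskian
    property, and eta = B^((1-m)/2).

    For the last claim take alpha^2 = exp (k x^1) |y|^2 and beta = exp (x^1) y^1 on
    R^n with k = 2m / (m-1): then F = (y^1)^m |y|^(1-m) does not depend on x, while
    beta could be parallel only if k = 2, which no m satisfies. *)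

(** * Directional derivatives of real functions *)

Section OneVariable.
Variables (R : realType) (V : normedModType R).

Lemma derive_line (f : V -> R) x v : 'D_v f x = 'D_1 (fun h : R => f (h *: v + x)) 0.
Proof.
rewrite /derive; set g1 := fun h => h^-1 *: _; set g2 := fun h => h^-1 *: _.
suff -> : g1 = g2 by [].
by rewrite funeqE /g1 /g2 => h /=; rewrite addr0 scale0r add0r [_%:A]mulr1.
Qed.

Lemma is_derive_line (f : V -> R) x v df :
  is_derive x v f df <-> is_derive (0 : R) 1 (fun h : R => f (h *: v + x)) df.
Proof.
split=> -[h1 h2]; apply: DeriveDef.
- exact/(derivable1P f x v).
- by rewrite -derive_line.
- exact/(derivable1P f x v).
- by rewrite derive_line.
Qed.

Lemma is_derive_comp1 (h : R -> R) (f : V -> R) x v df dh :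
  is_derive x v f df -> is_derive (f x) 1 h dh ->
  is_derive x v (h \o f) (dh * df).
Proof.
move=> /is_derive_line [f1 f2] [h1 h2]; apply/is_derive_line.
have fx : f x = (fun t : R => f (t *: v + x)) 0 by rewrite scale0r add0r.
have h1' : derivable h ((fun t : R => f (t *: v + x)) 0) 1 by rewrite -fx.
apply: DeriveDef.
  apply/derivable1_diffP; apply: (@differentiable_comp _ _ _ _ (fun t : R => f (t *: v + x)) h).
    exact/derivable1_diffP.
  exact/derivable1_diffP.
have := derive1_comp f1 h1'.
rewrite derive1E => ->; rewrite !derive1E.
by rewrite f2 -fx h2.
Qed.

Lemma is_deriveM1 (f g : V -> R) x v df dg :
  is_derive x v f df -> is_derive x v g dg ->
  is_derive x v (fun z => f z * g z) (df * g x + f x * dg).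
Proof.
move=> hf hg; have H := is_deriveM hf hg.
rewrite (_ : (fun z => _) = f * g) //.
apply: is_derive_eq H _; rewrite /GRing.scale /=; ring.
Qed.

Lemma is_deriveD1 (f g : V -> R) x v df dg :
  is_derive x v f df -> is_derive x v g dg ->
  is_derive x v (fun z => f z + g z) (df + dg).
Proof. by move=> hf hg; exact: (is_deriveD hf hg). Qed.

Lemma is_deriveB1 (f g : V -> R) x v df dg :
  is_derive x v f df -> is_derive x v g dg ->
  is_derive x v (fun z => f z - g z) (df - dg).
Proof. by move=> hf hg; exact: (is_deriveB hf hg). Qed.

Lemma is_deriveZ1 (f : V -> R) k x v df :
  is_derive x v f df -> is_derive x v (fun z => k * f z) (k * df).
Proof. by move=> hf; exact: (is_deriveZ k hf). Qed.

Lemma is_derive_sum1 (I : Type) (r : seq I) (P : pred I) (f : I -> V -> R) x v df :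
  (forall i, P i -> is_derive x v (f i) (df i)) ->
  is_derive x v (fun z => \sum_(i <- r | P i) f i z) (\sum_(i <- r | P i) df i).
Proof.
move=> h; elim: r => [|i r IH].
  rewrite (_ : (fun z => _) = cst 0).
    by rewrite big_nil; exact: is_derive_cst.
  by apply/funext => z; rewrite big_nil.
rewrite big_cons (_ : (fun z => _) = (fun z =>
   if P i then f i z + \sum_(j <- r | P j) f j z else \sum_(j <- r | P j) f j z)).
  by case: ifP => // Pi; apply: is_deriveD1 => //; exact: h.
by apply/funext => z; rewrite big_cons.
Qed.

Lemma is_deriveV1 (f : V -> R) x v df : f x != 0 ->
  is_derive x v f df -> is_derive x v (fun z => (f z)^-1) (- (f x)^-2 * df).
Proof.
move=> f0 hf.
apply: DeriveDef; first by apply: derivableV => //; exact: ex_derive.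
by rewrite deriveV // derive_val.
Qed.

Lemma is_derive_expR1 (f : V -> R) x v df :
  is_derive x v f df -> is_derive x v (fun z => expR (f z)) (expR (f x) * df).
Proof. by move=> hf; apply: (is_derive_comp1 hf); exact: is_derive_expR. Qed.

Lemma is_derive_ln1 (f : V -> R) x v df : 0 < f x ->
  is_derive x v f df -> is_derive x v (fun z => ln (f z)) ((f x)^-1 * df).
Proof. by move=> f0 hf; apply: (is_derive_comp1 hf); exact: is_derive1_ln. Qed.

Lemma is_derive_powR1 (f : V -> R) (a : R) x v df : 0 < f x ->
  is_derive x v f df ->
  is_derive x v (fun z => f z `^ a) (a * f x `^ (a - 1) * df).
Proof.
by move=> f0 hf; apply: (@is_derive_comp1 (fun t => t `^ a) _ _ _ _ _ hf); exact: is_derive1_powR.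
Qed.

End OneVariable.

Lemma is_derive_lin_comp (R : realType) (V W : normedModType R) (f : V -> R) (L : W -> V) (w z : W) (v : V) df :
  (forall t : R, L (t *: w + z) = t *: v + L z) ->
  is_derive (L z) v f df -> is_derive z w (f \o L) df.
Proof.
move=> hL /is_derive_line h; apply/is_derive_line.
rewrite (_ : (fun _ => _) = (fun h0 : R => f (h0 *: v + L z))) //.
by apply/funext => t /=; rewrite hL.
Qed.

(** * Continuous partial derivatives give differentiability *)

Lemma is_derive_scale (R : realType) (V : normedModType R) (f : V -> R) x v k df :
  is_derive x v f df -> is_derive x (k *: v) f (k * df).
Proof.
move=> /is_derive_line h; apply/is_derive_line.
have h0 : is_derive (k * (0 : R)) 1 (fun t : R => f (t *: v + x)) df by rewrite mulr0.
have hk : is_derive (0 : R) 1 (fun t : R => k * t) (k * 1).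
  by apply: is_deriveZ1; exact: is_derive_id.
have := is_derive_comp1 hk h0.
rewrite mulr1 mulrC; congr is_derive.
by apply/funext => t /=; rewrite scalerA mulrC.
Qed.

(** The mean value theorem along z + t v; stated with the derivative in the
    direction v, so that v may be a small multiple of a coordinate vector. *)
Lemma MVT_line (R : realType) (V : normedModType R) (f : V -> R) z v (df : R -> R) :
  (forall t : R, 0 <= t <= 1 -> is_derive (t *: v + z) v f (df t)) ->
  exists2 t : R, 0 <= t <= 1 & f (v + z) - f z = df t.
Proof.
move=> h.
have h' (t : R) : 0 <= t <= 1 -> is_derive t 1 (fun s : R => f (s *: v + z)) (df t).
  move=> ht; apply: (@is_derive_lin_comp R V R^o f (fun s : R => s *: v + z) 1 t v).
    by move=> s; rewrite -[s *: 1]/(s * 1) mulr1 scalerDl addrA.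
  exact: h.
have [||t] := @MVT_segment R (fun s : R => f (s *: v + z)) df 0 1 ler01.
- by move=> t; rewrite in_itv /= => /andP[t0 t1]; apply: h'; rewrite !ltW.
- apply: derivable_within_continuous => t; rewrite in_itv /= => ht.
  by have [] := h' t ht.
- rewrite in_itv /= => ht; rewrite scale1r scale0r add0r subr0 mulr1 => e.
  by exists t.
Qed.

Section RowNorm.
Variables (R : realType) (n : nat).
Implicit Types v : 'rV[R]_n.

Lemma coord_norm_le v i : `|v 0 i| <= `|v|.
Proof.
rewrite [leRHS]/Num.Def.normr/= mx_normrE.
exact: (@le_bigmax _ R _ 0 (fun k : 'I_1 * 'I_n => `|v k.1 k.2|) (0, i)).
Qed.

Lemma row_norm_le v e : 0 <= e -> (forall i, `|v 0 i| <= e) -> `|v| <= e.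
Proof.
move=> e0 h; rewrite [leLHS]/Num.Def.normr/= mx_normrE.
by apply: bigmax_le => // -[i j] _ /=; rewrite ord1.
Qed.

(** The partial sums of the path from 0 to v that moves one coordinate at a time. *)
Definition row_prefix (v : 'rV[R]_n) (k : nat) : 'rV[R]_n :=
  \row_i (if (i < k)%N then v 0 i else 0).

Lemma row_prefix0 v : row_prefix v 0 = 0.
Proof. by apply/rowP => i; rewrite !mxE. Qed.

Lemma row_prefix_full v : row_prefix v n = v.
Proof. by apply/rowP => i; rewrite !mxE ltn_ord. Qed.

Lemma row_prefixS v (k : 'I_n) :
  row_prefix v k.+1 = v 0 k *: delta_mx 0 k + row_prefix v k.
Proof.
apply/rowP => i; rewrite !mxE eqxx /= ltnS leq_eqVlt.
case: (ltngtP i k) => [h|h|/val_inj ->] /=.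
- by rewrite (_ : i == k = false) ?mulr0 ?add0r //; apply/negbTE; rewrite neq_ltn h.
- by rewrite (_ : i == k = false) ?mulr0 ?add0r //; apply/negbTE; rewrite neq_ltn h orbT.
- by rewrite !eqxx mulr1 addr0.
Qed.

End RowNorm.

Section FirstOrder.
Variables (R : realType) (n : nat).
Implicit Types (U V : set 'rV[R]_n) (f g : 'rV[R]_n -> R) (x v : 'rV[R]_n).

Definition grad f x v : R := \sum_i v 0 i * pd i f x.

Fact grad_linear f x : linear (grad f x).
Proof.
move=> a u v; rewrite /grad /GRing.scale /= mulr_sumr -big_split /=.
by apply: eq_bigr => i _; rewrite !mxE mulrDl mulrA.
Qed.

HB.instance Definition _ f x :=
  GRing.isLinear.Build R 'rV[R]_n R _ (grad f x) (grad_linear f x).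

Lemma continuous_sum (T : topologicalType) (I : Type) (r : seq I) (F : I -> T -> R) (t : T) :
  (forall i, {for t, continuous (F i)}) ->
  {for t, continuous (fun z => \sum_(i <- r) F i z)}.
Proof.
move=> h; elim: r => [|i r IH].
  rewrite (_ : (fun z => _) = cst 0); first exact: cst_continuous.
  by apply/funext => z; rewrite big_nil.
rewrite (_ : (fun z => _) = (fun z => F i z + \sum_(j <- r) F j z)).
  by apply: continuousD; [exact: h|exact: IH].
by apply/funext => z; rewrite big_cons.
Qed.

Lemma grad_continuous f x : continuous (grad f x).
Proof.
move=> v; apply: continuous_sum => i.
by apply: continuousM; [exact: coord_continuous|exact: cst_continuous].
Qed.

Lemma Ck_on_sub k U V f : V `<=` U -> Ck_on k U f -> Ck_on k V f.
Proof.
move=> VU; elim: k f => [|k IH] f /= [hc h].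
  by split=> // x; rewrite inE => /VU Ux; apply: hc; rewrite inE.
split; first by move=> x; rewrite inE => /VU Ux; apply: hc; rewrite inE.
move=> i; have [hd hk] := h i; split; last exact: IH.
by move=> x; rewrite inE => /VU Ux; apply: hd; rewrite inE.
Qed.

Lemma Ck_on_le k U f : Ck_on k.+1 U f -> Ck_on k U f.
Proof.
elim: k f => [|k IH] f /= [hc h]; split => //.
by move=> i; have [hd hk] := h i; split => //; exact: IH.
Qed.

Lemma Ck_on_is_derive k U f x i : Ck_on k.+1 U f -> U x ->
  is_derive x (delta_mx 0 i) f (pd i f x).
Proof.
move=> [_ h] Ux; have [hd _] := h i.
by apply: DeriveDef => //; apply: hd; rewrite inE.
Qed.

Lemma C1_near U f x (e : R) : open U -> Ck_on 1 U f -> U x -> 0 < e ->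
  exists2 d : R, 0 < d & forall z : 'rV[R]_n, `|x - z| < d -> U z /\
    forall i, `|pd i f x - pd i f z| <= e.
Proof.
move=> oU [_ h] Ux e0.
have : \forall z \near x, U z /\ forall i, `|pd i f x - pd i f z| <= e.
  near=> z; split; first by near: z; exact: (open_nbhs_nbhs (conj oU Ux)).
  near: z; apply: filter_forall => i.
  have [_ [hc _]] := h i.
  have /(_ x) := hc; rewrite inE => /(_ Ux) /cvgrPdist_le; exact.
move=> /nbhs_ballP[d d0 hd]; exists d => // z hz; apply: hd.
by rewrite -ball_normE.
Unshelve. all: by end_near. Qed.

(** Only partial derivatives are available at the start.  The increment of f is
    split along [row_prefix], each piece moves one coordinate and is controlled by
    the mean value theorem and the continuity of the corresponding partial
    derivative; the sum of the errors is o(h). *)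
Lemma C1_differentiable U f x : open U -> Ck_on 1 U f -> U x ->
  differentiable f x /\ 'd f x = grad f x :> (_ -> _).
Proof.
move=> oU hf Ux.
suff E : (f : 'rV[R]_n -> R^o) \o shift x =
    cst (f x : R^o) + (grad f x : 'rV[R]_n -> R^o) +o_ (0 : 'rV[R]_n) id.
  have D := diff_unique (@grad_continuous f x) E.
  split=> //; apply/diff_locallyP; rewrite D; split=> //; exact: grad_continuous.
apply/eqaddoP => _/posnumP[e].
have e0 : 0 < e%:num / (n.+1)%:R by rewrite divr_gt0.
have [d d0 hd] := C1_near oU hf Ux e0.
near=> h => /=.
  have hh : `|h| < d by near: h; exact: (@nbhs0_lt R 'rV[R]_n d d0).
have step (k : 'I_n) : `|(f (row_prefix h k.+1 + x) - f (row_prefix h k + x)) - h 0 k * pd k f x|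
    <= `|h| * (e%:num / (n.+1)%:R).
  have inU (t : R) : 0 <= t <= 1 ->
      `|x - (t *: (h 0 k *: delta_mx 0 k) + (row_prefix h k + x))| < d.
    move=> /andP[t0 t1]; apply: le_lt_trans hh.
    rewrite addrA opprD addrCA subrr addr0 normrN; apply: row_norm_le => // i.
    rewrite !mxE eqxx /=; case: (ltngtP i k) => [ik|ik|/val_inj ->].
    - by rewrite (_ : i == k = false) ?mulr0 ?add0r ?coord_norm_le //; apply/negbTE; rewrite neq_ltn ik.
    - by rewrite (_ : i == k = false) ?mulr0 ?addr0 ?normr0 //; apply/negbTE; rewrite neq_ltn ik orbT.
    - rewrite !eqxx mulr1 addr0 normrM (ger0_norm t0).
      by apply: le_trans (coord_norm_le h k); rewrite ler_piMl.
  have [t t01 E] : exists2 t : R, 0 <= t <= 1 &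
    f (h 0 k *: delta_mx 0 k + (row_prefix h k + x)) - f (row_prefix h k + x)
      = h 0 k * pd k f (t *: (h 0 k *: delta_mx 0 k) + (row_prefix h k + x)).
    apply: (@MVT_line _ _ f (row_prefix h k + x) (h 0 k *: delta_mx 0 k)
      (fun t => h 0 k * pd k f (t *: (h 0 k *: delta_mx 0 k) + (row_prefix h k + x)))).
    move=> t t01; apply: is_derive_scale; apply: (Ck_on_is_derive _ hf).
    by have [] := hd _ (inU t t01).
  rewrite row_prefixS -(addrA (h 0 k *: _)). rewrite E.
  rewrite -mulrBr normrM ler_pM // ?coord_norm_le // distrC.
  by have [_ ] := hd _ (inU t t01); exact.
rewrite [X in `|X| <= _](_ : _ =
   \sum_(k < n) ((f (row_prefix h k.+1 + x) - f (row_prefix h k + x)) - h 0 k * pd k f x)); last first.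
  rewrite sumrB -(big_mkord xpredT (fun k => f (row_prefix h k.+1 + x) - f (row_prefix h k + x))).
  rewrite telescope_sumr // row_prefix_full row_prefix0 add0r /= /grad.
  by rewrite -[LHS]/(f (h + x) - (f x + grad f x h)) opprD addrA.
apply: le_trans (ler_norm_sum _ _ _) _.
apply: le_trans (ler_sum _ (fun k _ => step k)) _.
rewrite sumr_const card_ord -[leLHS]mulr_natr -mulrA [leRHS]mulrC ler_wpM2l //.
rewrite mulrAC ler_pdivrMr // ler_wpM2l // ler_nat; exact: leqnSn.
Unshelve. all: by end_near. Qed.

Lemma C1_is_derive U f x v : open U -> Ck_on 1 U f -> U x ->
  is_derive x v f (grad f x v).
Proof.
move=> oU hf Ux; have [h1 h2] := C1_differentiable oU hf Ux.
apply: DeriveDef; first exact: diff_derivable.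
by rewrite deriveE // h2.
Qed.

End FirstOrder.

(** * Stability of the classes C^k *)

Section Closure.
Variables (R : realType) (n : nat).
Implicit Types (U V : set 'rV[R]_n) (f g : 'rV[R]_n -> R) (x v : 'rV[R]_n).

Lemma pd_ext U f g x i : open U -> (forall z, U z -> f z = g z) -> U x ->
  pd i f x = pd i g x.
Proof.
move=> oU fg Ux; apply: near_eq_derive; near=> z; apply: fg; near: z.
exact: (open_nbhs_nbhs (conj oU Ux)).
Unshelve. all: by end_near. Qed.

Lemma is_derive_ext U f g x v df : open U -> (forall z, U z -> f z = g z) -> U x ->
  is_derive x v f df -> is_derive x v g df.
Proof.
move=> oU fg Ux; apply: near_eq_is_derive; near=> z; apply: fg; near: z.
exact: (open_nbhs_nbhs (conj oU Ux)).
Unshelve. all: by end_near. Qed.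

Lemma is_derive_pd f x i df : is_derive x (delta_mx 0 i) f df -> pd i f x = df.
Proof. by move=> h; exact: derive_val. Qed.

Lemma continuous_ext U f g : open U -> (forall z, U z -> f z = g z) ->
  {in U, continuous f} -> {in U, continuous g}.
Proof.
move=> oU fg cf x Ux; have cx := cf _ Ux; rewrite inE in Ux.
have nx : \forall z \near x, f z = g z.
  near=> z; apply: fg; near: z; exact: (open_nbhs_nbhs (conj oU Ux)).
rewrite /continuous_at -(fg x Ux); exact: cvg_trans (near_eq_cvg nx) cx.
Unshelve. all: by end_near. Qed.

Lemma Ck_on_cont k U f : Ck_on k U f -> {in U, continuous f}.
Proof. by case: k => [|k] []. Qed.

(** Invariance of the classes C^k under local equality enters as a hypothesis
    because its own proof ([Ck_on_ext]) goes through this lemma by induction on k;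
    [Ck_onS] is the form to use afterwards. *)
Lemma Ck_on_intro k U f (g : 'I_n -> 'rV[R]_n -> R) : open U -> {in U, continuous f} ->
  (forall i x, U x -> is_derive x (delta_mx 0 i) f (g i x)) ->
  (forall i, Ck_on k U (g i)) ->
  (forall V h h', open V -> (forall z, V z -> h z = h' z) -> Ck_on k V h -> Ck_on k V h') ->
  Ck_on k.+1 U f.
Proof.
move=> oU cf hd hg ext; split => // i; split.
  by move=> x; rewrite inE => Ux; have [] := hd i x Ux.
apply: (ext U (g i)) => // z Uz; apply/esym; exact: is_derive_pd (hd _ _ Uz).
Qed.

Lemma Ck_on_ext k U f g : open U -> (forall z, U z -> f z = g z) ->
  Ck_on k U f -> Ck_on k U g.
Proof.
elim: k U f g => [|k IH] U f g oU fg hf.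
  by split=> //; apply: continuous_ext fg (Ck_on_cont hf).
case: hf => cf hf.
apply: (@Ck_on_intro k U g (fun i => pd i f)) => //.
- exact: continuous_ext fg cf.
- move=> i x Ux; have [hd _] := hf i; apply: (is_derive_ext oU fg Ux).
  by apply: DeriveDef => //; apply: hd; rewrite inE.
- by move=> i; have [] := hf i.
Qed.

Lemma Ck_onS k U f (g : 'I_n -> 'rV[R]_n -> R) : open U -> {in U, continuous f} ->
  (forall i x, U x -> is_derive x (delta_mx 0 i) f (g i x)) ->
  (forall i, Ck_on k U (g i)) -> Ck_on k.+1 U f.
Proof. by move=> *; apply: Ck_on_intro; eauto using Ck_on_ext. Qed.

Lemma Ck_on_pd k U f i : Ck_on k.+1 U f -> Ck_on k U (pd i f).
Proof. by move=> [_ h]; have [] := h i. Qed.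

Lemma Ck_on_cst k U c : open U -> Ck_on k U (cst c).
Proof.
move=> oU; elim: k c => [|k IH] c.
  by split=> // x _; exact: cst_continuous.
apply: (@Ck_onS k U _ (fun _ => cst 0)) => //.
by move=> x _; exact: cst_continuous.
Qed.

Lemma is_derive_coord v (i j : 'I_n) :
  is_derive v (delta_mx 0 i) (fun y : 'rV[R]_n => y 0 j) ((delta_mx 0 i : 'rV[R]_n) 0 j).
Proof.
apply/is_derive_line.
have : is_derive (0 : R) 1 (fun t : R => (delta_mx 0 i : 'rV[R]_n) 0 j * t + v 0 j)
    ((delta_mx 0 i : 'rV[R]_n) 0 j * 1 + 0).
  by apply: is_deriveD1; apply: is_deriveZ1.
rewrite mulr1 addr0; congr is_derive.
by apply/funext => t; rewrite !mxE mulrC.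
Qed.

Lemma Ck_on_coord k U (j : 'I_n) : open U -> Ck_on k U (fun x => x 0 j).
Proof.
move=> oU; have cc : {in U, continuous (fun x : 'rV[R]_n => x 0 j)}.
  by move=> x _; exact: coord_continuous.
case: k => [|k]; first by split.
apply: (@Ck_onS k U _ (fun i => cst ((delta_mx 0 i : 'rV[R]_n) 0 j))) => //.
- by move=> i x _; exact: is_derive_coord.
- by move=> i; exact: Ck_on_cst.
Qed.

Lemma Ck_onD k U f g : open U -> Ck_on k U f -> Ck_on k U g ->
  Ck_on k U (fun x => f x + g x).
Proof.
move=> oU; elim: k f g => [|k IH] f g hf hg.
  by split=> // x Ux; apply: continuousD; [exact: (Ck_on_cont hf)|exact: (Ck_on_cont hg)].
apply: (@Ck_onS k U _ (fun i x => pd i f x + pd i g x)) => //.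
- by move=> x Ux; apply: continuousD; [exact: (Ck_on_cont hf)|exact: (Ck_on_cont hg)].
- by move=> i x Ux; apply: is_deriveD1; [exact: (Ck_on_is_derive i hf)|exact: (Ck_on_is_derive i hg)].
- by move=> i; apply: IH; apply: Ck_on_pd.
Qed.

Lemma Ck_onM k U f g : open U -> Ck_on k U f -> Ck_on k U g ->
  Ck_on k U (fun x => f x * g x).
Proof.
move=> oU; elim: k f g => [|k IH] f g hf hg.
  by split=> // x Ux; apply: continuousM; [exact: (Ck_on_cont hf)|exact: (Ck_on_cont hg)].
apply: (@Ck_onS k U _ (fun i x => pd i f x * g x + f x * pd i g x)) => //.
- by move=> x Ux; apply: continuousM; [exact: (Ck_on_cont hf)|exact: (Ck_on_cont hg)].
- by move=> i x Ux; apply: is_deriveM1; [exact: (Ck_on_is_derive i hf)|exact: (Ck_on_is_derive i hg)].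
- by move=> i; apply: Ck_onD => //; apply: IH; (exact: Ck_on_pd || exact: Ck_on_le).
Qed.

Lemma Ck_onV k U f : open U -> (forall x, U x -> f x != 0) -> Ck_on k U f ->
  Ck_on k U (fun x => (f x)^-1).
Proof.
move=> oU f0; elim: k f f0 => [|k IH] f f0 hf.
  split=> // x; rewrite inE => Ux; apply: continuousV; first exact: f0.
  by apply: (Ck_on_cont hf); rewrite inE.
apply: (@Ck_onS k U _ (fun i x => -1 * ((f x)^-1 * (f x)^-1) * pd i f x)) => //.
- move=> x; rewrite inE => Ux; apply: continuousV; first exact: f0.
  by apply: (Ck_on_cont hf); rewrite inE.
- move=> i x Ux; apply: is_derive_eq (is_deriveV1 (f0 _ Ux) (Ck_on_is_derive i hf Ux)) _.
  by rewrite expr2 invfM mulN1r.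
- move=> i; have hV : Ck_on k U (fun x => (f x)^-1) by apply: IH => //; exact: Ck_on_le.
  apply: Ck_onM => //; last exact: Ck_on_pd.
  by apply: Ck_onM => //; [exact: Ck_on_cst|exact: Ck_onM].
Qed.

Lemma Ck_on_powR k U f a : open U -> (forall x, U x -> 0 < f x) -> Ck_on k U f ->
  Ck_on k U (fun x => f x `^ a).
Proof.
move=> oU f0; elim: k f a f0 => [|k IH] f a f0 hf.
  split=> // x; rewrite inE => Ux.
  apply: (@continuous_comp _ _ _ f (fun t => t `^ a)).
    by apply: (Ck_on_cont hf); rewrite inE.
  have [h _] := @is_derive1_powR R a (f x) (f0 _ Ux).
  exact/differentiable_continuous/derivable1_diffP.
apply: (@Ck_onS k U _ (fun i x => a * f x `^ (a - 1) * pd i f x)) => //.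
- move=> x; rewrite inE => Ux.
  apply: (@continuous_comp _ _ _ f (fun t => t `^ a)).
    by apply: (Ck_on_cont hf); rewrite inE.
  have [h _] := @is_derive1_powR R a (f x) (f0 _ Ux).
  exact/differentiable_continuous/derivable1_diffP.
- by move=> i x Ux; apply: is_derive_powR1 (Ck_on_is_derive i hf Ux); exact: f0.
- move=> i; apply: Ck_onM => //; last exact: Ck_on_pd.
  by apply: Ck_onM => //; [exact: Ck_on_cst|apply: IH => //; exact: Ck_on_le].
Qed.

Lemma Ck_on_expR k U f : open U -> Ck_on k U f ->
  Ck_on k U (fun x => expR (f x)).
Proof.
move=> oU; elim: k f => [|k IH] f hf.
  split=> // x Ux; apply: (@continuous_comp _ _ _ f expR); first exact: (Ck_on_cont hf).
  exact: continuous_expR.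
apply: (@Ck_onS k U _ (fun i x => expR (f x) * pd i f x)) => //.
- move=> x Ux; apply: (@continuous_comp _ _ _ f expR); first exact: (Ck_on_cont hf).
  exact: continuous_expR.
- by move=> i x Ux; apply: is_derive_expR1; exact: (Ck_on_is_derive i hf).
- by move=> i; apply: Ck_onM => //; [apply: IH; exact: Ck_on_le|exact: Ck_on_pd].
Qed.

Lemma Ck_on_sum k U (I : Type) (r : seq I) (P : pred I) (F : I -> 'rV[R]_n -> R) : open U ->
  (forall i, P i -> Ck_on k U (F i)) -> Ck_on k U (fun x => \sum_(i <- r | P i) F i x).
Proof.
move=> oU h; elim: r => [|i r IH].
  apply: (@Ck_on_ext k U (cst 0)) => //; last exact: Ck_on_cst.
  by move=> z _; rewrite big_nil.
apply: (@Ck_on_ext k U (fun x => if P i then F i x + \sum_(j <- r | P j) F j x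
   else \sum_(j <- r | P j) F j x)) => //.
  by move=> z _; rewrite big_cons.
case Pi: (P i); last exact: IH.
by apply: Ck_onD => //; apply: h.
Qed.

Lemma Ck_on_prod k U (I : Type) (r : seq I) (P : pred I) (F : I -> 'rV[R]_n -> R) : open U ->
  (forall i, P i -> Ck_on k U (F i)) -> Ck_on k U (fun x => \prod_(i <- r | P i) F i x).
Proof.
move=> oU h; elim: r => [|i r IH].
  apply: (@Ck_on_ext k U (cst 1)) => //; last exact: Ck_on_cst.
  by move=> z _; rewrite big_nil.
apply: (@Ck_on_ext k U (fun x => if P i then F i x * \prod_(j <- r | P j) F j x
   else \prod_(j <- r | P j) F j x)) => //.
  by move=> z _; rewrite big_cons.
case Pi: (P i); last exact: IH.
by apply: Ck_onM => //; apply: h.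
Qed.

End Closure.

Section VectorValued.
Variables (R : realType).

Lemma continuous_row n (T : topologicalType) (psi : T -> 'rV[R]_n) (t : T) :
  (forall j, {for t, continuous (fun s => psi s 0 j)}) -> {for t, continuous psi}.
Proof.
move=> h; apply/cvgrPdist_le => e e0; near=> s.
apply: row_norm_le => [|j]; first exact: ltW.
rewrite !mxE; move: j; near: s; apply: filter_forall => j.
by have /cvgrPdist_le := h j; apply.
Unshelve. all: by end_near. Qed.

Lemma differentiable_row (V : normedModType R) p (psi : V -> 'rV[R]_p) x :
  (forall j, differentiable (fun z => psi z 0 j : R^o) x) -> differentiable psi x.
Proof.
move=> h.
rewrite (_ : psi = \sum_(j < p) (fun z => psi z 0 j *: delta_mx 0 j)); last first.
  apply/funext => z; rewrite fct_sumE; exact: row_sum_delta.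
by apply: differentiable_sum => j; apply: differentiableZl.
Qed.

(** f is C^1 hence differentiable, which is what makes the chain rule available
    for an inner map psi known only through its directional derivatives. *)
Lemma is_derive_chain (V : normedModType R) p (f : 'rV[R]_p -> R) (psi : V -> 'rV[R]_p) x v
   (dpsi : 'I_p -> R) (U : set 'rV[R]_p) :
  open U -> Ck_on 1 U f -> U (psi x) ->
  (forall j, is_derive x v (fun z => psi z 0 j) (dpsi j)) ->
  is_derive x v (fun z => f (psi z)) (\sum_j dpsi j * pd j f (psi x)).
Proof.
move=> oU hf Ux hpsi; apply/is_derive_line.
pose c := fun t : R => psi (t *: v + x).
have c0 : c 0 = psi x by rewrite /c scale0r add0r.
have dc : derivable c 0 1.
  apply/derivable_mxP => i j; rewrite ord1.
  by have /is_derive_line [] := hpsi j.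
have [df Df] := C1_differentiable oU hf Ux.
rewrite -c0 in df.
have dcd : differentiable c 0 by apply/derivable1_diffP.
have dfc : differentiable (f \o c : R -> R^o) 0 by apply: differentiable_comp.
apply: DeriveDef; first by apply/derivable1_diffP.
rewrite -[LHS]/('D_1 (f \o c : R -> R^o) 0) deriveE // diff_comp //= c0 Df /grad.
apply: eq_bigr => j _; congr (_ * _).
rewrite -deriveE // derive_mx // mxE.
by have /is_derive_line [_] := hpsi j.
Qed.

End VectorValued.

Section Composition.
Variables (R : realType) (n p : nat).

Lemma Ck_on_comp k (U : set 'rV[R]_n) (W : set 'rV[R]_p) (f : 'rV[R]_p -> R)
    (psi : 'rV[R]_n -> 'rV[R]_p) : open U -> open W ->
  (forall x, U x -> W (psi x)) -> (forall j, Ck_on k U (fun x => psi x 0 j)) ->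
  Ck_on k W f -> Ck_on k U (fun x => f (psi x)).
Proof.
move=> oU oW UW; elim: k f => [|k IH] f hpsi hf.
  split=> // x Ux; apply: (@continuous_comp _ _ _ psi f).
    by apply: continuous_row => j; apply: (Ck_on_cont (hpsi j)).
  by apply: (Ck_on_cont hf); rewrite inE; apply: UW; rewrite -inE.
apply: (@Ck_onS _ _ k U _ (fun i x => \sum_j pd i (fun z => psi z 0 j) x * pd j f (psi x))) => //.
- move=> x Ux; apply: (@continuous_comp _ _ _ psi f).
    by apply: continuous_row => j; apply: (Ck_on_cont (hpsi j)).
  by apply: (Ck_on_cont hf); rewrite inE; apply: UW; rewrite -inE.
- move=> i x Ux; apply: (is_derive_chain oW _ (UW _ Ux)).
    by elim: (k) hf => // l IHl /Ck_on_le.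
  by move=> j; apply: (Ck_on_is_derive i (hpsi j)).
- move=> i; apply: Ck_on_sum => // j _; apply: Ck_onM => //; first exact: Ck_on_pd.
  apply: IH; last exact: Ck_on_pd.
  by move=> l; apply: Ck_on_le.
Qed.

End Composition.

#[local] Opaque pd.

(** * Symmetry of second derivatives; uniqueness for linear systems *)

Section Schwarz.
Variables (R : realType) (n : nat).
Implicit Types (U V : set 'rV[R]_n) (f g : 'rV[R]_n -> R) (x v : 'rV[R]_n).

Lemma ball_rV x z (r : R) : ball x r z <-> `|x - z| < r.
Proof. by rewrite -ball_normE. Qed.

Lemma delta_norm_le (i : 'I_n) : `|delta_mx 0 i : 'rV[R]_n| <= 1.
Proof.
apply: row_norm_le => // j; rewrite !mxE eqxx /=.
by case: eqP; rewrite ?normr1 ?normr0.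
Qed.

(** Two applications of the mean value theorem, first in the direction i and then
    in the direction j, evaluate the second difference of f over a small square as
    t^2 times a mixed derivative at some point of the square. *)
Lemma second_difference U f x i j (t d : R) : Ck_on 2 U f -> 0 < t -> 2 * t < d ->
  (forall z, `|x - z| < d -> U z) ->
  exists2 z, `|x - z| < d &
  (f (t *: delta_mx 0 i + (t *: delta_mx 0 j + x)) - f (t *: delta_mx 0 i + x)
   - (f (t *: delta_mx 0 j + x) - f x)) = t * (t * pd j (pd i f) z).
Proof.
move=> hf t0 td dU.
have near_x (a b : R) : 0 <= a <= 1 -> 0 <= b <= 1 ->
    `|x - (a *: (t *: delta_mx 0 i) + (b *: (t *: delta_mx 0 j) + x))| < d.
  move=> /andP[a0 a1] /andP[b0 b1]; apply: le_lt_trans td.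
  rewrite addrA opprD addrCA subrr addr0 normrN; apply: le_trans (ler_normD _ _) _.
  rewrite !normrZ (ger0_norm a0) (ger0_norm b0) (gtr0_norm t0) mulrDl mul1r.
  by apply: lerD; rewrite mulrA -[leRHS]mulr1 ler_pM ?delta_norm_le ?mulr_ge0 ?(ltW t0) // ler_piMl // ltW.
pose phi z := f (t *: delta_mx 0 j + z) - f z.
have hf1 : Ck_on 1 U f by exact: Ck_on_le.
have [|a a01 Ea] := @MVT_line R _ phi x (t *: delta_mx 0 i)
   (fun a => t * (pd i f (t *: delta_mx 0 j + (a *: (t *: delta_mx 0 i) + x)) - pd i f (a *: (t *: delta_mx 0 i) + x))).
- move=> a a01; apply: is_derive_scale; apply: is_deriveB1.
  + apply: (@is_derive_lin_comp _ _ _ f (fun z => t *: delta_mx 0 j + z) _ _ (delta_mx 0 i)).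
      by move=> s; rewrite addrCA.
    apply: (Ck_on_is_derive _ hf1); apply: dU.
    by rewrite addrCA -[t *: delta_mx 0 j]scale1r; apply: near_x => //; rewrite ler01 lexx.
  + apply: (Ck_on_is_derive _ hf1); apply: dU.
    by have := near_x a 0 a01; rewrite scale0r add0r; apply; rewrite lexx ler01.
set y := a *: (t *: delta_mx 0 i) + x in Ea.
have [|b b01 Eb] := @MVT_line R _ (pd i f) y (t *: delta_mx 0 j)
   (fun b => t * pd j (pd i f) (b *: (t *: delta_mx 0 j) + y)).
- move=> b b01; apply: is_derive_scale.
  apply: (Ck_on_is_derive _ (Ck_on_pd i hf)); apply: dU.
  by rewrite /y addrCA; exact: near_x.
exists (b *: (t *: delta_mx 0 j) + y); first by rewrite /y addrCA; exact: near_x.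
rewrite -Eb -Ea /phi; congr (_ - _ - _).
by rewrite addrCA.
Qed.

(** The second difference over a square is symmetric in i and j, so by
    [second_difference] the two mixed derivatives agree at points arbitrarily close
    to x; continuity concludes. *)
Lemma pdC U f x i j : open U -> Ck_on 2 U f -> U x ->
  pd i (pd j f) x = pd j (pd i f) x.
Proof.
move=> oU hf Ux; apply/eqP; rewrite -subr_eq0 -normr_le0; apply/ler_addgt0Pr => e e0.
rewrite add0r.
have e20 : 0 < e / 2 by rewrite divr_gt0.
have c2 (h : 'rV[R]_n -> R) : {in U, continuous h} -> \forall z \near x, `|h x - h z| <= e / 2.
  by move=> /(_ x); rewrite inE => /(_ Ux) /cvgrPdist_le; apply.
have n1 := c2 _ (Ck_on_cont (Ck_on_pd i (Ck_on_pd j hf))).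
have n2 := c2 _ (Ck_on_cont (Ck_on_pd j (Ck_on_pd i hf))).
have n3 : \forall z \near x, U z by exact: (open_nbhs_nbhs (conj oU Ux)).
have : \forall z \near x, [/\ U z, `|pd i (pd j f) x - pd i (pd j f) z| <= e / 2
   & `|pd j (pd i f) x - pd j (pd i f) z| <= e / 2].
  by apply: filterS (filterI (filterI n3 n1) n2) => z [[? ?] ?]; split.
move=> /nbhs_ballP[d /= d0 hd].
have hd' z : `|x - z| < d -> [/\ U z, `|pd i (pd j f) x - pd i (pd j f) z| <= e / 2
   & `|pd j (pd i f) x - pd j (pd i f) z| <= e / 2].
  by move=> /ball_rV /hd.
have t0 : 0 < d / 3 by rewrite divr_gt0.
have td : 2 * (d / 3) < d by lra.
have dU z : `|x - z| < d -> U z by move=> /hd' [].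
have [z1 h1 E1] := second_difference i j hf t0 td dU.
have [z2 h2 E2] := second_difference j i hf t0 td dU.
have E : pd j (pd i f) z1 = pd i (pd j f) z2.
  move: E1 E2; rewrite (addrCA (d / 3 *: delta_mx 0 j)).
  move: (pd j (pd i f) z1) (pd i (pd j f) z2) => X Y E1 E2.
  have E3 : d / 3 * (d / 3 * X) = d / 3 * (d / 3 * Y) by rewrite -E1 -E2; ring.
  have td0 := lt0r_neq0 t0.
  exact: (mulfI td0 (mulfI td0 E3)).
have [_ _ b1] := hd' _ h1; have [_ b2 _] := hd' _ h2.
move: (pd i (pd j f) x) (pd j (pd i f) x) (pd j (pd i f) z1) (pd i (pd j f) z2) E b1 b2.
move=> a b y z ->; rewrite !ler_norml => /andP[l1 l2] /andP[l3 l4].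
clear -e0 l1 l2 l3 l4.
apply/andP; split; lra.
Qed.

End Schwarz.

Section Gronwall.
Variables (R : realType).

(** g(t) exp (- C t) is nonincreasing. *)
Lemma gronwall_unit_interval (g dg : R -> R) C :
  (forall t : R, 0 <= t <= 1 -> is_derive t 1 g (dg t)) ->
  (forall t : R, 0 <= t <= 1 -> dg t <= C * g t) -> g 0 = 0 -> g 1 <= 0.
Proof.
move=> hg hle g0.
pose G (t : R) := g t * expR (- C * t).
have hG (t : R) : 0 <= t <= 1 -> is_derive t 1 G ((dg t - C * g t) * expR (- C * t)).
  move=> ht; have hl : is_derive t (1:R) (fun s : R => - C * s) (- C * 1).
    by apply: is_deriveZ1.
  apply: is_derive_eq (is_deriveM1 (hg t ht) (is_derive_expR1 hl)) _; ring.
have : G 1 <= G 0.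
  apply: (@ler0_derive1_le_cc _ G 0 1); rewrite ?in_itv /= ?lexx ?ler01 //.
  - move=> t; rewrite in_itv /= => /andP[t0 t1].
    by have [] := hG t; rewrite ?(ltW t0) ?(ltW t1).
  - move=> t; rewrite in_itv /= => /andP[t0 t1]; rewrite derive1E.
    have t01 : 0 <= t <= 1 by rewrite (ltW t0) (ltW t1).
    have [_ ->] := hG t t01.
    by rewrite mulr_le0_ge0 ?expR_ge0 // subr_le0 hle.
  - apply: derivable_within_continuous => t; rewrite in_itv /= => ht.
    by have [] := hG t ht.
by rewrite /G g0 mul0r pmulr_lle0 // expR_gt0.
Qed.

(** Uniqueness for an overdetermined linear homogeneous system.  On the segment
    from x0 to x the function g = |w|^2 satisfies g' <= 2 C g, where C bounds the
    coefficients on that compact segment, and g vanishes at x0. *)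
Lemma linear_system_zero n (I : finType) (x0 : 'rV[R]_n) (r : R) (w : I -> 'rV[R]_n -> R)
    (A : 'I_n -> I -> I -> 'rV[R]_n -> R) :
  (forall a, Ck_on 1 (ball x0 r) (w a)) ->
  (forall k a b, {in (ball x0 r : set 'rV[R]_n), continuous (A k a b)}) ->
  (forall k a x, ball x0 r x -> pd k (w a) x = \sum_b A k a b x * w b x) ->
  (forall a, w a x0 = 0) ->
  forall x, ball x0 r x -> forall a, w a x = 0.
Proof.
move=> hw hA hpd w0 x hx.
pose h := x - x0.
pose l (t : R) := t *: h + x0.
have lb (t : R) : 0 <= t <= 1 -> ball x0 r (l t).
  move=> /andP[t0 t1]; apply/ball_rV; move/ball_rV : hx; apply: le_lt_trans.
  rewrite /l opprD addrCA subrr addr0 normrN normrZ (ger0_norm t0) /h distrC.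
  by rewrite ler_piMl.
pose M a b (t : R) := \sum_k h 0 k * A k a b (l t).
pose S (t : R) := \sum_a \sum_b `|M a b t|.
have ob : open (ball x0 r) by exact: ball_open.
have cl : continuous l.
  move=> t; apply: (@continuousD R 'rV[R]_n R (fun s : R => s *: h) (fun=> x0)).
    exact: scalel_continuous.
  exact: cst_continuous.
have cS : {within `[0, 1], continuous S}.
  apply: continuous_in_subspaceT => t; rewrite inE /= in_itv /= => ht.
  apply: continuous_sum => a; apply: continuous_sum => b.
  apply: (@continuous_comp _ _ _ (M a b) (fun y => `|y|)); last exact: norm_continuous.
  apply: continuous_sum => k; apply: continuousM; first exact: cst_continuous.
  apply: (@continuous_comp _ _ _ l (A k a b)); first exact: cl.
  by apply: hA; rewrite inE; exact: lb.
have [c _ hc] := @EVT_max R S 0 1 ler01 cS.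
pose g (t : R) := \sum_a w a (l t) * w a (l t).
pose dg (t : R) := \sum_a ((\sum_b M a b t * w b (l t)) * w a (l t)
   + w a (l t) * (\sum_b M a b t * w b (l t))).
have hg (t : R) : 0 <= t <= 1 -> is_derive t 1 g (dg t).
  move=> ht; apply: is_derive_sum1 => a _.
  have hwa : is_derive t 1 (fun t => w a (l t)) (\sum_b M a b t * w b (l t)).
    apply: (@is_derive_lin_comp R _ R^o (w a) l 1 t h).
      by move=> s; rewrite /l -[s *: 1]/(s * 1) mulr1 scalerDl addrA.
    apply: is_derive_eq (C1_is_derive h ob (hw a) (lb t ht)) _.
    rewrite /grad.
    under eq_bigr do rewrite (hpd _ _ _ (lb t ht)) mulr_sumr.
    rewrite exchange_big /=; apply: eq_bigr => b _.
    by rewrite /M mulr_suml; apply: eq_bigr => k _; rewrite mulrA.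
  exact: is_deriveM1.
have gle : g 1 <= 0.
  apply: (@gronwall_unit_interval g dg (2 * S c)) => //; last first.
    by rewrite /g big1 // => a _; rewrite /l scale0r add0r w0 mul0r.
  move=> t ht.
  have sq0 a : 0 <= w a (l t) * w a (l t) by rewrite -expr2 sqr_ge0.
  have leg a : w a (l t) * w a (l t) <= g t.
    by rewrite /g (bigD1 a) //= lerDl sumr_ge0.
  apply: (@le_trans _ _ (\sum_a \sum_b (2 * `|M a b t|) * g t)).
    apply: ler_sum => a _; rewrite mulr_suml mulr_sumr -big_split /=.
    apply: ler_sum => b _.
    have h1 := leg a; have h2 := leg b.
    apply: le_trans (ler_norm _) _.
    set p := w a (l t) in h1 *; set q := w b (l t) in h2 *.
    have -> : M a b t * q * p + p * (M a b t * q) = M a b t * (2 * (p * q)) by ring.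
    rewrite normrM (_ : 2 * `|M a b t| * g t = `|M a b t| * (2 * g t)); last by ring.
    rewrite ler_wpM2l //.
    (* 2 |p q| <= p^2 + q^2, and both squares are at most g t *)
    have h3 : 0 <= (p - q) * (p - q) by rewrite -expr2 sqr_ge0.
    have h4 : 0 <= (p + q) * (p + q) by rewrite -expr2 sqr_ge0.
    rewrite ler_norml; apply/andP; split; lra.
  rewrite (_ : \sum_a _ = 2 * S t * g t); last first.
    rewrite /S; move: (g t) => gt; rewrite mulr_sumr mulr_suml; apply: eq_bigr => a _.
    by rewrite mulr_sumr mulr_suml.
  rewrite ler_wpM2r //; first by rewrite /g sumr_ge0.
  by rewrite ler_wpM2l // hc // in_itv.
move=> a; apply/eqP; rewrite -sqrf_eq0 expr2 -[x](subrK x0) -/h -[h]scale1r -/(l 1).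
rewrite eq_le; apply/andP; split; last by rewrite -expr2 sqr_ge0.
apply: le_trans gle; rewrite /g (bigD1 a) //= lerDl sumr_ge0 // => b _.
by rewrite -expr2 sqr_ge0.
Qed.

End Gronwall.

(** * Forms and polynomials on R^n *)

Section Forms.
Variables (R : realType) (n : nat).
Implicit Types (M N : 'M[R]_n) (u v w y : 'rV[R]_n) (i j l : 'I_n).

Definition mv M l v : R := \sum_j M l j * v 0 j.
Definition bil M u v : R := \sum_i u 0 i * mv M i v.
Definition tri (T : 'I_n -> 'M[R]_n) u v w : R := \sum_k u 0 k * bil (T k) v w.

Lemma quadE M y : quad M y = bil M y y.
Proof.
rewrite /quad /bil; apply: eq_bigr => i _; rewrite /mv mulr_sumr.
by apply: eq_bigr => j _; ring.
Qed.

Lemma linP (b : 'rV[R]_n) c u v : lin b (c *: u + v) = c * lin b u + lin b v.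
Proof.
rewrite /lin mulr_sumr -big_split /=; apply: eq_bigr => i _; rewrite !mxE; ring.
Qed.

Lemma lin0 (b : 'rV[R]_n) : lin b 0 = 0.
Proof. by rewrite /lin big1 // => i _; rewrite [X in _ * X]mxE mulr0. Qed.

Lemma lin_row b y : lin b y = \sum_i y 0 i * b 0 i.
Proof. by apply: eq_bigr => i _; rewrite mulrC. Qed.

Lemma mvP M l c u v : mv M l (c *: u + v) = c * mv M l u + mv M l v.
Proof.
rewrite /mv mulr_sumr -big_split /=; apply: eq_bigr => i _; rewrite !mxE; ring.
Qed.

Lemma bilPl M c u v w : bil M (c *: u + v) w = c * bil M u w + bil M v w.
Proof.
rewrite /bil mulr_sumr -big_split /=; apply: eq_bigr => i _; rewrite !mxE; ring.
Qed.

Lemma bilPr M c u v w : bil M w (c *: u + v) = c * bil M w u + bil M w v.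
Proof.
rewrite /bil mulr_sumr -big_split /=; apply: eq_bigr => i _; rewrite mvP; ring.
Qed.

Lemma triP1 T c u v w z : tri T (c *: u + v) w z = c * tri T u w z + tri T v w z.
Proof.
rewrite /tri mulr_sumr -big_split /=; apply: eq_bigr => i _; rewrite !mxE; ring.
Qed.

Lemma triP2 T c u v w z : tri T w (c *: u + v) z = c * tri T w u z + tri T w v z.
Proof.
rewrite /tri mulr_sumr -big_split /=; apply: eq_bigr => i _; rewrite bilPl; ring.
Qed.

Lemma triP3 T c u v w z : tri T w z (c *: u + v) = c * tri T w z u + tri T w z v.
Proof.
rewrite /tri mulr_sumr -big_split /=; apply: eq_bigr => i _; rewrite bilPr; ring.
Qed.

Lemma bil_sum_mv M u v : bil M u v = \sum_i u 0 i * mv M i v.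
Proof. by []. Qed.

Lemma lin_repr (f : 'rV[R]_n -> R) :
  (forall c u v, f (c *: u + v) = c * f u + f v) -> exists r, forall y, f y = lin r y.
Proof.
move=> hf; exists (\row_i f (delta_mx 0 i)) => y.
have f0 : f 0 = 0.
  by have := hf 1 0 0; rewrite scale1r addr0 mul1r => E; lra.
have fS (I : Type) (r : seq I) (c : I -> R) (g : I -> 'rV[R]_n) :
    f (\sum_(i <- r) c i *: g i) = \sum_(i <- r) c i * f (g i).
  by elim: r => [|i r IH]; rewrite ?big_nil // !big_cons hf IH.
rewrite {1}[y]row_sum_delta fS /lin; apply: eq_bigr => i _.
by rewrite mxE mulrC.
Qed.

Lemma lin_delta (b : 'rV[R]_n) i : lin b (delta_mx 0 i) = b 0 i.
Proof.
rewrite /lin (bigD1 i) //= mxE !eqxx mulr1 big1 ?addr0 // => j ji.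
by rewrite mxE eqxx (negbTE ji) mulr0.
Qed.

Lemma lin_inj (b c : 'rV[R]_n) : (forall y, lin b y = lin c y) -> b = c.
Proof. by move=> h; apply/rowP => i; rewrite -!lin_delta. Qed.

Lemma mv_delta M l i : mv M l (delta_mx 0 i) = M l i.
Proof.
rewrite /mv (bigD1 i) //= mxE !eqxx mulr1 big1 ?addr0 // => j ji.
by rewrite mxE eqxx (negbTE ji) mulr0.
Qed.

Lemma bil_delta M i j : bil M (delta_mx 0 i) (delta_mx 0 j) = M i j.
Proof.
rewrite /bil (bigD1 i) //= mv_delta mxE !eqxx mul1r big1 ?addr0 // => k ki.
by rewrite mxE eqxx (negbTE ki) mul0r.
Qed.

Lemma quad_polar M N : (forall y, quad M y = quad N y) ->
  forall i j, M i j + M j i = N i j + N j i.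
Proof.
move=> h i j.
have h1 := h (1 *: delta_mx 0 i + delta_mx 0 j).
have h2 := h (delta_mx 0 i); have h3 := h (delta_mx 0 j).
move: h1 h2 h3; rewrite !quadE !(bilPl, bilPr) !bil_delta => h1 h2 h3.
lra.
Qed.

End Forms.

Section PolynomialAlongLines.
Variables (R : realType) (n : nat).
Implicit Types (f g : 'rV[R]_n -> R).

(** Polynomial functions on R^n are used only through their restrictions to lines:
    this avoids multivariate polynomials and is enough for identities to propagate
    from a dense set of each line. *)
Definition polyline f := forall u v, exists p : {poly R}, forall s, f (s *: u + v) = p.[s].

Lemma polyline_cst c : polyline (fun=> c).
Proof. by move=> u v; exists c%:P => s; rewrite hornerC. Qed.

Lemma polyline_coord i : polyline (fun y => y 0 i).
Proof.
move=> u v; exists ((u 0 i)%:P * 'X + (v 0 i)%:P) => s.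
by rewrite !mxE hornerD hornerM !hornerC hornerX mulrC.
Qed.

Lemma polylineD f g : polyline f -> polyline g -> polyline (fun y => f y + g y).
Proof.
move=> hf hg u v; have [p hp] := hf u v; have [q hq] := hg u v.
by exists (p + q) => s; rewrite hornerD hp hq.
Qed.

Lemma polylineM f g : polyline f -> polyline g -> polyline (fun y => f y * g y).
Proof.
move=> hf hg u v; have [p hp] := hf u v; have [q hq] := hg u v.
by exists (p * q) => s; rewrite hornerM hp hq.
Qed.

Lemma polylineN f : polyline f -> polyline (fun y => - f y).
Proof.
move=> hf u v; have [p hp] := hf u v.
by exists (- p) => s; rewrite hornerN hp.
Qed.

Lemma polyline_sum (I : Type) (r : seq I) (F : I -> 'rV[R]_n -> R) :
  (forall i, polyline (F i)) -> polyline (fun y => \sum_(i <- r) F i y).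
Proof.
move=> h; elim: r => [|i r IH] u v.
  by exists 0 => s; rewrite big_nil horner0.
have [p hp] := h i u v; have [q hq] := IH u v.
by exists (p + q) => s; rewrite big_cons hornerD hp hq.
Qed.

Lemma polyline_lin b : polyline (@lin R n b).
Proof.
apply: polyline_sum => i; apply: polylineM; [exact: polyline_cst|exact: polyline_coord].
Qed.

Lemma polyline_mv M l : polyline (@mv R n M l).
Proof.
apply: polyline_sum => i; apply: polylineM; [exact: polyline_cst|exact: polyline_coord].
Qed.

Lemma polyline_quad M : polyline (@quad R n M).
Proof.
apply: polyline_sum => i; apply: polyline_sum => j.
apply: polylineM; last exact: polyline_coord.
apply: polylineM; [exact: polyline_cst|exact: polyline_coord].
Qed.

Lemma polyline_bil M : polyline (fun y => bil M y y).
Proof.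
by apply: polyline_sum => i; apply: polylineM; [exact: polyline_coord|exact: polyline_mv].
Qed.

Lemma polyline_tri (T : 'I_n -> 'M[R]_n) : polyline (fun y => tri T y y y).
Proof.
by apply: polyline_sum => i; apply: polylineM; [exact: polyline_coord|exact: polyline_bil].
Qed.

(** The positive numbers whose square is not c are infinitely many; an explicit
    infinite family is |c| + 1 + i, because (|c| + 1 + i)^2 > c. *)
Lemma poly_eq0_pos (p : {poly R}) (c : R) :
  (forall s, 0 < s -> s ^+ 2 != c -> p.[s] = 0) -> p = 0.
Proof.
move=> h.
pose rs := [seq (`|c| + 1 + i%:R : R) | i <- iota 0 (size p)].
apply: (@roots_geq_poly_eq0 _ p rs).
- apply/allP => x /mapP[i _ ->]; apply/eqP; apply: h.
    by rewrite ltr_wpDr ?ler0n // ltr_wpDl.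
  apply/eqP => E; have : c <= `|c| := ler_norm c.
  have c0 : 0 <= `|c| by [].
  have i0 : (0 : R) <= i%:R by rewrite ler0n.
  have : 0 <= `|c| * `|c| by rewrite mulr_ge0.
  have : 0 <= `|c| * i%:R by rewrite mulr_ge0.
  have : 0 <= (i%:R : R) * i%:R by rewrite mulr_ge0.
  by rewrite -{1}E; nra.
- rewrite map_inj_uniq ?iota_uniq // => i j /addrI /eqP.
  by rewrite eqr_nat => /eqP.
- by rewrite size_map size_iota.
Qed.

End PolynomialAlongLines.

Ltac polyline_tac := repeat first
  [ apply: polylineD | apply: polylineN | apply: polylineM
  | apply: polyline_quad | apply: polyline_lin | apply: polyline_mv
  | apply: polyline_bil | apply: polyline_tri | apply: polyline_coord | apply: polyline_cst
  | (apply: polyline_sum => ?) ].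

(** The conclusion says that q = h X^2 + k divides the cubic C.  As q is prime to X
    it divides C^2, hence the square of the remainder r0 + r1 X of C.  Reducing that
    square with h X^2 = - k gives r0^2 - k r1^2 / h + 2 r0 r1 X, which is too short
    to be a nonzero multiple of q; so r0 r1 = 0 and h r0^2 = k r1^2, whence
    r0 = r1 = 0. *)
Lemma quadratic_divides_cubic (R : realType) (h k c g0 g1 g2 g3 : R) (W : {poly R}) :
  0 < h -> 0 < k -> c != 0 ->
  (forall s, c * (g0 + g1 * s + g2 * s ^+ 2 + g3 * s ^+ 3) ^+ 2 * s ^+ 3
     = (h * s ^+ 2 + k) * W.[s]) ->
  g0 * h = k * g2 /\ g1 * h = k * g3.
Proof.
move=> h0 k0 c0 H.
have hn0 := lt0r_neq0 h0; have kn0 := lt0r_neq0 k0.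
pose q : {poly R} := h *: 'X^2 + k%:P.
pose v := g3 / h; pose u := g2 / h.
pose r0 := g0 - k * u; pose r1 := g1 - k * v.
pose C : {poly R} := q * (u%:P + v *: 'X) + (r0%:P + r1 *: 'X).
have CE s : C.[s] = g0 + g1 * s + g2 * s ^+ 2 + g3 * s ^+ 3.
  rewrite /C /q !hornerE /= /r0 /r1 /u /v; field => //.
have E : c%:P * C ^+ 2 * 'X^3 = q * W.
  apply/eqP; rewrite -subr_eq0; apply/eqP; apply: (@poly_eq0_pos R _ 0) => s _ _.
  have -> : (c%:P * C ^+ 2 * 'X^3 - q * W).[s] = c * C.[s] ^+ 2 * s ^+ 3 - q.[s] * W.[s].
    by rewrite hornerD hornerN 2!hornerM (hornerM _ W) hornerC hornerXn horner_exp.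
  rewrite CE H (_ : q.[s] = h * s ^+ 2 + k) ?subrr //.
  by rewrite /q hornerD hornerZ hornerXn hornerC.
have cop : coprimep q 'X.
  rewrite -['X]subr0 -polyC0 coprimep_XsubC /root /q hornerD hornerZ hornerXn hornerC.
  by rewrite expr0n /= mulr0 add0r.
have szq : size q = 3%N.
  rewrite /q size_polyDl ?size_scale ?size_polyXn //.
  by rewrite (leq_ltn_trans (size_polyC_leq1 _)).
have d1 : q %| C ^+ 2.
  have : q %| c%:P * C ^+ 2 * 'X^3 by rewrite E dvdp_mulr.
  rewrite Gauss_dvdpl; last exact: coprimep_expr.
  by rewrite mul_polyC dvdpZr.
have d2 : q %| (r0%:P + r1 *: 'X) ^+ 2.
  have : q %| C ^+ 2 - q * ((u%:P + v *: 'X) * (C + (r0%:P + r1 *: 'X))).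
    by rewrite dvdp_sub // dvdp_mulr.
  congr (q %| _); rewrite /C; ring.
have d3 : q %| (r0 ^+ 2 - k * r1 ^+ 2 / h)%:P + (2 * r0 * r1) *: 'X.
  have : q %| (r0%:P + r1 *: 'X) ^+ 2 - q * (r1 ^+ 2 / h)%:P.
    by rewrite dvdp_sub // dvdp_mulr.
  congr (q %| _).
  have hh : h%:P * (h^-1)%:P = 1 :> {poly R} by rewrite -polyCM divff.
  have -> : (r0 ^+ 2 - k * r1 ^+ 2 / h)%:P + (2 * r0 * r1) *: 'X =
    r0%:P ^+ 2 - k%:P * (r1%:P ^+ 2 * (h^-1)%:P) + 2 * r0%:P * r1%:P * 'X.
    by rewrite -!mul_polyC polyCB !polyCM polyC_natr; ring.
  have -> : (r1 ^+ 2 / h)%:P = r1%:P ^+ 2 * (h^-1)%:P by rewrite !polyCM; ring.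
  rewrite /q -!mul_polyC.
  transitivity (r0%:P ^+ 2 - k%:P * (r1%:P ^+ 2 * (h^-1)%:P) + 2 * r0%:P * r1%:P * 'X
     + (r1%:P ^+ 2 * 'X^2) * (1 - h%:P * (h^-1)%:P)); first ring.
  by rewrite hh subrr mulr0 addr0.
have z3 : (r0 ^+ 2 - k * r1 ^+ 2 / h)%:P + (2 * r0 * r1) *: 'X = 0 :> {poly R}.
  apply/eqP; apply: contraT => nz; have := dvdp_leq nz d3; rewrite szq leqNgt.
  rewrite (leq_ltn_trans (size_polyD _ _)) //.
  rewrite gtn_max (leq_ltn_trans (size_polyC_leq1 _)) //=.
  by rewrite (leq_ltn_trans (size_scale_leq _ _)) // size_polyX.
have ev s : r0 ^+ 2 - k * r1 ^+ 2 / h + 2 * r0 * r1 * s = 0.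
  have := congr1 (fun p : {poly R} => p.[s]) z3.
  by rewrite hornerD hornerC hornerZ hornerX horner0.
have e0 : r0 ^+ 2 - k * r1 ^+ 2 / h = 0 by have := ev 0; rewrite mulr0 addr0.
have e1 : 2 * r0 * r1 = 0 by have := ev 1; rewrite e0 add0r mulr1.
have r10 : r1 = 0.
  move/eqP : e1; rewrite !mulf_eq0 pnatr_eq0 /= => /orP[/eqP r00|/eqP //].
  move: e0; rewrite r00 expr0n /= sub0r => /eqP.
  by rewrite oppr_eq0 !mulf_eq0 invr_eq0 (negbTE hn0) (negbTE kn0) orbF /= orbb => /eqP.
have r00 : r0 = 0.
  by move: e0; rewrite r10 expr0n /= mulr0 mul0r subr0 => /eqP; rewrite sqrf_eq0 => /eqP.
have -> : g0 = k * u by apply/eqP; rewrite -subr_eq0 -/r0 r00.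
have -> : g1 = k * v by apply/eqP; rewrite -subr_eq0 -/r1 r10.
by rewrite /u /v; split; field.
Qed.

(** * Projective flatness at one point *)

Section PointwiseAlgebra.
Variables (R : realType) (n : nat) (m : R).
Variables (a : 'M[R]_n) (b e : 'rV[R]_n) (h B : R).
Variables (T : 'I_n -> 'M[R]_n) (S : 'M[R]_n).
Hypotheses (m_neq0 : m != 0) (m_neq1 : m != 1).
Hypothesis a_sym : forall i j, a i j = a j i.
Hypothesis T_sym : forall l i j, T l i j = T l j i.
Hypothesis a_pos : forall y, y != 0 -> 0 < quad a y.
Hypothesis h_gt0 : 0 < h.
(* e is the vector dual to b, normalised by b(e) = 1, so h = 1 / B = a(e, e). *)
Hypothesis Bh1 : B * h = 1.
Hypothesis e_dual : forall z, bil a e z = h * lin b z.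
Hypothesis lin_be : lin b e = 1.
Implicit Types y z : 'rV[R]_n.

(** The second condition guarantees that the fundamental tensor is invertible at y,
    see [fundamental_unit]. *)
Definition regular_direction y : Prop :=
  0 < lin b y /\ m * B * quad a y - (1 + m) * lin b y ^+ 2 != 0.

(** The l-th component of the equation G = P y, with P replaced by the value
    (2 m be0 / be + (1 - m) A0 / A) / 4 that it forces, multiplied by A^2 be^2 to
    become polynomial in y.  S k i and T k i j stand for the derivatives of b_i and
    a_ij in the direction k. *)
Definition projective_defect (l : 'I_n) y : R :=
  let A := quad a y in let be := lin b y in
  let A0 := tri T y y y in let be0 := bil S y y in
  2^-1 * (2 * m * be0 * A + (1 - m) * A0 * be)
    * (2 * m * b 0 l * A + 2 * (1 - m) * mv a l y * be)
  + 2 * m * (mv S^T l y * be * A ^+ 2 - be0 * b 0 l * A ^+ 2)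
  + 2 * (1 - m) * ((\sum_k y 0 k * mv (T k) l y) * A * be ^+ 2
                   - A0 * mv a l y * be ^+ 2)
  - 2 * m * mv S l y * be * A ^+ 2 - (1 - m) * quad (T l) y * A * be ^+ 2.

Hypothesis defect0 : forall y l, regular_direction y -> projective_defect l y = 0.
(* What K = 0 says when m = -1; see [flat_kropina_divides]. *)
Hypothesis flat0 : m = -1 -> exists2 W, polyline W &
  forall y, regular_direction y -> 3 * tri T y y y ^+ 2 * lin b y ^+ 2 = quad a y * W y.

Lemma bil_symE (M : 'M[R]_n) u v : (forall i j, M i j = M j i) -> bil M u v = bil M v u.
Proof.
move=> hM; rewrite /bil /mv.
under eq_bigr do rewrite mulr_sumr.
under [RHS]eq_bigr do rewrite mulr_sumr.
rewrite exchange_big /=; apply: eq_bigr => i _; apply: eq_bigr => j _.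
rewrite (hM j i); ring.
Qed.

Lemma quad_split s z : quad a (s *: e + z) = h * s ^+ 2 + 2 * (h * s * lin b z) + quad a z.
Proof.
rewrite !quadE !(bilPl, bilPr) (bil_symE z e a_sym) !e_dual lin_be.
ring.
Qed.

Lemma regular_direction_split s z : lin b z = 0 -> 0 < s -> s ^+ 2 != m * B * quad a z ->
  regular_direction (s *: e + z).
Proof.
move=> bz s0 hs; rewrite /regular_direction linP lin_be bz mulr1 addr0; split => //.
rewrite quad_split bz !mulr0 addr0.
have -> : m * B * (h * s ^+ 2 + quad a z) - (1 + m) * s ^+ 2 =
   m * s ^+ 2 * (B * h - 1) + (m * B * quad a z - s ^+ 2) by ring.
by rewrite Bh1 subrr mulr0 add0r subr_eq0 eq_sym.
Qed.

(** On a line s e + z with b(z) = 0 the regular directions are the s > 0 with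
    s^2 <> m B a(z, z): all but finitely many positive s. *)
Lemma dense_regular_direction f : polyline f ->
  (forall y, regular_direction y -> f y = 0) -> forall y, f y = 0.
Proof.
move=> pf hf y.
pose z := - lin b y *: e + y.
have bz : lin b z = 0 by rewrite linP lin_be mulr1 addNr.
have [p hp] := pf e z.
have yE : y = lin b y *: e + z by rewrite /z scaleNr addNKr.
rewrite yE hp (_ : p = 0) ?horner0 //.
apply: (@poly_eq0_pos R p (m * B * quad a z)) => s s0 hs.
by rewrite -hp hf //; exact: regular_direction_split.
Qed.

Lemma polyline_defect l : polyline (projective_defect l).
Proof. rewrite /projective_defect /= ; polyline_tac. Qed.

Lemma defect_everywhere l y : projective_defect l y = 0.
Proof.
by apply: dense_regular_direction; [exact: polyline_defect|move=> z; exact: defect0].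
Qed.

Lemma b_neq0 : exists l, b 0 l != 0.
Proof.
apply/existsP; rewrite -negb_forall; apply/negP => /forallP b0.
have : lin b e = 0 by rewrite /lin big1 // => i _; rewrite (eqP (b0 i)) mul0r.
by rewrite lin_be => /eqP; rewrite oner_eq0.
Qed.

Lemma beta0_vanishes z : lin b z = 0 -> bil S z z = 0.
Proof.
move=> bz.
have [->|z0] := eqVneq z 0.
  by rewrite /bil big1 // => i _; rewrite mxE mul0r.
have [l bl] := b_neq0; have := defect_everywhere l z; rewrite /projective_defect /= bz.
have A0 : quad a z != 0 by rewrite gt_eqF // a_pos.
move=> E; have : 2 * m * (m - 1) * b 0 l * quad a z ^+ 2 * bil S z z = 0 by rewrite -[RHS]E; field.
move/eqP; rewrite mulf_eq0 => /orP[|/eqP //].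
by rewrite !mulf_eq0 pnatr_eq0 subr_eq0 (negbTE m_neq0) (negbTE m_neq1) (negbTE bl) (negbTE A0).
Qed.

(** The quadratic form be0 vanishes on the hyperplane be = 0, so it is be times a
    linear form, which is read off by decomposing y along e. *)
Lemma beta0_divisible : exists mu : 'rV[R]_n, forall y, bil S y y = 2 * lin b y * lin mu y.
Proof.
have [mu hmu] : exists r, forall y, 2^-1 * (bil S e y + bil S y e - lin b y * bil S e e) = lin r y.
  by apply: lin_repr => c u v; rewrite bilPr bilPl linP; ring.
exists mu => y; rewrite -hmu.
have bz : lin b (- lin b y *: e + y) = 0 by rewrite linP lin_be mulr1 addNr.
have := beta0_vanishes bz; rewrite !(bilPl, bilPr).
by move: (lin b y) (bil S e e) (bil S e y) (bil S y e) (bil S y y) => c p q r t E; nra.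
Qed.

(** Contracting the defect with e isolates A0 y(e) be^2 modulo A when m <> -1, and
    y(e) is a multiple of be.  The extra factor A0 makes this case have the same
    shape as the case m = -1, where K = 0 yields only the square of A0. *)
Lemma alpha0_sq_divisible : exists c W, [/\ c != 0, polyline W &
  forall y, c * tri T y y y ^+ 2 * lin b y ^+ 3 = quad a y * W y].
Proof.
have [mE|mN] := eqVneq m (-1).
  have [W pW hW] := flat0 mE.
  exists 3, (fun y => W y * lin b y); split; [by rewrite pnatr_eq0|by polyline_tac|].
  move=> y; apply/eqP; rewrite -subr_eq0; apply/eqP; move: y.
  apply: dense_regular_direction; first by polyline_tac.
  by move=> y ry; rewrite mulrA -hW //; ring.
have [W pW hW] : exists2 W, polyline W & forall y,
   (1 - m) * (1 + m) * tri T y y y * (\sum_l e 0 l * mv a l y) * lin b y ^+ 2 = quad a y * W y.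
  exists (fun y => \sum_l e 0 l * (let A := quad a y in let be := lin b y in
  let A0 := tri T y y y in let be0 := bil S y y in
    2^-1 * (2 * m * be0) * (2 * m * b 0 l * A + 2 * (1 - m) * mv a l y * be)
    + (1 - m) * A0 * be * m * b 0 l
    + 2 * m * (mv S^T l y * be * A - be0 * b 0 l * A)
    + 2 * (1 - m) * ((\sum_k y 0 k * mv (T k) l y) * be ^+ 2)
    - 2 * m * mv S l y * be * A - (1 - m) * quad (T l) y * be ^+ 2)).
    by rewrite /=; polyline_tac.
  move=> y; rewrite [RHS]mulr_sumr [X in X * _ = _]mulr_sumr mulr_suml; apply: eq_bigr => l _.
  apply/eqP; rewrite -subr_eq0; apply/eqP.
  transitivity (- e 0 l * projective_defect l y); last by rewrite defect_everywhere mulr0.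
  by rewrite /projective_defect /=; field.
exists ((1 - m) * (1 + m) * h), (fun y => W y * tri T y y y); split.
- rewrite !mulf_neq0 ?(lt0r_neq0 h_gt0) //; first by rewrite subr_eq0 eq_sym.
  by rewrite addrC -[1]opprK subr_eq0.
- by polyline_tac.
- move=> y; rewrite mulrA -hW -bil_sum_mv e_dual; ring.
Qed.

(** On each line s e + z with b(z) = 0 the form A is h s^2 + a(z, z) and be is s, so
    [quadratic_divides_cubic] gives the divisibility of the cubic A0 by A there; the
    quotient it produces is the restriction of one linear form la. *)
Lemma alpha0_divisible : exists la : 'rV[R]_n, forall y, tri T y y y = 4 * quad a y * lin la y.
Proof.
have [c [W [c0 pW hW]]] := alpha0_sq_divisible.
pose L y := tri T y e e + tri T e y e + tri T e e y.
have [la hla] : exists r, forall y, (L y - 2 * lin b y * tri T e e e) / (4 * h) = lin r y.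
  by apply: lin_repr => k u v; rewrite /L triP1 triP2 triP3 linP; ring.
exists la => y; rewrite -hla.
have hn0 := lt0r_neq0 h_gt0.
pose z := - lin b y *: e + y.
have bz : lin b z = 0 by rewrite linP lin_be mulr1 addNr.
have yE : y = lin b y *: e + z by rewrite /z scaleNr addNKr.
clearbody z.
pose Q := tri T e z z + tri T z e z + tri T z z e.
have triE s : tri T (s *: e + z) (s *: e + z) (s *: e + z) =
   tri T z z z + Q * s + L z * s ^+ 2 + tri T e e e * s ^+ 3.
  by rewrite !(triP1, triP2, triP3) /Q /L; ring.
have [E0 E1] : tri T z z z * h = quad a z * L z /\ Q * h = quad a z * tri T e e e.
  have [z0|z0] := eqVneq z 0.
    have t0 u v : tri T 0 u v = 0 by have := triP1 T 1 0 0 u v; rewrite scale1r addr0 mul1r => ?; lra.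
    have t1 u v : tri T u 0 v = 0 by have := triP2 T 1 0 0 u v; rewrite scale1r addr0 mul1r => ?; lra.
    have q0 : quad a 0 = 0 by rewrite /quad big1 // => i _; rewrite big1 // => j _; rewrite !mxE mulr0.
    by rewrite /Q z0 !t0 t1 q0 !mul0r !addr0 mul0r.
  have [p hp] := pW e z.
  apply: (@quadratic_divides_cubic R h (quad a z) c _ _ _ _ p) => //; first exact: a_pos.
  move=> s; rewrite -hp -triE.
  have := hW (s *: e + z); rewrite quad_split linP lin_be bz !mulr0 mulr1 !addr0.
  by move=> ->.
have Ly : L y = L z + 3 * lin b y * tri T e e e.
  rewrite {1}yE /L !(triP1, triP2, triP3); ring.
have lhs : tri T y y y = tri T z z z + Q * lin b y + L z * lin b y ^+ 2 + tri T e e e * lin b y ^+ 3.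
  by rewrite -triE -yE.
have qy : quad a y = h * lin b y ^+ 2 + quad a z.
  by rewrite {1}yE quad_split bz !mulr0 addr0.
rewrite lhs Ly qy.
have -> : tri T z z z = quad a z * L z / h by rewrite -E0 mulfK.
have -> : Q = quad a z * tri T e e e / h by rewrite -E1 mulfK.
by field.
Qed.

(** With be0 = 2 be mu and A0 = 4 A la the equation G = P y becomes
    2 m X_l A + (1 - m) be Z_l = 0 with X_l linear and Z_l quadratic in y.  Hence
    be divides X_l, A divides Z_l, and polarisation turns both divisibilities into
    formulas for the components of S and T; the covectors c and d are the
    resulting quotients up to multiples of mu, la and p. *)
Lemma projective_structure : exists p c d : 'rV[R]_n,
  [/\ forall l i j, T l i j = p 0 i * a j l + p 0 j * a i l + a i j * d 0 l,
      forall l i, S l i = p 0 i * b 0 l + b 0 i * c 0 l,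
      forall l, 2 * m * c 0 l + (1 - m) * d 0 l = 2 * p 0 l &
      forall y, regular_direction y ->
        4^-1 * (2 * m * (bil S y y / lin b y) + (1 - m) * (tri T y y y / quad a y)) = lin p y].
Proof.
have [mu hmu] := beta0_divisible.
have [la hla] := alpha0_divisible.
pose p : 'rV[R]_n := \row_i (m * mu 0 i + (1 - m) * la 0 i).
have pE y : lin p y = m * lin mu y + (1 - m) * lin la y.
  rewrite /lin !mulr_sumr -big_split /=; apply: eq_bigr => i _; rewrite mxE; ring.
have p_i i : p 0 i = m * mu 0 i + (1 - m) * la 0 i by rewrite mxE.
clearbody p.
pose X l y := mv S l y - mv S^T l y + 2 * (lin mu y - lin p y) * b 0 l.
pose Z l y := quad (T l) y - 2 * (\sum_k y 0 k * mv (T k) l y)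
   + (8 * lin la y - 4 * lin p y) * mv a l y.
have hn l y : 2 * m * X l y * quad a y + (1 - m) * lin b y * Z l y = 0.
  move: y; apply: dense_regular_direction; first by rewrite /X /Z; polyline_tac.
  move=> y [b0 _]; have := defect_everywhere l y.
  have y0 : y != 0.
    by apply: contraTneq b0 => ->; rewrite lin0 ltxx.
  have A0 := a_pos y0.
  rewrite /projective_defect /= hmu hla => E.
  have : (2 * m * X l y * quad a y + (1 - m) * lin b y * Z l y) * (quad a y * lin b y) = 0.
    by rewrite -[RHS]oppr0 -E /X /Z pE; field.
  move/eqP; rewrite mulf_eq0 => /orP[/eqP //|].
  by rewrite mulf_eq0 (gt_eqF b0) (gt_eqF A0).
have XP l k u v : X l (k *: u + v) = k * X l u + X l v.
  by rewrite /X !mvP !linP; ring.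
have X0 l y : lin b y = 0 -> X l y = 0.
  move=> by0; have [->|y0] := eqVneq y 0.
    by have := XP l 1 0 0; rewrite scale1r addr0 mul1r => ?; lra.
  have := hn l y; rewrite by0 mulr0 mul0r addr0 => /eqP.
  by rewrite !mulf_eq0 pnatr_eq0 (negbTE m_neq0) (gt_eqF (a_pos y0)) orbF => /eqP.
have XE l y : X l y = lin b y * X l e.
  have bz : lin b (- lin b y *: e + y) = 0 by rewrite linP lin_be mulr1 addNr.
  have := X0 l _ bz; rewrite XP => E; lra.
have m10 : 1 - m != 0 by rewrite subr_eq0 eq_sym.
pose d' : 'rV[R]_n := \row_l (- 2 * m * X l e / (1 - m)).
have d'X l : (1 - m) * d' 0 l = - 2 * m * X l e by rewrite mxE mulrC divfK.
clearbody d'.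
have ZE l y : Z l y = quad a y * d' 0 l.
  apply/eqP; rewrite -subr_eq0; apply/eqP; move: y.
  apply: dense_regular_direction; first by rewrite /Z; polyline_tac.
  move=> y [b0 _]; have := hn l y; rewrite XE => E.
  have : (1 - m) * lin b y * (Z l y - quad a y * d' 0 l) = 0.
    rewrite -[RHS]E; transitivity ((1 - m) * lin b y * Z l y - lin b y * quad a y * ((1 - m) * d' 0 l)); first ring.
    by rewrite d'X; ring.
  move/eqP; rewrite mulf_eq0 => /orP[|/eqP //].
  by rewrite mulf_eq0 (negbTE m10) (gt_eqF b0).
(* Contracting Z_l with y identifies the quotient d' as 4 la - 4 p. *)
have sumZ y : \sum_l y 0 l * Z l y = (4 * lin la y - 4 * lin p y) * quad a y.
  rewrite /Z.
  under eq_bigr do rewrite mulrDr mulrBr.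
  rewrite big_split sumrB /=.
  have -> : \sum_i y 0 i * quad (T i) y = tri T y y y.
    by apply: eq_bigr => i _; rewrite quadE.
  have -> : \sum_i y 0 i * (2 * (\sum_k y 0 k * mv (T k) i y)) = 2 * tri T y y y.
    under eq_bigr do rewrite mulrCA mulr_sumr.
    rewrite -mulr_sumr exchange_big /=; congr (2 * _).
    apply: eq_bigr => k _; rewrite /bil mulr_sumr; apply: eq_bigr => i _; ring.
  have -> : \sum_i y 0 i * ((8 * lin la y - 4 * lin p y) * mv a i y) =
     (8 * lin la y - 4 * lin p y) * quad a y.
    by rewrite quadE /bil mulr_sumr; apply: eq_bigr => i _; ring.
  rewrite hla; ring.
have d'E l : d' 0 l = 4 * la 0 l - 4 * p 0 l.
  suff E : d' = 4 *: la + (- 4) *: p by rewrite E !mxE; ring.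
  apply: lin_inj => y; have [->|y0] := eqVneq y 0.
    by rewrite !lin0.
  have A0 := lt0r_neq0 (a_pos y0).
  apply: (mulIf A0).
  transitivity (\sum_l0 y 0 l0 * Z l0 y).
    by rewrite mulr_suml; apply: eq_bigr => i _; rewrite ZE; ring.
  rewrite sumZ; congr (_ * _); rewrite /lin !mulr_sumr -sumrB.
  by apply: eq_bigr => i _; rewrite !mxE; ring.
pose c : 'rV[R]_n := \row_l (mu 0 l + 2^-1 * X l e).
pose d : 'rV[R]_n := \row_l (4 * la 0 l - 2 * p 0 l).
exists p, c, d.
have Ssym k i : S k i + S i k = 2 * (b 0 k * mu 0 i + b 0 i * mu 0 k).
  have : forall y, quad S y = quad (\matrix_(k, i) (2 * b 0 k * mu 0 i)) y.
    move=> y; rewrite quadE hmu /quad /lin -mulrA mulr_suml mulr_sumr.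
    apply: eq_bigr => k' _; rewrite !mulr_sumr; apply: eq_bigr => i' _.
    rewrite mxE; ring.
  by move/quad_polar => /(_ k i); rewrite !mxE => ->; ring.
have Sasym l i : S l i - S i l + 2 * (mu 0 i - p 0 i) * b 0 l = b 0 i * X l e.
  have := XE l (delta_mx 0 i); rewrite {1}/X !mv_delta !lin_delta mxE; exact.
have Tsym l i j : 2 * T l i j - 2 * T i l j - 2 * T j l i
   + (8 * la 0 i - 4 * p 0 i) * a l j + (8 * la 0 j - 4 * p 0 j) * a l i
   = 2 * d' 0 l * a i j.
  have : forall y, quad (\matrix_(i, j) (T l i j - 2 * T i l j + (8 * la 0 i - 4 * p 0 i) * a l j)) y
     = quad (\matrix_(i, j) (d' 0 l * a i j)) y.
    move=> y; transitivity (Z l y).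
      rewrite /Z {1 2}/quad.
      have -> : (8 * lin la y - 4 * lin p y) = \sum_i (8 * la 0 i - 4 * p 0 i) * y 0 i.
        by rewrite /lin !mulr_sumr -sumrB; apply: eq_bigr => i' _; ring.
      rewrite mulr_suml mulr_sumr -sumrB -big_split /=; apply: eq_bigr => i' _.
      rewrite /mv !mulr_sumr -sumrB -big_split /=; apply: eq_bigr => j' _.
      rewrite mxE; ring.
    rewrite ZE /quad mulr_suml; apply: eq_bigr => i' _; rewrite mulr_suml.
    by apply: eq_bigr => j' _; rewrite mxE; ring.
  move/quad_polar => /(_ i j); rewrite !mxE (T_sym l j i) (a_sym j i).
  move/eqP; rewrite -subr_eq0 => /eqP E.
  by apply/eqP; rewrite -subr_eq0; apply/eqP; rewrite -[RHS]E; ring.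
split.
- move=> l i j.
  have E1 : 2 * T i l j - 2 * T l i j - 2 * T j l i + (8 * la 0 l - 4 * p 0 l) * a i j
      + (8 * la 0 j - 4 * p 0 j) * a i l - 2 * (4 * la 0 i - 4 * p 0 i) * a j l = 0.
    by have := Tsym i l j; rewrite d'E (T_sym j i l) (a_sym l j) => ->; rewrite subrr.
  have E2 : 2 * T j l i - 2 * T l i j - 2 * T i l j + (8 * la 0 l - 4 * p 0 l) * a i j
      + (8 * la 0 i - 4 * p 0 i) * a j l - 2 * (4 * la 0 j - 4 * p 0 j) * a i l = 0.
    have := Tsym j l i; rewrite d'E (T_sym i j l) (T_sym l j i) (a_sym j i) (a_sym l i) => ->.
    by rewrite subrr.
  have four0 : (4 : R) != 0 by rewrite pnatr_eq0.
  apply: (mulfI four0); apply/eqP; rewrite -subr_eq0; apply/eqP; rewrite mxE.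
  have := congr2 +%R E1 E2; rewrite addr0 => E3.
  by rewrite -[RHS]oppr0 -[X in _ = - X]E3; ring.
- move=> l i; rewrite mxE; have := Ssym l i; have := Sasym l i.
  move: (S l i) (S i l) (b 0 l) (b 0 i) (mu 0 l) (mu 0 i) (p 0 i) (X l e) => *; nra.
- move=> l; rewrite !mxE.
  have -> : 2 * m * (mu 0 l + 2^-1 * X l e) = 2 * m * mu 0 l - 2^-1 * (- 2 * m * X l e) by field.
  by rewrite -d'X d'E !p_i; field.
- move=> y [b0 _]; rewrite hmu hla pE.
  have y0 : y != 0.
    by apply: contraTneq b0 => ->; rewrite lin0 ltxx.
  have A0 := lt0r_neq0 (a_pos y0); have b0' := lt0r_neq0 b0.
  by field; rewrite A0 b0'.
Qed.

End PointwiseAlgebra.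

(** * The spray of an m-Kropina metric in coordinates *)

Lemma open_setI_preimage (T T' : topologicalType) (f : T -> T') (U : set T) (D : set T') :
  open U -> {in U, continuous f} -> open D -> open (U `&` f @^-1` D).
Proof.
move=> oU cf oD; rewrite openE => x [Ux Dx]; apply: filterI.
  exact: (open_nbhs_nbhs (conj oU Ux)).
by apply: (cf x); rewrite ?inE //; exact: (open_nbhs_nbhs (conj oD Dx)).
Qed.

Section LinearAlgebra.
Variables (R : realType) (n : nat).
Implicit Types (a : 'M[R]_n) (u v b : 'rV[R]_n).

Lemma mvE a l v : mv a l v = (a *m v^T) l 0.
Proof. by rewrite /mv mxE; apply: eq_bigr => j _; rewrite mxE. Qed.

Lemma bilE a u v : bil a u v = (u *m a *m v^T) 0 0.
Proof. by rewrite -mulmxA mxE; apply: eq_bigr => i _; rewrite mvE. Qed.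

Lemma linE b v : lin b v = (b *m v^T) 0 0.
Proof. by rewrite mxE; apply: eq_bigr => i _; rewrite mxE. Qed.

Lemma unitmx_row_inj a : (forall u, u *m a = 0 -> u = 0) -> a \in unitmx.
Proof.
move=> h; rewrite -row_free_unit -kermx_eq0; apply/eqP/row_matrixP => i.
rewrite row0; apply: h; apply/eqP; rewrite -submx0.
have := row_sub i (kermx a); rewrite sub_kermx => /eqP ->; exact: sub0mx.
Qed.

Lemma posdef_unitmx a : (forall y, y != 0 -> 0 < quad a y) -> a \in unitmx.
Proof.
move=> h; apply: unitmx_row_inj => u ua; apply: contrapT => /eqP u0.
by have := h u u0; rewrite quadE bilE ua mul0mx mxE ltxx.
Qed.

Definition sqnorm a b : R := (b *m invmx a *m b^T) 0 0.

Lemma sqnorm_gt0 a b : (forall i j, a i j = a j i) ->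
  (forall y, y != 0 -> 0 < quad a y) -> b != 0 -> 0 < sqnorm a b.
Proof.
move=> asym apos b0; have ua := posdef_unitmx apos.
pose u := b *m invmx a.
have bE : b = u *m a by rewrite /u mulmxKV.
have aT : a^T = a by apply/matrixP => i j; rewrite mxE.
have u0 : u != 0 by apply: contra_neq b0 => u0; rewrite bE u0 mul0mx.
have -> : sqnorm a b = (u *m a *m u^T) 0 0.
  by rewrite /sqnorm -/u {1}bE trmx_mul aT mulmxA.
by rewrite -bilE -quadE; exact: apos.
Qed.

End LinearAlgebra.

Section Energy.
Variables (R : realType) (m : R).

(** In exponential form both factors of F^2 differentiate by the same rule,
    whatever the real exponent m. *)
Lemma energy_expR (bv q : R) : 0 < bv -> 0 < q ->
  (bv `^ m * Num.sqrt q `^ (1 - m)) ^+ 2 = expR (2 * m * ln bv + (1 - m) * ln q).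
Proof.
move=> b0 q0; rewrite -(powR12_sqrt (ltW q0)) -powRrM.
rewrite /powR (gt_eqF b0) (gt_eqF q0) -expRD expr2 -expRD; congr expR.
by field.
Qed.

Lemma is_derive_energy (V : normedModType R) (f g : V -> R) x v df dg :
  0 < f x -> 0 < g x -> is_derive x v f df -> is_derive x v g dg ->
  is_derive x v (fun z => expR (2 * m * ln (f z) + (1 - m) * ln (g z)))
    (expR (2 * m * ln (f x) + (1 - m) * ln (g x)) *
      (2 * m * (df / f x) + (1 - m) * (dg / g x))).
Proof.
move=> f0 g0 hf hg.
have h1 := is_deriveD1 (is_deriveZ1 (2 * m) (is_derive_ln1 f0 hf)) (is_deriveZ1 (1 - m) (is_derive_ln1 g0 hg)).
apply: is_derive_eq (is_derive_expR1 h1) _; congr (_ * _).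
by rewrite !(mulrC _^-1).
Qed.

Lemma is_derive_quotient (V : normedModType R) (f g : V -> R) x v df dg :
  g x != 0 -> is_derive x v f df -> is_derive x v g dg ->
  is_derive x v (fun z => f z / g z) (df / g x - f x * dg / g x ^+ 2).
Proof.
move=> g0 hf hg; apply: is_derive_eq (is_deriveM1 hf (is_deriveV1 g0 hg)) _.
by field.
Qed.

End Energy.

Section VerticalDerivatives.
Variables (R : realType) (n : nat).
Implicit Types (a : 'M[R]_n) (b v : 'rV[R]_n).

Lemma is_derive_lin b v i : is_derive v (delta_mx 0 i) (lin b) (b 0 i).
Proof.
rewrite -(lin_delta b i); apply: is_derive_sum1 => j _.
apply: is_deriveZ1; exact: is_derive_coord.
Qed.

Lemma is_derive_mv a l v i : is_derive v (delta_mx 0 i) (mv a l) (a l i).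
Proof.
rewrite -(mv_delta a l i); apply: is_derive_sum1 => j _.
apply: is_deriveZ1; exact: is_derive_coord.
Qed.

Lemma is_derive_quad a v i : (forall i j, a i j = a j i) ->
  is_derive v (delta_mx 0 i) (quad a) (2 * mv a i v).
Proof.
move=> asym.
have E : quad a = (fun y => \sum_l y 0 l * mv a l y) by apply/funext => y; rewrite quadE.
have D : is_derive v (delta_mx 0 i) (quad a)
    (\sum_l (((delta_mx 0 i : 'rV[R]_n) 0 l) * mv a l v + v 0 l * a l i)).
  rewrite E; apply: is_derive_sum1 => l _; apply: is_deriveM1; first exact: is_derive_coord.
  exact: is_derive_mv.
apply: is_derive_eq D _.
rewrite big_split /= (bigD1 i) //= mxE !eqxx mul1r big1 ?addr0; last first.
  by move=> j ji; rewrite mxE eqxx (negbTE ji) mul0r.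
rewrite mulrDl mul1r; congr (_ + _); rewrite /mv; apply: eq_bigr => j _.
by rewrite (asym j i) mulrC.
Qed.

Lemma open_lin_gt0 b : open [set y | 0 < lin b y].
Proof.
apply: (@open_comp _ _ (lin b) [set t : R | 0 < t]); last exact: open_gt.
move=> y _; apply: continuous_sum => i.
by apply: continuousM; [exact: cst_continuous|exact: coord_continuous].
Qed.

End VerticalDerivatives.

Section KropinaEnergy.
Variables (R : realType) (n : nat) (m : R).
Variables (U : set 'rV[R]_n) (af : 'rV[R]_n -> 'M[R]_n) (bf : 'rV[R]_n -> 'rV[R]_n).
Hypothesis oU : open U.
Hypothesis a_smooth : forall i j, smooth_on U (fun x => af x i j).
Hypothesis b_smooth : forall i, smooth_on U (fun x => bf x 0 i).
Hypothesis a_sym : forall x, U x -> forall i j, af x i j = af x j i.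
Hypothesis a_pos : forall x, U x -> forall y, y != 0 -> 0 < quad (af x) y.
Implicit Types x y z v : 'rV[R]_n.

Definition kropinaF x y : R := lin (bf x) y `^ m * Num.sqrt (quad (af x) y) `^ (1 - m).

Definition pd_form x : 'M[R]_n := \matrix_(k, i) pd k (fun z => bf z 0 i) x.
Definition pd_metric x (k : 'I_n) : 'M[R]_n := \matrix_(i, j) pd k (fun z => af z i j) x.

Lemma lin_gt0_neq0 (b y : 'rV[R]_n) : 0 < lin b y -> y != 0.
Proof. by apply: contraTneq => ->; rewrite lin0 ltxx. Qed.

Definition energy x y := expR (2 * m * ln (lin (bf x) y) + (1 - m) * ln (quad (af x) y)).

Lemma energyE x y : U x -> 0 < lin (bf x) y -> kropinaF x y ^+ 2 = energy x y.
Proof. by move=> Ux b0; apply: energy_expR => //; apply: a_pos => //; exact: lin_gt0_neq0 b0. Qed.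

(** The derivatives of ln F^2: first ones in y and in x, then second ones in
    y, y and in y, x. *)
Definition dlog_v x y i := 2 * m * (bf x 0 i / lin (bf x) y) + (1 - m) * (2 * mv (af x) i y / quad (af x) y).

Definition dlog_x x y k := 2 * m * (mv (pd_form x) k y / lin (bf x) y) + (1 - m) * (quad (pd_metric x k) y / quad (af x) y).

Definition dlog_vv x y j i :=
  2 * m * (- (bf x 0 i * bf x 0 j / lin (bf x) y ^+ 2))
  + (1 - m) * (2 * af x i j / quad (af x) y - 2 * mv (af x) i y * (2 * mv (af x) j y) / quad (af x) y ^+ 2).

Definition dlog_xv x y l k :=
  2 * m * (pd_form x k l / lin (bf x) y - mv (pd_form x) k y * bf x 0 l / lin (bf x) y ^+ 2)
  + (1 - m) * (2 * mv (pd_metric x k) l y / quad (af x) y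
     - quad (pd_metric x k) y * (2 * mv (af x) l y) / quad (af x) y ^+ 2).

Lemma pd_metric_sym x k i j : U x -> pd_metric x k i j = pd_metric x k j i.
Proof.
move=> Ux; rewrite !mxE; apply: (pd_ext _ oU) => // z Uz; exact: a_sym.
Qed.

Lemma is_derive_energy_v x y i : U x -> 0 < lin (bf x) y ->
  is_derive y (delta_mx 0 i) (energy x) (energy x y * dlog_v x y i).
Proof.
move=> Ux b0; apply: is_derive_energy => //.
- by apply: a_pos => //; exact: lin_gt0_neq0 b0.
- exact: is_derive_lin.
- by apply: is_derive_quad; exact: a_sym.
Qed.

Lemma is_derive_bfx x y k : U x ->
  is_derive x (delta_mx 0 k) (fun z => lin (bf z) y) (mv (pd_form x) k y).
Proof.
move=> Ux; apply: is_derive_sum1 => i _; rewrite mxE.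
have h := Ck_on_is_derive k (b_smooth i 1%N) Ux.
apply: is_derive_eq (is_deriveM1 h (is_derive_cst (y 0 i) x _)) _.
by rewrite mulr0 addr0.
Qed.

Lemma is_derive_afx x y k : U x ->
  is_derive x (delta_mx 0 k) (fun z => quad (af z) y) (quad (pd_metric x k) y).
Proof.
move=> Ux; apply: is_derive_sum1 => i _; apply: is_derive_sum1 => j _; rewrite mxE.
have h := Ck_on_is_derive k (a_smooth i j 1%N) Ux.
apply: is_derive_eq (is_deriveM1 (is_deriveM1 h (is_derive_cst (y 0 i) x _)) (is_derive_cst (y 0 j) x _)) _.
by rewrite !mulr0 !addr0.
Qed.

Lemma is_derive_energy_x x y k : U x -> 0 < lin (bf x) y ->
  is_derive x (delta_mx 0 k) (fun z => energy z y) (energy x y * dlog_x x y k).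
Proof.
move=> Ux b0; apply: (@is_derive_energy R m _ (fun z => lin (bf z) y) (fun z => quad (af z) y)) => //.
- by apply: a_pos => //; exact: lin_gt0_neq0 b0.
- exact: is_derive_bfx.
- exact: is_derive_afx.
Qed.

Lemma is_derive_dlog_v x y i j : U x -> 0 < lin (bf x) y ->
  is_derive y (delta_mx 0 j) (fun v => dlog_v x v i) (dlog_vv x y j i).
Proof.
move=> Ux b0; have y0 := lin_gt0_neq0 b0.
apply: is_deriveD1; apply: is_deriveZ1.
- apply: is_derive_eq (is_derive_quotient (lt0r_neq0 b0) (is_derive_cst (bf x 0 i) y _) (is_derive_lin _ _ _)) _.
  by rewrite mul0r sub0r.
- apply: is_derive_quotient; first by rewrite lt0r_neq0 // a_pos.
    by apply: is_deriveZ1; exact: is_derive_mv.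
  by apply: is_derive_quad; exact: a_sym.
Qed.

Lemma is_derive_dlog_x x y k l : U x -> 0 < lin (bf x) y ->
  is_derive y (delta_mx 0 l) (fun v => dlog_x x v k) (dlog_xv x y l k).
Proof.
move=> Ux b0; have y0 := lin_gt0_neq0 b0.
apply: is_deriveD1; apply: is_deriveZ1.
- by apply: is_derive_quotient; [exact: lt0r_neq0|exact: is_derive_mv|exact: is_derive_lin].
- apply: is_derive_quotient; first by rewrite lt0r_neq0 // a_pos.
    by apply: is_derive_quad => i j; exact: pd_metric_sym.
  by apply: is_derive_quad; exact: a_sym.
Qed.

Lemma fundamentalE x y i j : U x -> 0 < lin (bf x) y ->
  fundamental kropinaF x y i j = 2^-1 * energy x y * (dlog_v x y i * dlog_v x y j + dlog_vv x y i j).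
Proof.
move=> Ux b0; rewrite mxE -mulrA; congr (_ * _); apply: is_derive_pd.
have oO := @open_lin_gt0 R n (bf x).
have E1 v : 0 < lin (bf x) v -> pd j (fun v => kropinaF x v ^+ 2) v = energy x v * dlog_v x v j.
  move=> v0; transitivity (pd j (energy x) v).
    by apply: (pd_ext _ oO) => // w w0; exact: energyE.
  by apply: is_derive_pd; exact: is_derive_energy_v.
apply: (@is_derive_ext R n [set v | 0 < lin (bf x) v] (fun v => energy x v * dlog_v x v j)) => //.
  by move=> v v0; rewrite E1.
apply: is_derive_eq (is_deriveM1 (is_derive_energy_v i Ux b0) (is_derive_dlog_v j i Ux b0)) _.
by ring.
Qed.

Definition spray_rhs x y l := \sum_k pd l (fun v => pd k (fun z => kropinaF z v ^+ 2) x) y * y 0 k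
     - pd l (fun z => kropinaF z y ^+ 2) x.

(** The formula for F^2 holds only where beta > 0; differentiating it in x needs
    this condition on a neighbourhood of x for fixed y. *)
Lemma near_lin_gt0 x y : U x -> 0 < lin (bf x) y ->
  exists V, [/\ open V, V x & forall z, V z -> U z /\ 0 < lin (bf z) y].
Proof.
move=> Ux b0.
have cb : {in U, continuous (fun z => lin (bf z) y)}.
  move=> z Uz; apply: continuous_sum => i; apply: continuousM; last exact: cst_continuous.
  exact: (Ck_on_cont (b_smooth i 0%N)).
exists (U `&` (fun z => lin (bf z) y) @^-1` [set t : R | 0 < t]); split => //.
by apply: open_setI_preimage => //; exact: open_gt.
Qed.


Lemma spray_rhsE x y l : U x -> 0 < lin (bf x) y ->
  spray_rhs x y l = energy x y * (\sum_k (dlog_v x y l * dlog_x x y k + dlog_xv x y l k) * y 0 k - dlog_x x y l).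
Proof.
move=> Ux b0.
have pdL k v : 0 < lin (bf x) v -> pd k (fun z => kropinaF z v ^+ 2) x = energy x v * dlog_x x v k.
  move=> v0; have [V [oV Vx hV]] := near_lin_gt0 Ux v0.
  transitivity (pd k (fun z => energy z v) x).
    by apply: (pd_ext _ oV) => // z /hV[Uz z0]; exact: energyE.
  by apply: is_derive_pd; exact: is_derive_energy_x.
rewrite /spray_rhs pdL // mulrBr mulr_sumr; congr (_ - _); apply: eq_bigr => k _.
rewrite mulrA; congr (_ * _); apply: is_derive_pd.
apply: (@is_derive_ext R n [set v | 0 < lin (bf x) v] (fun v => energy x v * dlog_x x v k)) => //.
- exact: open_lin_gt0.
- by move=> v v0; rewrite pdL.
apply: is_derive_eq (is_deriveM1 (is_derive_energy_v l Ux b0) (is_derive_dlog_x k l Ux b0)) _.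
by ring.
Qed.

(** Euler's relation: F^2 is homogeneous of degree 2 in y. *)
Lemma sum_dlog_v x y : 0 < lin (bf x) y -> quad (af x) y != 0 -> \sum_l y 0 l * dlog_v x y l = 2.
Proof.
move=> b0 A0; have b0' := lt0r_neq0 b0.
rewrite /dlog_v; under eq_bigr do rewrite mulrDr.
rewrite big_split /=.
have -> : \sum_i y 0 i * (2 * m * (bf x 0 i / lin (bf x) y)) = 2 * m.
  transitivity (2 * m / lin (bf x) y * \sum_i y 0 i * bf x 0 i); last by rewrite -lin_row divfK.
  by rewrite mulr_sumr; apply: eq_bigr => i _; ring.
have -> : \sum_i y 0 i * ((1 - m) * (2 * mv (af x) i y / quad (af x) y)) = 2 * (1 - m).
  transitivity (2 * (1 - m) / quad (af x) y * bil (af x) y y); last by rewrite -quadE divfK.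
  by rewrite /bil mulr_sumr; apply: eq_bigr => i _; ring.
by ring.
Qed.

Lemma dlog_vvC x y i j : U x -> dlog_vv x y i j = dlog_vv x y j i.
Proof. by move=> Ux; rewrite /dlog_vv (a_sym Ux i j); ring. Qed.

Lemma sum_dlog_vv x y l (u : 'rV[R]_n) : U x -> 
  \sum_i u 0 i * dlog_vv x y l i = - (2 * m * (lin (bf x) u * bf x 0 l / lin (bf x) y ^+ 2))
  + 2 * (1 - m) * (mv (af x) l u / quad (af x) y
       - 2 * bil (af x) u y * mv (af x) l y / quad (af x) y ^+ 2).
Proof.
move=> Ux.
transitivity (\sum_i (- (2 * m * bf x 0 l / lin (bf x) y ^+ 2) * (u 0 i * bf x 0 i)
   + (2 * (1 - m) / quad (af x) y) * (af x l i * u 0 i)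
   + (- 4 * (1 - m) * mv (af x) l y / quad (af x) y ^+ 2) * (u 0 i * mv (af x) i y))).
  apply: eq_bigr => i _; rewrite /dlog_vv (a_sym Ux i l); ring.
rewrite !big_split -!mulr_sumr /= -lin_row /bil /mv; ring.
Qed.

Lemma euler_dlog_vv x y l : U x -> 0 < lin (bf x) y ->
  \sum_i y 0 i * dlog_vv x y l i = - dlog_v x y l.
Proof.
move=> Ux b0; have A0 := lt0r_neq0 (a_pos Ux (lin_gt0_neq0 b0)); have b0' := lt0r_neq0 b0.
rewrite sum_dlog_vv // -quadE /dlog_v; field.
by rewrite A0 b0'.
Qed.

Section Frame.
Variables (x e : 'rV[R]_n) (h B : R).
Hypotheses (Ux : U x) (m_neq1 : m != 1) (Bh1 : B * h = 1).
Hypothesis e_dual : forall z, bil (af x) e z = h * lin (bf x) z.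
Hypothesis lin_be : lin (bf x) e = 1.

(** Let u be in the kernel of the fundamental tensor.  Contracting with y gives
    d(ln F^2)(u) = 0; contracting then with the dual vector e of b gives
    b(u) (m B A - (1 + m) be^2) = 0, so b(u) = 0 at a regular direction.  What is
    left of the equation is a(u, _) = 0, and a is positive definite. *)
Lemma fundamental_unit y : regular_direction m (af x) (bf x) B y ->
  fundamental kropinaF x y \in unitmx.
Proof.
move=> [b0 D0]; have A0 := lt0r_neq0 (a_pos Ux (lin_gt0_neq0 b0)).
have b0' := lt0r_neq0 b0.
apply: unitmx_row_inj => u ug.
have L0 : 2^-1 * energy x y != 0 by rewrite mulf_neq0 ?invr_eq0 ?pnatr_eq0 // gt_eqF // expR_gt0.
pose sg := \sum_i u 0 i * dlog_v x y i.
have E j : sg * dlog_v x y j + \sum_i u 0 i * dlog_vv x y j i = 0.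
  have := congr1 (fun M : 'rV[R]_n => M 0 j) ug; rewrite !mxE.
  have -> : \sum_i u 0 i * fundamental kropinaF x y i j =
     2^-1 * energy x y * (sg * dlog_v x y j + \sum_i u 0 i * dlog_vv x y j i).
    rewrite mulrDr /sg mulr_suml !mulr_sumr -big_split /=; apply: eq_bigr => i _.
    by rewrite fundamentalE // (dlog_vvC y j i Ux); ring.
  by move/eqP; rewrite mulf_eq0 (negbTE L0) => /eqP.
have sg0 : sg = 0.
  have : \sum_j y 0 j * (sg * dlog_v x y j + \sum_i u 0 i * dlog_vv x y j i) = 0.
    by rewrite big1 // => j _; rewrite E mulr0.
  under eq_bigr do rewrite mulrDr mulrCA.
  rewrite big_split /= -mulr_sumr sum_dlog_v //.
  have -> : \sum_i y 0 i * (\sum_j u 0 j * dlog_vv x y i j) = - sg.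
    under eq_bigr do rewrite mulr_sumr.
    rewrite exchange_big /= /sg -sumrN; apply: eq_bigr => j _.
    transitivity (u 0 j * \sum_i y 0 i * dlog_vv x y j i).
      by rewrite mulr_sumr; apply: eq_bigr => i _; rewrite (dlog_vvC y j i Ux); ring.
    by rewrite euler_dlog_vv //; ring.
  by move=> ?; lra.
pose bu := lin (bf x) u; pose Y := bil (af x) u y.
have YE : (1 - m) * Y / quad (af x) y = - m * bu / lin (bf x) y.
  have : sg = 2 * m * bu / lin (bf x) y + 2 * (1 - m) * Y / quad (af x) y.
    rewrite /sg /bu lin_row /Y /bil; transitivity (\sum_i (2 * m / lin (bf x) y * (u 0 i * bf x 0 i)
      + 2 * (1 - m) / quad (af x) y * (u 0 i * mv (af x) i y))).
      by apply: eq_bigr => i _; rewrite /dlog_v; ring.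
    by rewrite big_split -!mulr_sumr /=; ring.
  by rewrite sg0 => ?; lra.
have E2 j : - m * bu * bf x 0 j / lin (bf x) y ^+ 2 + (1 - m) * mv (af x) j u / quad (af x) y
   + 2 * m * bu * mv (af x) j y / (lin (bf x) y * quad (af x) y) = 0.
  have := E j; rewrite sg0 mul0r add0r sum_dlog_vv // -/bu -/Y => EE.
  have : - (m * (bu * bf x 0 j / lin (bf x) y ^+ 2)) + (1 - m) * mv (af x) j u / quad (af x) y
       - 2 * ((1 - m) * Y / quad (af x) y) * mv (af x) j y / quad (af x) y = 0.
    have two0 : (2 : R) != 0 by rewrite pnatr_eq0.
    by apply: (mulfI two0); rewrite mulr0 -[RHS]EE; field; rewrite ?A0 ?b0'.
  rewrite YE => EEE; rewrite -[RHS]EEE; field.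
  by rewrite A0 b0'.
have bu0 : bu = 0.
  have : \sum_j e 0 j * (- m * bu * bf x 0 j / lin (bf x) y ^+ 2 + (1 - m) * mv (af x) j u / quad (af x) y
   + 2 * m * bu * mv (af x) j y / (lin (bf x) y * quad (af x) y)) = 0.
    by rewrite big1 // => j _; rewrite E2 mulr0.
  have -> : \sum_j e 0 j * (- m * bu * bf x 0 j / lin (bf x) y ^+ 2 + (1 - m) * mv (af x) j u / quad (af x) y
   + 2 * m * bu * mv (af x) j y / (lin (bf x) y * quad (af x) y)) =
    - m * bu / lin (bf x) y ^+ 2 * lin (bf x) e + (1 - m) / quad (af x) y * bil (af x) e u
    + 2 * m * bu / (lin (bf x) y * quad (af x) y) * bil (af x) e y.
    rewrite lin_row /bil !mulr_sumr -!big_split /=; apply: eq_bigr => j _; ring.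
  rewrite !e_dual lin_be -/bu => EE.
  have h0 : h != 0 by apply: contra_eq_neq Bh1 => ->; rewrite mulr0 eq_sym oner_eq0.
  have : h * bu * (m * B * quad (af x) y - (1 + m) * lin (bf x) y ^+ 2) = 0.
    have -> : h * bu * (m * B * quad (af x) y - (1 + m) * lin (bf x) y ^+ 2)
      = bu * ((B * h) * m * quad (af x) y - h * (1 + m) * lin (bf x) y ^+ 2) by ring.
    rewrite Bh1 -[RHS](mulr0 (- (lin (bf x) y ^+ 2 * quad (af x) y))) -[in RHS]EE; field.
    by rewrite A0 b0'.
  by move/eqP; rewrite !mulf_eq0 (negbTE D0) (negbTE h0) orbF /= => /eqP.
have m10 : 1 - m != 0 by rewrite subr_eq0 eq_sym.
have mvu j : mv (af x) j u = 0.
  have := E2 j; rewrite bu0 !(mulr0, mul0r) add0r addr0 => /eqP.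
  by rewrite !mulf_eq0 invr_eq0 (negbTE m10) (negbTE A0) orbF /= => /eqP.
apply: contrapT => /eqP u0; have := a_pos Ux u0.
by rewrite quadE /bil big1 ?ltxx // => i _; rewrite mvu mulr0.
Qed.

End Frame.

Definition projective_factor x y : R :=
  4^-1 * (2 * m * (bil (pd_form x) y y / lin (bf x) y) + (1 - m) * (tri (pd_metric x) y y y / quad (af x) y)).

(** Multiplying G = P y by the fundamental tensor removes its inverse and, by
    Euler's relations, leaves one equation E1 for each l.  The derivatives of ln F^2
    in x are homogeneous of degree 0 in y, so contracting E1 with y kills the mixed
    second derivatives and determines P; substituting P back gives the defect. *)
Lemma spray_projective x y (P : R) : U x -> 0 < lin (bf x) y ->
  fundamental kropinaF x y \in unitmx ->
  (forall i, spray kropinaF i x y = P * y 0 i) ->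
  P = projective_factor x y /\
  forall l, projective_defect m (af x) (bf x) (pd_metric x) (pd_form x) l y = 0.
Proof.
move=> Ux b0 gu hP.
have A0 := lt0r_neq0 (a_pos Ux (lin_gt0_neq0 b0)); have b0' := lt0r_neq0 b0.
set g := fundamental kropinaF x y in gu.
have LN : energy x y != 0 by rewrite gt_eqF // expR_gt0.
have rhsE l : spray_rhs x y l = 4 * P * \sum_i g l i * y 0 i.
  have E : (\col_l spray_rhs x y l) = (4 * P) *: (g *m y^T).
    rewrite -[LHS](mulKVmx gu) scalemxAr; congr (_ *m _).
    apply/colP => i; rewrite !mxE; have := hP i; rewrite /spray -/g => E.
    have -> : \sum_j invmx g i j * (\col_l spray_rhs x y l) j 0 =
       4 * (4^-1 * \sum_j invmx g i j * spray_rhs x y j).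
      rewrite mulrA divff ?mul1r ?pnatr_eq0 //; apply: eq_bigr => j _; by rewrite mxE.
    by rewrite E mulrA.
  have := congr1 (fun M : 'cV[R]_n => M l 0) E; rewrite mxE [X in _ = X]mxE [X in _ = _ * X]mxE => ->.
  by congr (_ * _); apply: eq_bigr => i _; rewrite [y^T i 0]mxE.
pose D0 := \sum_k dlog_x x y k * y 0 k.
have E1 l : dlog_v x y l * D0 + \sum_k dlog_xv x y l k * y 0 k - dlog_x x y l = 2 * P * dlog_v x y l.
  apply: (mulfI LN).
  have -> : energy x y * (dlog_v x y l * D0 + \sum_k dlog_xv x y l k * y 0 k - dlog_x x y l) = spray_rhs x y l.
    rewrite spray_rhsE //; congr (_ * (_ - _)); rewrite /D0 mulr_sumr -big_split /=.
    by apply: eq_bigr => k _; ring.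
  rewrite rhsE.
  have -> : \sum_i g l i * y 0 i = 2^-1 * energy x y * (dlog_v x y l * 2 + - dlog_v x y l).
    rewrite -euler_dlog_vv //; transitivity (2^-1 * energy x y * (dlog_v x y l * (\sum_i y 0 i * dlog_v x y i)
      + \sum_i y 0 i * dlog_vv x y l i)); last by rewrite sum_dlog_v.
    rewrite mulrDr !mulr_sumr -big_split /=.
    by apply: eq_bigr => i _; rewrite /g fundamentalE //; ring.
  by field.
have D0E : D0 = 2 * m * (bil (pd_form x) y y / lin (bf x) y) + (1 - m) * (tri (pd_metric x) y y y / quad (af x) y).
  rewrite /D0 /bil /tri !mulr_suml !mulr_sumr -big_split /=; apply: eq_bigr => k _.
  by rewrite /dlog_x -quadE; ring.
have xv l : \sum_k dlog_xv x y l k * y 0 k =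
    2 * m * (mv (pd_form x)^T l y / lin (bf x) y - bil (pd_form x) y y * bf x 0 l / lin (bf x) y ^+ 2)
  + 2 * (1 - m) * ((\sum_k y 0 k * mv (pd_metric x k) l y) / quad (af x) y
     - tri (pd_metric x) y y y * mv (af x) l y / quad (af x) y ^+ 2).
  transitivity (\sum_k ((2 * m / lin (bf x) y) * ((pd_form x)^T l k * y 0 k)
     - (2 * m * bf x 0 l / lin (bf x) y ^+ 2) * (y 0 k * mv (pd_form x) k y)
     + (2 * (1 - m) / quad (af x) y) * (y 0 k * mv (pd_metric x k) l y)
     - (2 * (1 - m) * mv (af x) l y / quad (af x) y ^+ 2) * (y 0 k * quad (pd_metric x k) y))).
    by apply: eq_bigr => k _; rewrite /dlog_xv [(pd_form x)^T l k]mxE; ring.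
  rewrite !(sumrB, big_split) /= -!mulr_sumr.
  have -> : \sum_i y 0 i * quad (pd_metric x i) y = tri (pd_metric x) y y y.
    by apply: eq_bigr => i _; rewrite quadE.
  by rewrite -/(mv (pd_form x)^T l y) -/(bil (pd_form x) y y); ring.
have PE : D0 = 4 * P.
  have : \sum_l y 0 l * (dlog_v x y l * D0 + \sum_k dlog_xv x y l k * y 0 k - dlog_x x y l)
    = \sum_l y 0 l * (2 * P * dlog_v x y l) by apply: eq_bigr => l _; rewrite E1.
  have -> : \sum_l y 0 l * (2 * P * dlog_v x y l) = 2 * P * 2.
    transitivity (2 * P * \sum_l y 0 l * dlog_v x y l); last by rewrite sum_dlog_v.
    by rewrite mulr_sumr; apply: eq_bigr => l _; ring.
  have -> : \sum_l y 0 l * (dlog_v x y l * D0 + \sum_k dlog_xv x y l k * y 0 k - dlog_x x y l)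
    = 2 * D0 + \sum_l y 0 l * (\sum_k dlog_xv x y l k * y 0 k) - D0.
    transitivity ((\sum_l y 0 l * dlog_v x y l) * D0 + \sum_l y 0 l * (\sum_k dlog_xv x y l k * y 0 k)
      - \sum_l y 0 l * dlog_x x y l).
      by rewrite mulr_suml -big_split -sumrB /=; apply: eq_bigr => l _; ring.
    by rewrite sum_dlog_v //; congr (_ + _ - _); apply: eq_bigr => l _; rewrite mulrC.
  have -> : \sum_l y 0 l * (\sum_k dlog_xv x y l k * y 0 k) = 0.
    under eq_bigr do rewrite xv.
    transitivity (\sum_l ((2 * m / lin (bf x) y) * (y 0 l * mv (pd_form x)^T l y)
      - (2 * m * bil (pd_form x) y y / lin (bf x) y ^+ 2) * (y 0 l * bf x 0 l)
      + (2 * (1 - m) / quad (af x) y) * (y 0 l * (\sum_k y 0 k * mv (pd_metric x k) l y))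
      - (2 * (1 - m) * tri (pd_metric x) y y y / quad (af x) y ^+ 2) * (y 0 l * mv (af x) l y))).
      by apply: eq_bigr => l _; ring.
    rewrite !(sumrB, big_split) /= -!mulr_sumr -lin_row -!bil_sum_mv -(quadE (af x) y).
    have -> : \sum_i y 0 i * (\sum_k y 0 k * mv (pd_metric x k) i y) = tri (pd_metric x) y y y.
      under eq_bigr do rewrite mulr_sumr.
      rewrite exchange_big /=; apply: eq_bigr => k _; rewrite /bil mulr_sumr.
      by apply: eq_bigr => i _; ring.
    have -> : bil (pd_form x)^T y y = bil (pd_form x) y y.
      by rewrite !bilE -[RHS]trace_mx11 -mxtrace_tr trace_mx11 !trmx_mul trmxK mulmxA.
    field.
    by rewrite A0 b0'.
  by move=> ?; lra.
have PF : P = projective_factor x y.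
  by rewrite /projective_factor -D0E PE; field.
split=> // l.
have := E1 l; rewrite PE => /eqP; rewrite -subr_eq0 => /eqP E.
rewrite -[RHS](mulr0 (lin (bf x) y ^+ 2 * quad (af x) y ^+ 2)) -[X in _ = _ * X]E xv PF.
rewrite /projective_defect /projective_factor /dlog_v /dlog_x /=; field.
by rewrite A0 b0'.
Qed.

End KropinaEnergy.

(** * The normalised metric and 1-form in coordinates *)

Section SmoothMatrices.
Variables (R : realType) (n : nat) (U : set 'rV[R]_n).
Hypothesis oU : open U.

Lemma Ck_on_det k p (M : 'rV[R]_n -> 'M[R]_p) :
  (forall i j, Ck_on k U (fun x => M x i j)) -> Ck_on k U (fun x => \det (M x)).
Proof.
move=> h; rewrite /determinant; apply: Ck_on_sum => // s _.
apply: Ck_onM => //; first exact: Ck_on_cst.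
by apply: Ck_on_prod.
Qed.

Lemma Ck_on_invmx k p (M : 'rV[R]_n -> 'M[R]_p) :
  (forall i j, Ck_on k U (fun x => M x i j)) -> (forall x, U x -> M x \in unitmx) ->
  forall i j, Ck_on k U (fun x => invmx (M x) i j).
Proof.
move=> h hu i j.
apply: (@Ck_on_ext _ _ k U (fun x => (\det (M x))^-1 * cofactor (M x) j i)) => //.
  by move=> x Ux; rewrite /invmx (hu x Ux) !mxE.
apply: Ck_onM => //.
  apply: Ck_onV => //; last exact: Ck_on_det.
  by move=> x Ux; have := hu x Ux; rewrite unitmxE unitfE.
apply: Ck_onM => //; first exact: Ck_on_cst.
apply: Ck_on_det => i' j'.
apply: (@Ck_on_ext _ _ k U (fun x => M x (lift j i') (lift i j'))) => //.
by move=> x _; rewrite !mxE.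
Qed.

Lemma Ck_on_sqnorm k p (M : 'rV[R]_n -> 'M[R]_p) (b : 'rV[R]_n -> 'rV[R]_p) :
  (forall i j, Ck_on k U (fun x => M x i j)) -> (forall x, U x -> M x \in unitmx) ->
  (forall i, Ck_on k U (fun x => b x 0 i)) -> Ck_on k U (fun x => sqnorm (M x) (b x)).
Proof.
move=> hM hu hb; have hi := Ck_on_invmx hM hu.
apply: (@Ck_on_ext _ _ k U (fun x => \sum_j (\sum_i b x 0 i * invmx (M x) i j) * b x 0 j)) => //.
  move=> x _; rewrite /sqnorm mxE; apply: eq_bigr => j _.
  by rewrite [in RHS]mxE; congr (_ * _); rewrite mxE.
apply: Ck_on_sum => // j _; apply: Ck_onM => //.
by apply: Ck_on_sum => // i _; apply: Ck_onM.
Qed.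

End SmoothMatrices.

Section LocalStructure.
Variables (R : realType) (n : nat) (m : R).
Variables (U : set 'rV[R]_n) (af : 'rV[R]_n -> 'M[R]_n) (bf : 'rV[R]_n -> 'rV[R]_n).
Variable P : 'rV[R]_n -> 'rV[R]_n -> R.
Hypotheses (m_neq0 : m != 0) (m_neq1 : m != 1).
Hypothesis oU : open U.
Hypothesis a_smooth : forall i j, smooth_on U (fun x => af x i j).
Hypothesis b_smooth : forall i, smooth_on U (fun x => bf x 0 i).
Hypothesis a_sym : forall x, U x -> forall i j, af x i j = af x j i.
Hypothesis a_pos : forall x, U x -> forall y, y != 0 -> 0 < quad (af x) y.
Hypothesis b_neq0 : forall x, U x -> bf x != 0.
Let F := kropinaF m af bf.
Hypothesis projective : forall x y, U x -> 0 < lin (bf x) y -> fundamental F x y \in unitmx ->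
  forall i, spray F i x y = P x y * y 0 i.
Hypothesis flat_flag : forall x y, U x -> 0 < lin (bf x) y -> fundamental F x y \in unitmx ->
  flag_curvature F P x y = 0.
Implicit Types x y z : 'rV[R]_n.

Let B x := sqnorm (af x) (bf x).
Let raise x := bf x *m invmx (af x).
Let e x := (B x)^-1 *: raise x.

Lemma a_unit x : U x -> af x \in unitmx.
Proof. by move=> Ux; apply: posdef_unitmx; exact: a_pos. Qed.

Lemma B_gt0 x : U x -> 0 < B x.
Proof. by move=> Ux; apply: sqnorm_gt0; [exact: a_sym|exact: a_pos|exact: b_neq0]. Qed.

Lemma BV1 x : U x -> B x * (B x)^-1 = 1.
Proof. by move=> Ux; rewrite divff // lt0r_neq0 // B_gt0. Qed.

Lemma lin_raise x : lin (bf x) (raise x) = B x.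
Proof. by rewrite linE /B /sqnorm -/(raise x) -[LHS]trace_mx11 -mxtrace_tr trace_mx11 trmx_mul trmxK. Qed.

Lemma bil_raise x z : U x -> bil (af x) (raise x) z = lin (bf x) z.
Proof. by move=> Ux; rewrite bilE /raise mulmxKV ?a_unit // -linE. Qed.

Lemma lin_be x : U x -> lin (bf x) (e x) = 1.
Proof.
move=> Ux; rewrite -[e x]addr0 linP lin0 addr0 lin_raise mulrC BV1 //.
Qed.

Lemma e_dual x z : U x -> bil (af x) (e x) z = (B x)^-1 * lin (bf x) z.
Proof.
move=> Ux; rewrite -(bil_raise z Ux) /bil mulr_sumr; apply: eq_bigr => i _.
by rewrite mxE mulrA.
Qed.

Lemma B_smooth : smooth_on U B.
Proof.
move=> k; apply: Ck_on_sqnorm => //; [by move=> i j; exact: a_smooth|exact: a_unit|].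
by move=> i; exact: b_smooth.
Qed.

Let reg x y := regular_direction m (af x) (bf x) (B x) y.

Lemma reg_unit x y : U x -> reg x y -> fundamental F x y \in unitmx.
Proof.
move=> Ux ry.
apply: (@fundamental_unit R n m U af bf a_sym a_pos x (e x) (B x)^-1 (B x)) => //.
- exact: BV1.
- by move=> z; exact: e_dual.
- exact: lin_be.
Qed.

Lemma reg_projective x y : U x -> reg x y ->
  P x y = projective_factor m af bf x y /\
  forall l, projective_defect m (af x) (bf x) (pd_metric af x) (pd_form bf x) l y = 0.
Proof.
move=> Ux ry; have [b0 _] := ry.
apply: (@spray_projective R n m U af bf oU) => //; first exact: reg_unit.
by apply: projective => //; exact: reg_unit.
Qed.

(** Needed to differentiate in x, at fixed y, identities known at regular
    directions only. *)
Lemma reg_near x y : U x -> reg x y ->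
  exists V, [/\ open V, V x & forall z, V z -> U z /\ reg z y].
Proof.
move=> Ux [b0 d0].
have cb : {in U, continuous (fun z => lin (bf z) y)}.
  move=> z Uz; apply: continuous_sum => i; apply: continuousM; last exact: cst_continuous.
  exact: (Ck_on_cont (b_smooth i 0%N)).
have cd : {in U, continuous (fun z => m * B z * quad (af z) y - (1 + m) * lin (bf z) y ^+ 2)}.
  have h : Ck_on 0 U (fun z => m * B z * quad (af z) y + (- (1 + m)) * (lin (bf z) y * lin (bf z) y)).
    have hl : Ck_on 0 U (fun z => lin (bf z) y).
      by apply: Ck_on_sum => // i _; apply: Ck_onM => //; [exact: b_smooth|exact: Ck_on_cst].
    apply: Ck_onD => //; apply: Ck_onM => //.
    - by apply: Ck_onM => //; [exact: Ck_on_cst|exact: B_smooth].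
    - apply: Ck_on_sum => // i _; apply: Ck_on_sum => // j _; apply: Ck_onM => //; last exact: Ck_on_cst.
      by apply: Ck_onM => //; [exact: a_smooth|exact: Ck_on_cst].
    - exact: Ck_on_cst.
    - exact: Ck_onM.
  move=> z Uz; have := Ck_on_cont h Uz; congr (continuous_at _ _).
  by apply/funext => w; ring.
have o1 := open_setI_preimage oU cb (@open_gt R 0).
have o2 := open_setI_preimage oU cd (@open_neq R 0).
exists ((U `&` (fun z => lin (bf z) y) @^-1` [set t : R | 0 < t]) `&`
  (U `&` (fun z => m * B z * quad (af z) y - (1 + m) * lin (bf z) y ^+ 2) @^-1` [set t : R | t != 0])).
split => //; first exact: openI.
by move=> z [[Uz ?] [_ ?]]; split.
Qed.

Lemma flag_zero x y : U x -> reg x y -> P x y ^+ 2 = \sum_k pd k (fun z => P z y) x * y 0 k.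
Proof.
move=> Ux ry; have := flat_flag Ux (proj1 ry) (reg_unit Ux ry).
rewrite /flag_curvature; move/eqP.
rewrite mulf_eq0 invr_eq0 (energyE m a_pos Ux (proj1 ry)) (gt_eqF (expR_gt0 _)) orbF subr_eq0.
by move/eqP.
Qed.

Lemma flag_zero_formula x y : U x -> reg x y ->
  projective_factor m af bf x y ^+ 2 = \sum_k pd k (fun z => projective_factor m af bf z y) x * y 0 k.
Proof.
move=> Ux ry; have [V [oV Vx hV]] := reg_near Ux ry.
have [<- _] := reg_projective Ux ry; rewrite flag_zero //.
apply: eq_bigr => k _; congr (_ * _); apply: (pd_ext _ oV) => // z /hV[Uz rz].
by have [] := reg_projective Uz rz.
Qed.

Definition pd2_form x k : 'M[R]_n := \matrix_(i, j) pd k (pd i (fun z => bf z 0 j)) x.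
Definition pd2_metric x k (l : 'I_n) : 'M[R]_n := \matrix_(i, j) pd k (pd l (fun z => af z i j)) x.

Lemma is_derive_beta0 x y k : U x ->
  is_derive x (delta_mx 0 k) (fun z => bil (pd_form bf z) y y) (bil (pd2_form x k) y y).
Proof.
move=> Ux; apply: is_derive_sum1 => i _; apply: is_deriveZ1; apply: is_derive_sum1 => j _.
rewrite mxE.
have E : (fun z => pd_form bf z i j * y 0 j) = (fun z => pd i (fun z => bf z 0 j) z * y 0 j).
  by apply/funext => z; rewrite mxE.
rewrite E.
have h := Ck_on_is_derive k (Ck_on_pd i (b_smooth j 2%N)) Ux.
apply: is_derive_eq (is_deriveM1 h (is_derive_cst (y 0 j) x _)) _.
by rewrite mulr0 addr0.
Qed.

Lemma is_derive_alpha0 x y k : U x ->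
  is_derive x (delta_mx 0 k) (fun z => tri (pd_metric af z) y y y) (tri (pd2_metric x k) y y y).
Proof.
move=> Ux; apply: is_derive_sum1 => l _; apply: is_deriveZ1.
apply: is_derive_sum1 => i _; apply: is_deriveZ1; apply: is_derive_sum1 => j _.
rewrite mxE.
have E : (fun z => pd_metric af z l i j * y 0 j) = (fun z => pd l (fun z => af z i j) z * y 0 j).
  by apply/funext => z; rewrite mxE.
rewrite E.
have h := Ck_on_is_derive k (Ck_on_pd l (a_smooth i j 2%N)) Ux.
apply: is_derive_eq (is_deriveM1 h (is_derive_cst (y 0 j) x _)) _.
by rewrite mulr0 addr0.
Qed.

(** K = 0 reads P^2 = y^k d_k P with 4 P = - 2 be0 / be + 2 A0 / A.  Multiplied by
    4 A^2 be^2, every term is visibly a multiple of A except the A0^2 be^2 terms,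
    which add up to 3 A0^2 be^2: one from P^2, two from differentiating 1 / A. *)
Lemma flat_kropina_divides x : U x -> m = -1 -> exists2 W, polyline W &
  forall y, reg x y -> 3 * tri (pd_metric af x) y y y ^+ 2 * lin (bf x) y ^+ 2 = quad (af x) y * W y.
Proof.
move=> Ux mE.
exists (fun y => 2 * tri (pd_metric af x) y y y * bil (pd_form bf x) y y * lin (bf x) y
   + bil (pd_form bf x) y y * bil (pd_form bf x) y y * quad (af x) y
   + 2 * (\sum_k tri (pd2_metric x k) y y y * y 0 k) * (lin (bf x) y * lin (bf x) y)
   - 2 * (\sum_k bil (pd2_form x k) y y * y 0 k) * lin (bf x) y * quad (af x) y).
  polyline_tac.
move=> y ry; have [b0 _] := ry.
have A0 := lt0r_neq0 (a_pos Ux (lin_gt0_neq0 b0)); have b0' := lt0r_neq0 b0.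
have := flag_zero_formula Ux ry.
have -> : \sum_k pd k (fun z => projective_factor m af bf z y) x * y 0 k =
  4^-1 * (2 * m * ((\sum_k bil (pd2_form x k) y y * y 0 k) / lin (bf x) y
       - bil (pd_form bf x) y y * bil (pd_form bf x) y y / lin (bf x) y ^+ 2)
    + (1 - m) * ((\sum_k tri (pd2_metric x k) y y y * y 0 k) / quad (af x) y
       - tri (pd_metric af x) y y y * tri (pd_metric af x) y y y / quad (af x) y ^+ 2)).
  transitivity (\sum_k (4^-1 * (2 * m) / lin (bf x) y * (bil (pd2_form x k) y y * y 0 k)
     - 4^-1 * (2 * m) * bil (pd_form bf x) y y / lin (bf x) y ^+ 2 * (y 0 k * mv (pd_form bf x) k y)
     + 4^-1 * (1 - m) / quad (af x) y * (tri (pd2_metric x k) y y y * y 0 k)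
     - 4^-1 * (1 - m) * tri (pd_metric af x) y y y / quad (af x) y ^+ 2 * (y 0 k * quad (pd_metric af x k) y))).
    apply: eq_bigr => k _.
    have d1 := @is_derive_quotient R _ _ (fun z => lin (bf z) y) x _ _ _ b0' (is_derive_beta0 y k Ux) (is_derive_bfx b_smooth y k Ux).
    have d2 := @is_derive_quotient R _ _ (fun z => quad (af z) y) x _ _ _ A0 (is_derive_alpha0 y k Ux) (is_derive_afx a_smooth y k Ux).
    have d := is_deriveZ1 4^-1 (is_deriveD1 (is_deriveZ1 (2 * m) d1) (is_deriveZ1 (1 - m) d2)).
    rewrite (is_derive_pd d); ring.
  rewrite !(sumrB, big_split) /= -!mulr_sumr.
  have -> : \sum_i y 0 i * quad (pd_metric af x i) y = tri (pd_metric af x) y y y.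
    by apply: eq_bigr => i _; rewrite quadE.
  rewrite -bil_sum_mv; ring.
rewrite /projective_factor mE => E.
apply/eqP; rewrite -subr_eq0; apply/eqP.
move/eqP : E; rewrite -subr_eq0 => /eqP E.
rewrite -[RHS](mulr0 (4 * quad (af x) y ^+ 2 * lin (bf x) y ^+ 2)) -[X in _ = _ * X]E; field.
by rewrite A0 b0'.
Qed.

Lemma pointwise_structure x : U x -> exists p c d : 'rV[R]_n,
  [/\ forall l i j, pd_metric af x l i j = p 0 i * af x j l + p 0 j * af x i l + af x i j * d 0 l,
      forall l i, pd_form bf x l i = p 0 i * bf x 0 l + bf x 0 i * c 0 l,
      forall l, 2 * m * c 0 l + (1 - m) * d 0 l = 2 * p 0 l &
      forall y, reg x y -> projective_factor m af bf x y = lin p y].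
Proof.
move=> Ux.
apply: (@projective_structure R n m (af x) (bf x) (e x) (B x)^-1 (B x) (pd_metric af x) (pd_form bf x)) => //.
- exact: a_sym.
- by move=> l i j; exact: (pd_metric_sym oU a_sym).
- exact: a_pos.
- by rewrite invr_gt0 B_gt0.
- exact: BV1.
- by move=> z; exact: e_dual.
- exact: lin_be.
- by move=> y l ry; have [_] := reg_projective Ux ry; apply.
- exact: flat_kropina_divides.
Qed.

(** The exponents are such that F is unchanged and the normalised form has norm 1. *)
Definition normal_metric x : 'M[R]_n := sqnorm (af x) (bf x) `^ m *: af x.
Definition normal_form x : 'rV[R]_n := sqnorm (af x) (bf x) `^ ((m - 1) / 2) *: bf x.

Lemma normal_metric_smooth i j : smooth_on U (fun x => normal_metric x i j).
Proof.
move=> k; apply: (@Ck_on_ext _ _ k U (fun x => B x `^ m * af x i j)) => //.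
  by move=> x _; rewrite mxE.
apply: Ck_onM => //; last exact: a_smooth.
by apply: Ck_on_powR => //; [exact: B_gt0|exact: B_smooth].
Qed.

Lemma normal_form_smooth i : smooth_on U (fun x => normal_form x 0 i).
Proof.
move=> k; apply: (@Ck_on_ext _ _ k U (fun x => B x `^ ((m - 1) / 2) * bf x 0 i)) => //.
  by move=> x _; rewrite mxE.
apply: Ck_onM => //; last exact: b_smooth.
by apply: Ck_on_powR => //; [exact: B_gt0|exact: B_smooth].
Qed.

(** No derivative of the inverse matrix is needed: with v the vector dual to b one
    has b = v a and B = b(v), and differentiating both relations expresses the
    derivative of B by S and T contracted with v. *)
Lemma is_derive_B x (p c d : 'rV[R]_n) l : U x ->
  (forall l i j, pd_metric af x l i j = p 0 i * af x j l + p 0 j * af x i l + af x i j * d 0 l) ->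
  (forall l i, pd_form bf x l i = p 0 i * bf x 0 l + bf x 0 i * c 0 l) ->
  is_derive x (delta_mx 0 l) B (B x * (2 * c 0 l - d 0 l)).
Proof.
move=> Ux hT hS.
have hr i : Ck_on 1 U (fun z => raise z 0 i).
  apply: (@Ck_on_ext _ _ 1 U (fun z => \sum_j bf z 0 j * invmx (af z) j i)) => //.
    by move=> z _; rewrite mxE.
  apply: Ck_on_sum => // j _; apply: Ck_onM => //; first exact: b_smooth.
  by apply: Ck_on_invmx => // [i' j'|]; [exact: a_smooth|exact: a_unit].
pose eps i := pd l (fun z => raise z 0 i) x.
have hre i : is_derive x (delta_mx 0 l) (fun z => raise z 0 i) (eps i).
  exact: (Ck_on_is_derive l (hr i)).
have hb i : is_derive x (delta_mx 0 l) (fun z => bf z 0 i) (pd_form bf x l i).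
  by rewrite mxE; exact: (Ck_on_is_derive l (b_smooth i 1%N)).
have ha i j : is_derive x (delta_mx 0 l) (fun z => af z i j) (pd_metric af x l i j).
  by rewrite mxE; exact: (Ck_on_is_derive l (a_smooth i j 1%N)).
have bE z i : U z -> bf z 0 i = \sum_j raise z 0 j * af z j i.
  by move=> Uz; rewrite -[bf z in LHS](mulmxKV (a_unit Uz)) mxE.
have SE i : pd_form bf x l i = \sum_j (eps j * af x j i + raise x 0 j * pd_metric af x l j i).
  have h : is_derive x (delta_mx 0 l) (fun z => \sum_j raise z 0 j * af z j i)
     (\sum_j (eps j * af x j i + raise x 0 j * pd_metric af x l j i)).
    by apply: is_derive_sum1 => j _; exact: is_deriveM1.
  have h' : is_derive x (delta_mx 0 l) (fun z => bf z 0 i)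
     (\sum_j (eps j * af x j i + raise x 0 j * pd_metric af x l j i)).
    by apply: (is_derive_ext oU _ Ux h) => z Uz; rewrite bE.
  by rewrite -(is_derive_pd h') mxE.
have BE z : B z = \sum_i raise z 0 i * bf z 0 i by rewrite -lin_raise lin_row.
have hB : is_derive x (delta_mx 0 l) B (\sum_i (eps i * bf x 0 i + raise x 0 i * pd_form bf x l i)).
  have -> : B = (fun z => \sum_i raise z 0 i * bf z 0 i) by apply/funext => z.
  by apply: is_derive_sum1 => i _; exact: is_deriveM1.
apply: is_derive_eq hB _.
rewrite big_split /=.
have X1 : \sum_i raise x 0 i * pd_form bf x l i = lin p (raise x) * bf x 0 l + B x * c 0 l.
  rewrite BE lin_row !mulr_suml -big_split /=; apply: eq_bigr => i _; rewrite hS; ring.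
have bE' i : mv (af x) i (raise x) = bf x 0 i.
  by rewrite bE // /mv; apply: eq_bigr => j _; rewrite (a_sym Ux i j) mulrC.
have X2 : \sum_i raise x 0 i * (\sum_j raise x 0 j * pd_metric af x l j i) =
   2 * lin p (raise x) * bf x 0 l + B x * d 0 l.
  transitivity (\sum_i (lin p (raise x) * (af x l i * raise x 0 i)
      + bf x 0 l * (raise x 0 i * p 0 i) + (raise x 0 i * bf x 0 i) * d 0 l)).
    apply: eq_bigr => i _.
    have -> : \sum_j raise x 0 j * pd_metric af x l j i = \sum_j (af x l i * (raise x 0 j * p 0 j)
       + p 0 i * (af x l j * raise x 0 j) + (af x i j * raise x 0 j) * d 0 l).
      by apply: eq_bigr => j _; rewrite hT (a_sym Ux l j) (a_sym Ux l i) (a_sym Ux i j); ring.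
    rewrite !big_split /= -!mulr_sumr -mulr_suml -lin_row.
    by rewrite -/(mv (af x) l (raise x)) -/(mv (af x) i (raise x)) !bE'; ring.
  rewrite !big_split /= -!mulr_suml -!mulr_sumr -BE -lin_row.
  by rewrite -/(mv (af x) l (raise x)) bE'; ring.
have X3 : \sum_i raise x 0 i * pd_form bf x l i = \sum_i eps i * bf x 0 i
    + \sum_i raise x 0 i * (\sum_j raise x 0 j * pd_metric af x l j i).
  transitivity (\sum_i (raise x 0 i * (\sum_j eps j * af x j i)
     + raise x 0 i * (\sum_j raise x 0 j * pd_metric af x l j i))).
    by apply: eq_bigr => i _; rewrite SE big_split mulrDr.
  rewrite big_split /=; congr (_ + _).
  under eq_bigr do rewrite mulr_sumr.
  rewrite exchange_big /=; apply: eq_bigr => j _.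
  rewrite -bE' /mv mulr_sumr; apply: eq_bigr => i _; ring.
move: X3; rewrite X1 X2 => X3; lra.
Qed.


(** The covector p with P = p(y), recovered from the derivatives of the normalised
    metric (see [normal_factorE]).  Unlike the covector provided pointwise by
    [pointwise_structure], it is manifestly smooth in x. *)
Definition normal_factor x : 'rV[R]_n :=
  \row_l ((2 * n%:R + 2)^-1 * \sum_i \sum_j invmx (normal_metric x) i j * pd_metric normal_metric x l i j).

Lemma normal_metric_sym x i j : U x -> normal_metric x i j = normal_metric x j i.
Proof. by move=> Ux; rewrite !mxE a_sym. Qed.

Lemma quad_scale (A : 'M[R]_n) t y : quad (t *: A) y = t * quad A y.
Proof.
rewrite /quad mulr_sumr; apply: eq_bigr => i _; rewrite mulr_sumr.
by apply: eq_bigr => j _; rewrite mxE !mulrA.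
Qed.

Lemma normal_metric_pos x y : U x -> y != 0 -> 0 < quad (normal_metric x) y.
Proof.
by move=> Ux y0; rewrite quad_scale mulr_gt0 ?a_pos // powR_gt0 // B_gt0.
Qed.

Lemma normal_unit x : U x -> normal_metric x \in unitmx.
Proof. by move=> Ux; apply: posdef_unitmx => y; exact: normal_metric_pos. Qed.

Lemma sqnorm_scale (A : 'M[R]_n) b (s t : R) : s != 0 -> A \in unitmx ->
  sqnorm (s *: A) (t *: b) = t ^+ 2 / s * sqnorm A b.
Proof.
move=> s0 uA; rewrite /sqnorm invmxZ ?unitfE //; last by rewrite unitmxZ ?unitfE.
have -> : (t *: b)^T = t *: b^T by apply/matrixP => i j; rewrite !mxE.
rewrite -scalemxAr -!scalemxAl -scalemxAr -scalemxAl !scalerA mxE.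
by congr (_ * _); ring.
Qed.

Lemma normal_form_unit x : U x -> sqnorm (normal_metric x) (normal_form x) = 1.
Proof.
move=> Ux; have B0 := B_gt0 Ux.
rewrite sqnorm_scale ?a_unit ?gt_eqF ?powR_gt0 // -/(B x).
rewrite expr2 -powRD; last by rewrite (gt_eqF B0) implybT.
rewrite -powRN -powRD; last by rewrite (gt_eqF B0) implybT.
rewrite -[X in _ * X]powRr1 ?ltW // -powRD; last by rewrite (gt_eqF B0) implybT.
rewrite (_ : _ + _ = 0) ?powRr0 //.
by field.
Qed.

(** d_l B = B (2 c_l - d_l), so the rescaling adds multiples of 2 c_l - d_l to the
    coefficients d_l and c_l, and 2 m c + (1 - m) d = 2 p turns the sums into 2 p_l
    and p_l. *)
Lemma normal_derivatives x : U x -> exists p : 'rV[R]_n,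
  [/\ forall l i j, pd_metric normal_metric x l i j =
         p 0 i * normal_metric x j l + p 0 j * normal_metric x i l + 2 * p 0 l * normal_metric x i j,
      forall l i, pd_form normal_form x l i = p 0 i * normal_form x 0 l + p 0 l * normal_form x 0 i &
      forall y, reg x y -> projective_factor m af bf x y = lin p y].
Proof.
move=> Ux; have [p [c [d [hT hS hcd hp]]]] := pointwise_structure Ux.
have B0 := B_gt0 Ux; have Bn0 := lt0r_neq0 B0.
have powB (k : R) l : is_derive x (delta_mx 0 l) (fun z => B z `^ k)
     (B x `^ k * (k * (2 * c 0 l - d 0 l))).
  apply: is_derive_eq (is_derive_powR1 k B0 (is_derive_B l Ux hT hS)) _.
  have -> : B x `^ k = B x `^ (k - 1) * B x.
    rewrite -{3}[B x]powRr1 ?ltW // -powRD ?subrK //.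
    by rewrite (gt_eqF B0) implybT.
  by ring.
exists p; split => //.
- move=> l i j; rewrite mxE.
  have h : is_derive x (delta_mx 0 l) (fun z => normal_metric z i j)
     (B x `^ m * (m * (2 * c 0 l - d 0 l)) * af x i j + B x `^ m * pd_metric af x l i j).
    have -> : (fun z => normal_metric z i j) = (fun z => B z `^ m * af z i j).
      by apply/funext => z; rewrite mxE.
    apply: is_deriveM1 => //; rewrite mxE; exact: (Ck_on_is_derive l (a_smooth i j 1%N)).
  rewrite (is_derive_pd h) hT !mxE -/(B x).
  have := hcd l; move: (B x `^ m) => t E.
  transitivity (t * (p 0 i * af x j l + p 0 j * af x i l
    + (2 * m * c 0 l + (1 - m) * d 0 l) * af x i j)); first by ring.
  by rewrite E; ring.
- move=> l i; rewrite mxE.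
  have h : is_derive x (delta_mx 0 l) (fun z => normal_form z 0 i)
     (B x `^ ((m - 1) / 2) * ((m - 1) / 2 * (2 * c 0 l - d 0 l)) * bf x 0 i
       + B x `^ ((m - 1) / 2) * pd_form bf x l i).
    have -> : (fun z => normal_form z 0 i) = (fun z => B z `^ ((m - 1) / 2) * bf z 0 i).
      by apply/funext => z; rewrite mxE.
    apply: is_deriveM1 => //; rewrite mxE; exact: (Ck_on_is_derive l (b_smooth i 1%N)).
  rewrite (is_derive_pd h) hS !mxE -/(B x).
  have := hcd l; move: (B x `^ ((m - 1) / 2)) => t E.
  transitivity (t * (p 0 i * bf x 0 l + 2^-1 * (2 * m * c 0 l + (1 - m) * d 0 l) * bf x 0 i)).
    by field.
  by rewrite E; field.
Qed.

(** Contracting d_l g_ij with the inverse of g gives p_l + p_l + 2 n p_l. *)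
Lemma normal_factorE x (p : 'rV[R]_n) : U x ->
  (forall l i j, pd_metric normal_metric x l i j =
    p 0 i * normal_metric x j l + p 0 j * normal_metric x i l + 2 * p 0 l * normal_metric x i j) ->
  p = normal_factor x.
Proof.
move=> Ux hT; apply/rowP => l; rewrite mxE.
set g := normal_metric x.
have gV i k : \sum_j invmx g i j * g j k = (i == k)%:R.
  have := mulVmx (normal_unit Ux); rewrite -/g => /matrixP /(_ i k).
  by rewrite !mxE.
have n0 : (2 * n%:R + 2 : R) != 0 by rewrite gt_eqF // ltr_wpDl // mulr_ge0.
apply: (mulfI n0); rewrite mulrA divff // mul1r.
transitivity (\sum_i (p 0 i * (\sum_j invmx g i j * g j l)
   + \sum_j (invmx g i j * p 0 j * g i l)
   + 2 * p 0 l * (\sum_j invmx g i j * g j i))); last first.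
  apply: eq_bigr => i _; rewrite !mulr_sumr -!big_split /=; apply: eq_bigr => j _.
  by rewrite hT -/g (normal_metric_sym j i Ux); ring.
rewrite !big_split /= -mulr_sumr.
have -> : \sum_i p 0 i * (\sum_j invmx g i j * g j l) = p 0 l.
  rewrite (bigD1 l) //= gV eqxx mulr1 big1 ?addr0 // => i il.
  by rewrite gV (negbTE il) mulr0.
have -> : \sum_i \sum_j invmx g i j * p 0 j * g i l = p 0 l.
  rewrite exchange_big /=.
  have gV' j k : \sum_i g k i * invmx g i j = (k == j)%:R.
    by have := mulmxV (normal_unit Ux); rewrite -/g => /matrixP /(_ k j); rewrite !mxE.
  transitivity (\sum_j p 0 j * (\sum_i g l i * invmx g i j)).
    apply: eq_bigr => j _; rewrite mulr_sumr; apply: eq_bigr => i _.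
    by rewrite /g (normal_metric_sym i l Ux); ring.
  rewrite (bigD1 l) //= gV' eqxx mulr1 big1 ?addr0 // => i il.
  by rewrite gV' eq_sym (negbTE il) mulr0.
have -> : \sum_i \sum_j invmx g i j * g j i = n%:R.
  under eq_bigr do rewrite gV eqxx.
  by rewrite sumr_const card_ord.
by ring.
Qed.

Lemma normal_factor_smooth l : smooth_on U (fun x => normal_factor x 0 l).
Proof.
move=> k; apply: (@Ck_on_ext _ _ k U (fun x => (2 * n%:R + 2)^-1 *
  \sum_i \sum_j invmx (normal_metric x) i j * pd l (fun z => normal_metric z i j) x)) => //.
  move=> x _; rewrite mxE; congr (_ * _); apply: eq_bigr => i _; apply: eq_bigr => j _.
  by rewrite [pd_metric _ _ _ _ _]mxE.
apply: Ck_onM => //; first exact: Ck_on_cst.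
apply: Ck_on_sum => // i _; apply: Ck_on_sum => // j _; apply: Ck_onM => //.
  by apply: Ck_on_invmx => // [i' j'|]; [exact: normal_metric_smooth|exact: normal_unit].
exact: (Ck_on_pd l (normal_metric_smooth i j k.+1)).
Qed.

Lemma normal_structure x : U x ->
  [/\ forall l i j, pd l (fun z => normal_metric z i j) x =
         normal_factor x 0 i * normal_metric x j l + normal_factor x 0 j * normal_metric x i l
         + 2 * normal_factor x 0 l * normal_metric x i j,
      forall l i, pd l (fun z => normal_form z 0 i) x =
         normal_factor x 0 i * normal_form x 0 l + normal_factor x 0 l * normal_form x 0 i &
      forall y, reg x y -> P x y = lin (normal_factor x) y].
Proof.
move=> Ux; have [p [hT hS hp]] := normal_derivatives Ux.
have pE := normal_factorE Ux hT; rewrite -pE; split.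
- by move=> l i j; rewrite -hT mxE.
- by move=> l i; rewrite -hS mxE.
- by move=> y ry; rewrite -hp //; have [] := reg_projective Ux ry.
Qed.

(** P = p(y) on the regular directions, so K = 0 is the equality of the quadratic
    forms y^k y^j d_k p_j and p(y)^2 there, hence everywhere; polarise. *)
Lemma normal_factor_sym_derivative x k j : U x ->
  pd k (fun z => normal_factor z 0 j) x + pd j (fun z => normal_factor z 0 k) x
    = 2 * normal_factor x 0 k * normal_factor x 0 j.
Proof.
move=> Ux.
pose D : 'M[R]_n := \matrix_(k, j) pd k (fun z => normal_factor z 0 j) x.
pose N : 'M[R]_n := \matrix_(k, j) (normal_factor x 0 k * normal_factor x 0 j).
have DE i l : D i l = pd i (fun z => normal_factor z 0 l) x by rewrite [LHS]mxE.
have NE i l : N i l = normal_factor x 0 i * normal_factor x 0 l by rewrite [LHS]mxE.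
have H : forall y, quad D y + - quad N y = 0.
  apply: (@dense_regular_direction R n m (af x) (bf x) (e x) (B x)^-1 (B x)) => //.
  - exact: a_sym.
  - exact: BV1.
  - by move=> z; exact: e_dual.
  - exact: lin_be.
  - by polyline_tac.
  move=> y ry; apply/eqP; rewrite subr_eq0; apply/eqP.
  transitivity (P x y ^+ 2).
    rewrite flag_zero //; have [V [oV Vx hV]] := reg_near Ux ry.
    rewrite quadE /bil; apply: eq_bigr => i _; rewrite mulrC; congr (_ * _).
    transitivity (pd i (fun z => lin (normal_factor z) y) x); last first.
      apply: (pd_ext _ oV) => // z /hV[Uz rz]; by have [_ _ ->] := normal_structure Uz.
    apply/esym/is_derive_pd; apply: is_derive_sum1 => l _; rewrite DE.
    have h := Ck_on_is_derive i (normal_factor_smooth l 1%N) Ux.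
    apply: is_derive_eq (is_deriveM1 h (is_derive_cst (y 0 l) x _)) _.
    by rewrite mulr0 addr0.
  have [_ _ ->] // := normal_structure Ux.
  rewrite expr2 {1}/lin mulr_suml /quad; apply: eq_bigr => i _.
  by rewrite /lin mulr_sumr; apply: eq_bigr => l _; rewrite NE; ring.
have H' : forall y, quad D y = quad N y.
  by move=> y; apply/eqP; rewrite -subr_eq0 H.
have := quad_polar H' k j; rewrite !DE !NE => ->; ring.
Qed.

(** By [normal_factor_sym_derivative] the difference s_kj = d_k p_j - p_k p_j is
    antisymmetric.  The symmetry of the second derivatives of w gives
    s_ki w_l + s_il w_k + 2 s_kl w_i = 0.  Fix r with w_r <> 0: the case
    k = i = r gives s_rl = 0 for all l, and then the case l = r gives s_ki = 0. *)
Lemma normal_factor_derivative x k j : U x ->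
  pd k (fun z => normal_factor z 0 j) x = normal_factor x 0 k * normal_factor x 0 j.
Proof.
move=> Ux.
pose Sk k j := pd k (fun z => normal_factor z 0 j) x - normal_factor x 0 k * normal_factor x 0 j.
suff Sk0 : Sk k j = 0 by apply/eqP; rewrite -subr_eq0; apply/eqP.
have anti k' j' : Sk k' j' = - Sk j' k'.
  have := normal_factor_sym_derivative k' j' Ux; rewrite /Sk => /eqP.
  rewrite -subr_eq0 => /eqP H; apply/eqP; rewrite -subr_eq0; apply/eqP.
  by rewrite -[RHS]H; ring.
have second k' l i : pd k' (pd l (fun z => normal_form z 0 i)) x =
   (Sk k' i + normal_factor x 0 k' * normal_factor x 0 i) * normal_form x 0 l
   + normal_factor x 0 i * (normal_factor x 0 l * normal_form x 0 k' + normal_factor x 0 k' * normal_form x 0 l)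
   + ((Sk k' l + normal_factor x 0 k' * normal_factor x 0 l) * normal_form x 0 i
   + normal_factor x 0 l * (normal_factor x 0 i * normal_form x 0 k' + normal_factor x 0 k' * normal_form x 0 i)).
  transitivity (pd k' (fun z => normal_factor z 0 i * normal_form z 0 l
     + normal_factor z 0 l * normal_form z 0 i) x).
    by apply: (pd_ext _ oU) => // z Uz; have [_ -> _] := normal_structure Uz.
  apply: is_derive_pd.
  have hp i' := Ck_on_is_derive k' (normal_factor_smooth i' 1%N) Ux.
  have hb i' := Ck_on_is_derive k' (normal_form_smooth i' 1%N) Ux.
  apply: is_derive_eq (is_deriveD1 (is_deriveM1 (hp i) (hb l)) (is_deriveM1 (hp l) (hb i))) _.
  have [_ hS _] := normal_structure Ux.
  by rewrite !hS /Sk !subrK.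
have E k' l i : Sk k' i * normal_form x 0 l + Sk i l * normal_form x 0 k'
    + 2 * Sk k' l * normal_form x 0 i = 0.
  have := pdC k' l oU (normal_form_smooth i 2%N) Ux; rewrite !second (anti l k') (anti i l).
  move: (Sk k' i) (Sk l i) (Sk k' l) (normal_form x 0 l) (normal_form x 0 k')
    (normal_form x 0 i) (normal_factor x 0 l) (normal_factor x 0 k') (normal_factor x 0 i).
  move=> s1 s2 s3 b1 b2 b3 p1 p2 p3 /eqP; rewrite -subr_eq0 => /eqP H.
  by rewrite -[RHS]H; ring.
have [l bl] : exists l, normal_form x 0 l != 0.
  apply/existsP; rewrite -negb_forall; apply/negP => /forallP h.
  have : normal_form x = 0 by apply/rowP => i; rewrite (eqP (h i)) mxE.
  move/eqP; rewrite scaler_eq0 (negbTE (b_neq0 Ux)) orbF powR_eq0.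
  by rewrite (gt_eqF (B_gt0 Ux)).
have Sl i : Sk l i = 0.
  have H := E l i l.
  have Sll : Sk l l = 0.
    have /eqP := anti l l; rewrite -addr_eq0 -mulr2n mulrn_eq0 /= => /eqP //.
  rewrite Sll mul0r add0r in H.
  have : 3 * normal_form x 0 l * Sk l i = 0 by rewrite -[RHS]H; ring.
  by move/eqP; rewrite !mulf_eq0 pnatr_eq0 (negbTE bl) /= => /eqP.
have := E k l j; rewrite (anti j l) (anti k l) !Sl oppr0 !(mul0r, mulr0, addr0) => /eqP.
by rewrite mulf_eq0 (negbTE bl) orbF => /eqP.
Qed.

End LocalStructure.

(** * Orthonormal coframes *)

Section Frames.
Variable R : realType.

(** Eliminating the first row leaves the Schur complement, which is again symmetric
    and positive definite: its value at z is the value of a at the vector that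
    completes z orthogonally to the first basis vector. *)
Lemma cholesky n (a : 'M[R]_n) : a^T = a ->
  (forall y : 'rV[R]_n, y != 0 -> 0 < (y *m a *m y^T) 0 0) -> exists C : 'M[R]_n, C *m C^T = a.
Proof.
elim: n a => [|n IH] a aT apos; first by exists 0; apply/matrixP => -[].
move: a aT apos; rewrite -[n.+1]/(1 + n)%N => a aT apos.
pose r := ursubmx a; pose D := drsubmx a; pose al := ulsubmx a 0 0.
have aE : a = block_mx al%:M r r^T D.
  rewrite -[a in LHS]submxK; congr block_mx.
    by apply/matrixP => i j; rewrite !ord1 [in RHS]mxE eqxx.
  by rewrite /r trmx_ursub aT.
have al0 : 0 < al.
  have nz : (row_mx 1 0 : 'rV[R]_(1 + n)) != 0.
    apply/eqP => /(congr1 (fun M : 'rV[R]_(1 + n) => lsubmx M)).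
    by rewrite row_mxKl linear0 => /eqP; rewrite oner_eq0.
  have := apos _ nz; rewrite aE mul_row_block tr_row_mx mul_row_col !mul0mx !addr0 !mul1mx.
  by rewrite trmx1 mulmx1 trmx0 mulmx0 addr0 mxE eqxx.
have aln := lt0r_neq0 al0.
pose D' := D - al^-1 *: (r^T *m r).
have DT : D^T = D by rewrite /D trmx_drsub aT.
have D'T : D'^T = D' by rewrite /D' linearB /= linearZ /= trmx_mul trmxK DT.
have D'pos (z : 'rV[R]_n) : z != 0 -> 0 < (z *m D' *m z^T) 0 0.
  move=> z0.
  pose y : 'rV[R]_(1 + n) := row_mx (- al^-1 *: (z *m r^T)) z.
  have y0 : y != 0.
    apply: contra_neq z0 => /(congr1 (fun M : 'rV[R]_(1 + n) => rsubmx M)).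
    by rewrite row_mxKr linear0.
  have := apos y y0; congr (0 < fun_of_matrix _ _ _).
  rewrite aE mul_row_block tr_row_mx mul_row_col.
  have -> : - al^-1 *: (z *m r^T) *m al%:M + z *m r^T = 0.
    by rewrite mul_mx_scalar scalerA mulrN divff // scaleN1r addNr.
  rewrite mul0mx add0r; congr (_ *m _).
  by rewrite /D' mulmxBr addrC -scalemxAr -scalemxAl -mulmxA scaleNr.
have [C' hC'] := IH D' D'T D'pos.
pose s := Num.sqrt al.
have ss : s * s = al by rewrite -expr2 sqr_sqrtr // ltW.
have s0 : s != 0 by rewrite gt_eqF // sqrtr_gt0.
exists (block_mx s%:M 0 (s^-1 *: r^T) C').
rewrite tr_block_mx mulmx_block !trmx0 !mulmx0 !mul0mx !addr0 aE.
congr block_mx.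
- by rewrite tr_scalar_mx -scalar_mxM ss.
- by rewrite mul_scalar_mx linearZ /= scalerA divff // scale1r trmxK.
- by rewrite tr_scalar_mx mul_mx_scalar scalerA divff // scale1r.
- rewrite hC' linearZ /= trmxK -scalemxAl -scalemxAr scalerA -invfM ss /D'.
  by rewrite addrC subrK.
Qed.

(** The reflection in the hyperplane orthogonal to v - e0 exchanges v and e0. *)
Lemma orthogonal_first_row n (v : 'rV[R]_n.+1) : v *m v^T = 1%:M ->
  exists Q : 'M[R]_n.+1, Q *m Q^T = 1%:M /\ row 0 Q = v.
Proof.
move=> vv.
pose e0 : 'rV[R]_n.+1 := delta_mx 0 0.
have e00 : e0 *m e0^T = 1%:M.
  by rewrite trmx_delta mul_delta_mx; apply/matrixP => i j; rewrite !ord1 !mxE.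
have [->|ve] := eqVneq v e0.
  by exists 1%:M; rewrite trmx1 mulmx1 rowE mulmx1.
pose w := v - e0.
pose c := v 0 0.
have ve0 : v *m e0^T = c%:M.
  by rewrite trmx_delta; apply/matrixP => i j; rewrite !ord1 -colE !mxE.
have e0v : e0 *m v^T = c%:M by rewrite -[LHS]trmxK trmx_mul trmxK ve0 tr_scalar_mx.
have ww : w *m w^T = (2 - 2 * c)%:M.
  rewrite /w linearB /= mulmxBl !mulmxBr vv ve0 e0v e00.
  by apply/matrixP => i j; rewrite !ord1 !mxE eqxx !mulr1n; ring.
have wE : w = v - e0 by [].
clearbody w.
have k0 : 2 - 2 * c != 0.
  apply/eqP => k0; rewrite k0 in ww; move/eqP: ve; apply; apply/eqP; rewrite -subr_eq0 -wE.
  apply/eqP/rowP => i.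
  have : (w *m w^T) 0 0 = 0 by rewrite ww mxE mul0rn.
  rewrite mxE => /eqP; rewrite psumr_eq0 => [/allP /(_ i)|j _]; last by rewrite mxE -expr2 sqr_ge0.
  by rewrite mem_index_enum => /(_ isT) /=; rewrite mxE mulf_eq0 orbb => /eqP ->; rewrite mxE.
pose Q : 'M[R]_n.+1 := 1%:M - (2 / (2 - 2 * c)) *: (w^T *m w).
have QT : Q^T = Q by rewrite /Q linearB /= trmx1 linearZ /= trmx_mul trmxK.
exists Q; split.
  pose X : 'M[R]_n.+1 := (2 / (2 - 2 * c)) *: (w^T *m w).
  have XX : X *m X = X + X.
    rewrite /X -scalemxAl -scalemxAr scalerA mulmxA -(mulmxA w^T) ww mul_mx_scalar.
    rewrite -scalemxAl scalerA -scalerDl; congr (_ *: _).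
    by field.
  by rewrite QT /Q -/X mulmxBl mul1mx mulmxBr mulmx1 XX opprB addrK subrK.
rewrite rowE -/e0 /Q mulmxBr mulmx1 -scalemxAr mulmxA.
have -> : e0 *m w^T = (c - 1)%:M.
  by rewrite wE linearB /= mulmxBr e0v e00 -raddfB.
rewrite mul_scalar_mx scalerA.
have -> : 2 / (2 - 2 * c) * (c - 1) = -1 by field.
by rewrite scaleN1r opprK wE addrC subrK.
Qed.

(** A Cholesky factor C gives some orthonormal coframe, in which the covector b has
    unit coordinates v; an orthogonal matrix with first row v rotates it into the
    first position. *)
Lemma adapted_coframe n (a : 'M[R]_n.+1) (b : 'rV[R]_n.+1) :
  (forall i j, a i j = a j i) -> (forall y, y != 0 -> 0 < quad a y) -> sqnorm a b = 1 ->
  exists E : 'M[R]_n.+1, E *m E^T = a /\ forall i, E i 0 = b 0 i.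
Proof.
move=> asym apos hb.
have aT : a^T = a by apply/matrixP => i j; rewrite mxE.
have [|C hC] := cholesky aT.
  by move=> y y0; rewrite -bilE -quadE; exact: apos.
have ua := posdef_unitmx apos.
have uC : C \in unitmx by move: ua; rewrite -hC unitmx_mul => /andP[].
pose v := b *m invmx C^T.
have uCT : C^T \in unitmx by rewrite unitmx_tr.
have vv : v *m v^T = 1%:M.
  rewrite /v trmx_mul -trmx_inv trmxK mulmxA.
  have E : invmx a = (invmx C)^T *m invmx C.
    rewrite trmx_inv.
    apply: (mulrI ua); rewrite -!mulmxE mulmxV // -hC -mulmxA (mulmxA C^T) mulmxV // mul1mx mulmxV //.
  rewrite -(mulmxA b) -E; apply/matrixP => i j; rewrite !ord1 [RHS]mxE eqxx.
  exact: hb.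
have [Q [QQ Qv]] := orthogonal_first_row vv.
have QQ' : Q^T *m Q = 1%:M by apply: mulmx1C.
exists (C *m Q^T); split.
  by rewrite trmx_mul trmxK -!mulmxA (mulmxA Q^T) QQ' mul1mx.
move=> i.
have -> : (C *m Q^T) i 0 = (C *m v^T) i 0.
  by rewrite -Qv tr_row !mxE; apply: eq_bigr => k _; rewrite !mxE.
by rewrite /v trmx_mul -trmx_inv trmxK mulKVmx // mxE.
Qed.

End Frames.

(** * Straightening by a projective map *)


Section ProjectiveMap.
Variables (R : realType) (n : nat) (x0 p0 : 'rV[R]_n) (E : 'M[R]_n).
Hypothesis uE : E \in unitmx.
Implicit Types x z : 'rV[R]_n.

Definition pden x : R := 1 - lin p0 (x - x0).
Definition pnum x : 'rV[R]_n := (x - x0) *m E.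
Definition proj_map x : 'rV[R]_n := (pden x)^-1 *: pnum x.
Definition qden z : R := 1 + lin p0 (z *m invmx E).
Definition proj_inv z : 'rV[R]_n := x0 + (qden z)^-1 *: (z *m invmx E).
(** The Jacobian of [proj_map]; see [is_derive_proj_map]. *)
Definition pjac x : 'M[R]_n :=
  \matrix_(i, a) (E i a / pden x + pnum x 0 a * p0 0 i / pden x ^+ 2).

Lemma pjacE x i a :
  pjac x i a = E i a / pden x + pnum x 0 a * p0 0 i / pden x ^+ 2.
Proof. by rewrite [LHS]mxE. Qed.

Lemma linZ (b : 'rV[R]_n) c v : lin b (c *: v) = c * lin b v.
Proof. by rewrite -[c *: v]addr0 linP lin0 addr0. Qed.

Lemma qden_proj_map x : pden x != 0 -> qden (proj_map x) = (pden x)^-1.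
Proof.
move=> u0; rewrite /qden /proj_map /pnum -scalemxAl mulmxK // linZ.
have -> : lin p0 (x - x0) = 1 - pden x by rewrite /pden subKr.
by field.
Qed.

Lemma proj_invK x : pden x != 0 -> proj_inv (proj_map x) = x.
Proof.
move=> u0; rewrite /proj_inv qden_proj_map // invrK /proj_map /pnum -scalemxAl mulmxK //.
by rewrite scalerA divff // scale1r addrC subrK.
Qed.

Lemma pden_proj_inv z : qden z != 0 -> pden (proj_inv z) = (qden z)^-1.
Proof.
move=> v0; rewrite /pden /proj_inv addrAC subrr add0r linZ.
have -> : lin p0 (z *m invmx E) = qden z - 1 by rewrite /qden addrAC subrr add0r.
by field.
Qed.

Lemma proj_mapK z : qden z != 0 -> proj_map (proj_inv z) = z.
Proof.
move=> v0; rewrite /proj_map pden_proj_inv // invrK /pnum /proj_inv addrAC subrr add0r.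
by rewrite -scalemxAl mulmxKV // scalerA divff // scale1r.
Qed.

Lemma is_derive_pden x i : is_derive x (delta_mx 0 i) pden (- p0 0 i).
Proof.
have h : is_derive x (delta_mx 0 i) (fun z => lin p0 (z - x0)) (p0 0 i).
  apply: (@is_derive_lin_comp _ _ _ (lin p0) (fun z => z - x0) _ _ (delta_mx 0 i)).
    by move=> t; rewrite addrA.
  exact: is_derive_lin.
apply: is_derive_eq (is_deriveB1 (is_derive_cst (1 : R) x _) h) _.
by rewrite sub0r.
Qed.

Lemma is_derive_pnum x i a : is_derive x (delta_mx 0 i) (fun z => pnum z 0 a) (E i a).
Proof.
have -> : (fun z => pnum z 0 a) = (fun z => lin (\row_k E k a) (z - x0)).
  by apply/funext => z; rewrite linE /pnum mxE mxE; apply: eq_bigr => k _; rewrite !mxE mulrC.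
have -> : E i a = (\row_k E k a) 0 i by rewrite mxE.
apply: (@is_derive_lin_comp _ _ _ (lin (\row_k E k a)) (fun z => z - x0) _ _ (delta_mx 0 i)).
  by move=> t; rewrite addrA.
exact: is_derive_lin.
Qed.

Lemma is_derive_proj_map x i a : pden x != 0 ->
  is_derive x (delta_mx 0 i) (fun z => proj_map z 0 a) (pjac x i a).
Proof.
move=> u0; have -> : (fun z => proj_map z 0 a) = (fun z => pnum z 0 a / pden z).
  by apply/funext => z; rewrite mxE mulrC.
apply: is_derive_eq (is_derive_quotient u0 (is_derive_pnum x i a) (is_derive_pden x i)) _.
by rewrite pjacE; field.
Qed.

(** J satisfies the same system as the normalised form, with p replaced by the
    explicit solution p0 / u. *)
Lemma is_derive_pjac x l i a : pden x != 0 ->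
  is_derive x (delta_mx 0 l) (fun z => pjac z i a)
    (p0 0 i / pden x * pjac x l a + p0 0 l / pden x * pjac x i a).
Proof.
move=> u0.
have -> : (fun z => pjac z i a) =
   (fun z => E i a / pden z + pnum z 0 a * p0 0 i / (pden z * pden z)).
  by apply/funext => z; rewrite pjacE expr2.
have hu := is_derive_pden x l.
have uu0 : pden x * pden x != 0 by rewrite mulf_neq0.
have h1 := is_derive_quotient u0 (is_derive_cst (E i a) x (delta_mx 0 l)) hu.
have h2 := @is_derive_quotient _ _ _ (fun z => pden z * pden z) x _ _ _ uu0
  (is_deriveM1 (is_derive_pnum x l a) (is_derive_cst (p0 0 i) x _)) (is_deriveM1 hu hu).
apply: is_derive_eq (is_deriveD1 h1 h2) _.
by rewrite !pjacE /cst; field.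
Qed.

Lemma Ck_on_affine k (U : set 'rV[R]_n) (c : R) (b y0 : 'rV[R]_n) : open U ->
  Ck_on k U (fun x => c + lin b (x - y0)).
Proof.
move=> oU; apply: (@Ck_on_ext _ _ k U (fun x => (c - lin b y0) + \sum_i b 0 i * x 0 i)) => //.
  move=> x _; rewrite -addrA; congr (_ + _).
  have -> : x - y0 = (-1) *: y0 + x by rewrite scaleN1r addrC.
  by rewrite linP mulN1r.
apply: Ck_onD => //; first exact: Ck_on_cst.
apply: Ck_on_sum => // i _; apply: Ck_onM => //; [exact: Ck_on_cst|exact: Ck_on_coord].
Qed.

Lemma Ck_on_pden k (U : set 'rV[R]_n) : open U -> Ck_on k U pden.
Proof.
move=> oU; apply: (@Ck_on_ext _ _ k U (fun x => 1 + lin (- p0) (x - x0))) => //; last exact: Ck_on_affine.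
by move=> x _; rewrite /pden linE mulNmx mxE -linE.
Qed.

Lemma Ck_on_rowmul k (U : set 'rV[R]_n) (f : 'rV[R]_n -> 'rV[R]_n) (M : 'M[R]_n) a : open U ->
  (forall i, Ck_on k U (fun x => f x 0 i)) -> Ck_on k U (fun x => (f x *m M) 0 a).
Proof.
move=> oU hf; apply: (@Ck_on_ext _ _ k U (fun x => \sum_i f x 0 i * M i a)) => //.
  by move=> x _; rewrite mxE.
by apply: Ck_on_sum => // i _; apply: Ck_onM => //; exact: Ck_on_cst.
Qed.

Lemma Ck_on_pnum k (U : set 'rV[R]_n) a : open U -> Ck_on k U (fun x => pnum x 0 a).
Proof.
move=> oU; apply: Ck_on_rowmul => // i.
apply: (@Ck_on_ext _ _ k U (fun x => x 0 i + - x0 0 i)) => //; first by move=> x _; rewrite !mxE.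
by apply: Ck_onD => //; [exact: Ck_on_coord|exact: Ck_on_cst].
Qed.

Lemma Ck_on_proj_map k (U : set 'rV[R]_n) a : open U -> (forall x, U x -> pden x != 0) ->
  Ck_on k U (fun x => proj_map x 0 a).
Proof.
move=> oU u0; apply: (@Ck_on_ext _ _ k U (fun x => (pden x)^-1 * pnum x 0 a)) => //.
  by move=> x _; rewrite [RHS]mxE.
apply: Ck_onM => //; last exact: Ck_on_pnum.
by apply: Ck_onV => //; exact: Ck_on_pden.
Qed.

Lemma Ck_on_qden k (U : set 'rV[R]_n) : open U -> Ck_on k U qden.
Proof.
move=> oU; apply: Ck_onD => //; first exact: Ck_on_cst.
apply: Ck_on_sum => // i _; apply: Ck_onM => //; first exact: Ck_on_cst.
by apply: Ck_on_rowmul => // j; exact: Ck_on_coord.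
Qed.

Lemma Ck_on_proj_inv k (U : set 'rV[R]_n) a : open U -> (forall z, U z -> qden z != 0) ->
  Ck_on k U (fun z => proj_inv z 0 a).
Proof.
move=> oU v0.
apply: (@Ck_on_ext _ _ k U (fun z => x0 0 a + (qden z)^-1 * (z *m invmx E) 0 a)) => //.
  by move=> z _; rewrite [RHS]mxE [X in _ = _ + X]mxE.
apply: Ck_onD => //; first exact: Ck_on_cst.
apply: Ck_onM => //; first by apply: Ck_onV => //; exact: Ck_on_qden.
by apply: Ck_on_rowmul => // j; exact: Ck_on_coord.
Qed.

Lemma Ck_on_pjac k (U : set 'rV[R]_n) i a : open U -> (forall x, U x -> pden x != 0) ->
  Ck_on k U (fun x => pjac x i a).
Proof.
move=> oU u0.
have hV : Ck_on k U (fun x => (pden x)^-1) by apply: Ck_onV => //; exact: Ck_on_pden.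
apply: (@Ck_on_ext _ _ k U (fun x => E i a * (pden x)^-1
   + (pnum x 0 a * p0 0 i) * ((pden x)^-1 * (pden x)^-1))) => //.
  by move=> x _; rewrite pjacE expr2 invfM.
have hc c : Ck_on k U (fun=> c) by exact: Ck_on_cst.
apply: Ck_onD => //; apply: Ck_onM => //; last exact: Ck_onM.
by apply: Ck_onM => //; exact: Ck_on_pnum.
Qed.

Lemma pden_x0 : pden x0 = 1.
Proof. by rewrite /pden subrr lin0 subr0. Qed.

Lemma pjac_x0 i a : pjac x0 i a = E i a.
Proof. by rewrite pjacE pden_x0 divr1 /pnum subrr mul0mx mxE !mul0r addr0. Qed.

End ProjectiveMap.

Section Straightening.
Variables (R : realType) (n : nat) (U : set 'rV[R]_n).
Variables (g : 'rV[R]_n -> 'M[R]_n) (b p : 'rV[R]_n -> 'rV[R]_n).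
Hypothesis oU : open U.
Hypothesis g_smooth : forall i j, smooth_on U (fun x => g x i j).
Hypothesis b_smooth : forall i, smooth_on U (fun x => b x 0 i).
Hypothesis p_smooth : forall i, smooth_on U (fun x => p x 0 i).
Hypothesis pd_g : forall x, U x -> forall l i j, pd l (fun z => g z i j) x =
  p x 0 i * g x j l + p x 0 j * g x i l + 2 * p x 0 l * g x i j.
Hypothesis pd_b : forall x, U x -> forall l i, pd l (fun z => b z 0 i) x =
  p x 0 i * b x 0 l + p x 0 l * b x 0 i.
Hypothesis pd_p : forall x, U x -> forall k j,
  pd k (fun z => p z 0 j) x = p x 0 k * p x 0 j.
Variables (x0 : 'rV[R]_n) (E : 'M[R]_n) (i0 : 'I_n).
Hypothesis Ux0 : U x0.
Hypothesis EE : E *m E^T = g x0.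
Hypothesis E_i0 : forall i, E i i0 = b x0 0 i.

Let sum_indicator (I : finType) (G : I -> R) k : \sum_c (c == k)%:R * G c = G k.
Proof.
rewrite (bigD1 k) //= eqxx mul1r big1 ?addr0 // => c ck.
by rewrite (negbTE ck) mul0r.
Qed.

(** p u - p(x0), then b minus a column of J, then g - J J^T satisfy linear
    homogeneous systems and vanish at x0, so [linear_system_zero] applies to each.
    The order matters: the last two systems are homogeneous only once p = p(x0) / u
    is known. *)
Lemma straightening : exists2 r : R, 0 < r & forall x, ball x0 r x ->
  [/\ U x, 0 < pden x0 (p x0) x,
      g x = pjac x0 (p x0) E x *m (pjac x0 (p x0) E x)^T &
      forall i, b x 0 i = pjac x0 (p x0) E x i i0].
Proof.
set u := pden x0 (p x0).
have cu : {in U, continuous u} by apply: (@Ck_on_cont _ _ 0); exact: Ck_on_pden.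
have oW := open_setI_preimage oU cu (@open_gt R 0).
have Wx0 : (U `&` u @^-1` [set t : R | 0 < t]) x0.
  by split => //; rewrite /= /u pden_x0 ltr01.
have [r /= r0 hr] : exists2 r : R, 0 < r & ball x0 r `<=` (U `&` u @^-1` [set t : R | 0 < t]).
  have : \forall z \near x0, (U `&` u @^-1` [set t : R | 0 < t]) z.
    exact: (open_nbhs_nbhs (conj oW Wx0)).
  by move=> /nbhs_ballP[r /= r0 hr]; exists r.
have ob : open (ball x0 r) by exact: ball_open.
have hU x : ball x0 r x -> U x by move=> /hr [].
have hu x : ball x0 r x -> 0 < u x by move=> /hr [].
have hu0 x : ball x0 r x -> u x != 0 by move=> /hu /lt0r_neq0.
have bU : ball x0 r `<=` U by move=> x /hU.
have sub k f : Ck_on k U f -> Ck_on k (ball x0 r) f by exact: Ck_on_sub.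
have cst0 k c : Ck_on k (ball x0 r) (fun=> c) by exact: Ck_on_cst.
have Cu k : Ck_on k (ball x0 r) u by exact: Ck_on_pden.
have Cp k i : Ck_on k (ball x0 r) (fun x => p x 0 i) by apply: sub; exact: p_smooth.
have CJ k i a : Ck_on k (ball x0 r) (fun x => pjac x0 (p x0) E x i a).
  by apply: Ck_on_pjac.
have x0b : ball x0 r x0 by exact: ballxx.
have w1 : forall x, ball x0 r x -> forall j, u x * p x 0 j - p x0 0 j = 0.
  apply: (@linear_system_zero R n 'I_n x0 r (fun j x => u x * p x 0 j - p x0 0 j)
     (fun k j c x => p x 0 j * (c == k)%:R)).
  - move=> j; apply: Ck_onD => //; first exact: Ck_onM.
  - move=> k j c; apply: (@Ck_on_cont _ _ 0); exact: Ck_onM.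
  - move=> k j x bx.
    have hp := Ck_on_is_derive k (p_smooth j 1%N) (hU _ bx).
    have hd := is_deriveB1 (is_deriveM1 (is_derive_pden x0 (p x0) x k) hp) (is_derive_cst (p x0 0 j) x _).
    rewrite (is_derive_pd hd) (pd_p (hU _ bx)) (bigD1 k) //= eqxx big1 ?addr0; last first.
      by move=> c ck; rewrite (negbTE ck) mulr0 mul0r.
    by rewrite /u mulr1; ring.
  - by move=> j; rewrite /u pden_x0 mul1r subrr.
have pE x : ball x0 r x -> forall j, p x 0 j = p x0 0 j / u x.
  move=> bx j; have /eqP := w1 x bx j; rewrite subr_eq0 => /eqP <-.
  by rewrite mulrC mulKf // hu0.
have w2 : forall x, ball x0 r x -> forall i, b x 0 i - pjac x0 (p x0) E x i i0 = 0.
  apply: (@linear_system_zero R n 'I_n x0 r (fun i x => b x 0 i - pjac x0 (p x0) E x i i0)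
     (fun l i c x => p x 0 i * (c == l)%:R + p x 0 l * (c == i)%:R)).
  - move=> i; have hN : Ck_on 1 (ball x0 r) (fun x => b x 0 i + -1 * pjac x0 (p x0) E x i i0).
      by apply: Ck_onD => //; [apply: sub; exact: b_smooth|apply: Ck_onM].
    by apply: Ck_on_ext hN => // x _; rewrite mulN1r.
  - by move=> l i c; apply: (@Ck_on_cont _ _ 0); apply: Ck_onD => //; apply: Ck_onM.
  - move=> l i x bx.
    have hb := Ck_on_is_derive l (b_smooth i 1%N) (hU _ bx).
    have hd := is_deriveB1 hb (is_derive_pjac E l i i0 (hu0 _ bx)).
    rewrite (is_derive_pd hd) (pd_b (hU _ bx)).
    under eq_bigr do rewrite mulrDl -!mulrA.
    rewrite big_split -!mulr_sumr /=.
    by rewrite !sum_indicator !(pE _ bx) -/u; ring.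
  - by move=> i; rewrite pjac_x0 E_i0 subrr.
pose JJ x i j := \sum_a pjac x0 (p x0) E x i a * pjac x0 (p x0) E x j a.
have w3 : forall x, ball x0 r x -> forall ij : 'I_n * 'I_n, g x ij.1 ij.2 - JJ x ij.1 ij.2 = 0.
  apply: (@linear_system_zero R n _ x0 r (fun (ij : 'I_n * 'I_n) x => g x ij.1 ij.2 - JJ x ij.1 ij.2)
     (fun l ij c x => p x 0 ij.1 * (c == (ij.2, l))%:R + p x 0 ij.2 * (c == (ij.1, l))%:R
         + 2 * p x 0 l * (c == ij)%:R)).
  - move=> [i j] /=; have hN : Ck_on 1 (ball x0 r) (fun x => g x i j + -1 * JJ x i j).
      apply: Ck_onD => //; first by apply: sub; exact: g_smooth.
      by apply: Ck_onM => //; apply: Ck_on_sum => // a _; apply: Ck_onM.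
    by apply: Ck_on_ext hN => // x _; rewrite mulN1r.
  - move=> l [i j] c /=; apply: (@Ck_on_cont _ _ 0); apply: Ck_onD => //.
      by apply: Ck_onD => //; apply: Ck_onM.
    by apply: Ck_onM => //; apply: Ck_onM.
  - move=> l [i j] x bx /=.
    have hg := Ck_on_is_derive l (g_smooth i j 1%N) (hU _ bx).
    have hJ : is_derive x (delta_mx 0 l) (fun z => JJ z i j)
       (p x 0 i * JJ x j l + p x 0 j * JJ x i l + 2 * p x 0 l * JJ x i j).
      have hJa a := is_deriveM1 (is_derive_pjac E l i a (hu0 _ bx)) (is_derive_pjac E l j a (hu0 _ bx)).
      apply: is_derive_eq (is_derive_sum1 (index_enum 'I_n) (P := xpredT) (fun a _ => hJa a)) _.
      rewrite /JJ !mulr_sumr -!big_split /=; apply: eq_bigr => a _.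
      by rewrite !(pE _ bx) -/u; ring.
    rewrite (is_derive_pd (is_deriveB1 hg hJ)) (pd_g (hU _ bx)).
    under eq_bigr do rewrite !mulrDl -!mulrA.
    rewrite !big_split -!mulr_sumr /=.
    by rewrite !sum_indicator /=; ring.
  - move=> [i j] /=; rewrite -EE /JJ mxE; apply/eqP; rewrite subr_eq0; apply/eqP.
    by apply: eq_bigr => a _; rewrite !pjac_x0 mxE.
exists r => // x bx; split; [exact: hU|exact: hu| |].
- apply/matrixP => i j; have /eqP := w3 x bx (i, j); rewrite subr_eq0 => /eqP /= ->.
  by rewrite /JJ [RHS]mxE; apply: eq_bigr => a _; rewrite [X in _ = _ * X]mxE.
- by move=> i; have /eqP := w2 x bx i; rewrite subr_eq0 => /eqP.
Qed.

End Straightening.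

(** * Charts and their Jacobians *)

Section Jacobian.
Variables (R : realType) (n : nat).

Lemma jacobianE (U : set 'rV[R]_n) (phi : 'rV[R]_n -> 'rV[R]_n) x : open U -> U x ->
  (forall j, Ck_on 1 U (fun z => phi z 0 j)) ->
  forall i j, 'J phi x i j = pd i (fun z => phi z 0 j) x.
Proof.
move=> oU Ux h i j.
have hd : differentiable phi x.
  apply: differentiable_row => k; have [hk _] := C1_differentiable oU (h k) Ux; exact: hk.
rewrite /jacobian mxE -deriveE // derive_mx ?mxE; first by [].
exact: diff_derivable.
Qed.

End Jacobian.

Section Charts.
Variables (R : realType) (n : nat) (M : topologicalType).
Implicit Types (c d : chart R n M).

Lemma cinvK c x : cran c x -> cdom c (cinv c x) /\ cmap c (cinv c x) = x.
Proof. by move=> [q cq <-]; rewrite cmapK ?inE. Qed.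

Lemma chart_image c (O : set M) :
  cmap c @` (cdom c `&` O) = cran c `&` cinv c @^-1` O.
Proof.
apply/seteqP; split => [_ [q [cq Oq] <-]|x [cx Ox]].
  by split; [exists q|rewrite /= cmapK ?inE].
by have [h1 h2] := cinvK cx; exists (cinv c x).
Qed.

Lemma chart_image_open c (O : set M) : open O -> open (cmap c @` (cdom c `&` O)).
Proof.
move=> oO; rewrite chart_image; apply: open_setI_preimage => //; first exact: cran_open.
exact: cinv_continuous.
Qed.

Lemma transitionE c d (q : M) : cdom c q -> transition c d (cmap c q) = cmap d q.
Proof. by move=> cq; rewrite /transition cmapK ?inE. Qed.

(** psi' only has to invert psi on W: the maps of a chart are irrelevant outside
    its domain and range. *)
Lemma chart_precompose c (W : set 'rV[R]_n) (psi psi' : 'rV[R]_n -> 'rV[R]_n) :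
  open W -> W `<=` cran c -> open (psi @` W) -> (forall x, W x -> psi' (psi x) = x) ->
  {in W, continuous psi} -> {in psi @` W, continuous psi'} ->
  exists d : chart R n M, [/\ cdom d = cdom c `&` cmap c @^-1` W,
    cmap d = psi \o cmap c & cinv d = cinv c \o psi'].
Proof.
move=> oW Wc oZ psiK cpsi cpsi'.
have o1 : open (cdom c `&` cmap c @^-1` W).
  by apply: open_setI_preimage => //; [exact: cdom_open|exact: cmap_continuous].
have ran : (psi \o cmap c) @` (cdom c `&` cmap c @^-1` W) = psi @` W.
  apply/seteqP; split => [_ [q [cq Wq] <-]|_ [x Wx <-]]; first by exists (cmap c q).
  have [q cq qx] := Wc _ Wx.
  by exists q; rewrite /= ?qx //; split => //=; rewrite qx.
have o2 : open ((psi \o cmap c) @` (cdom c `&` cmap c @^-1` W)) by rewrite ran.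
have k1 : {in cdom c `&` cmap c @^-1` W, cancel (psi \o cmap c) (cinv c \o psi')}.
  by move=> q; rewrite inE => -[cq Wq] /=; rewrite psiK // cmapK ?inE.
have c1 : {in cdom c `&` cmap c @^-1` W, continuous (psi \o cmap c)}.
  move=> q; rewrite inE => -[cq Wq]; apply: continuous_comp.
    by apply: cmap_continuous; rewrite inE.
  by apply: cpsi; rewrite inE.
have c2 : {in (psi \o cmap c) @` (cdom c `&` cmap c @^-1` W), continuous (cinv c \o psi')}.
  rewrite ran => z; rewrite inE => Zz; apply: continuous_comp.
    by apply: cpsi'; rewrite inE.
  apply: cinv_continuous; rewrite inE; case: Zz => x Wx <-; rewrite psiK //.
  exact: Wc.
by exists (Chart o1 o2 k1 c1 c2).
Qed.

End Charts.

Section AtlasExtension.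
Variables (R : realType) (n : nat) (M : manifold R n).
Implicit Types (c d e : chart R n M).

(** The new chart is compatible with every chart of the atlas, because psi and its
    inverse are smooth; it belongs to the atlas by maximality. *)
Lemma atlas_precompose c (W : set 'rV[R]_n) (psi psi' : 'rV[R]_n -> 'rV[R]_n) :
  matlas c -> open W -> W `<=` cran c -> open (psi @` W) ->
  (forall x, W x -> psi' (psi x) = x) ->
  (forall j, smooth_on W (fun x => psi x 0 j)) ->
  (forall j, smooth_on (psi @` W) (fun x => psi' x 0 j)) ->
  exists d : chart R n M, [/\ matlas d, cdom d = cdom c `&` cmap c @^-1` W,
    cmap d = psi \o cmap c & cinv d = cinv c \o psi'].
Proof.
move=> cA oW Wc oZ psiK spsi spsi'.
have [||d [dd md vd]] := chart_precompose oW Wc oZ psiK.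
- by move=> x Wx; apply: continuous_row => j; exact: (Ck_on_cont (spsi j 0%N)).
- by move=> x Wx; apply: continuous_row => j; exact: (Ck_on_cont (spsi' j 0%N)).
exists d; split => //; apply: matlas_maximal => e eA; split => j k.
- have [smooth_ce _] := matlas_compatible cA eA.
  apply: (@Ck_on_ext _ _ k _ (fun z => transition c e (psi' z) 0 j)).
  + by apply: chart_image_open; exact: cdom_open.
  + by move=> z _; rewrite /transition vd.
  + apply: (@Ck_on_comp _ _ _ k _ (cmap c @` (cdom c `&` cdom e)) (fun x => transition c e x 0 j)).
    * by apply: chart_image_open; exact: cdom_open.
    * by apply: chart_image_open; exact: cdom_open.
    * move=> _ [q [dq eq] <-]; rewrite md /=; move: dq; rewrite dd => -[cq Wq].
      by rewrite psiK //; exists q.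
    * move=> i; apply: Ck_on_sub (spsi' i k) => _ [q [dq eq] <-].
      by rewrite md /=; move: dq; rewrite dd => -[cq Wq]; exists (cmap c q).
    * exact: smooth_ce.
- have [_ smooth_ec] := matlas_compatible cA eA.
  apply: (@Ck_on_ext _ _ k _ (fun z => psi (transition e c z) 0 j)).
  + by apply: chart_image_open; exact: cdom_open.
  + by move=> z _; rewrite /transition md.
  + apply: (@Ck_on_comp _ _ _ k _ W (fun x => psi x 0 j)) => //.
    * by apply: chart_image_open; exact: cdom_open.
    * by move=> _ [q [eq dq] <-]; rewrite transitionE //; move: dq; rewrite dd => -[].
    * move=> i; apply: Ck_on_sub (smooth_ec i k) => _ [q [eq dq] <-].
      by move: dq; rewrite dd => -[cq _]; exists q.
    * exact: spsi.
Qed.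

Lemma transition_jacobian c d q i j : matlas c -> matlas d -> cdom c q -> cdom d q ->
  'J (transition c d) (cmap c q) i j = pd i (fun z => transition c d z 0 j) (cmap c q).
Proof.
move=> cA dA cq dq; have [h _] := matlas_compatible cA dA.
apply: (@jacobianE R n (cmap c @` (cdom c `&` cdom d))).
- by apply: chart_image_open; exact: cdom_open.
- by exists q.
- by move=> k; exact: h.
Qed.

End AtlasExtension.

(** * Metrics and 1-forms pulled back from Euclidean space *)

Section PulledBackFlatMetric.
Variables (R : realType) (n : nat) (V : set 'rV[R]_n) (phi : 'rV[R]_n -> 'rV[R]_n).
Variables (g : 'rV[R]_n -> 'M[R]_n).
Hypothesis oV : open V.
Hypothesis phi_smooth : forall a, smooth_on V (fun x => phi x 0 a).
Variables (J : 'rV[R]_n -> 'M[R]_n) (H : 'rV[R]_n -> 'I_n -> 'I_n -> 'rV[R]_n).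
Hypothesis JE : forall x i a, J x i a = pd i (fun z => phi z 0 a) x.
Hypothesis HE : forall x i j c, H x i j 0 c = pd i (pd j (fun z => phi z 0 c)) x.
Hypothesis J_unit : forall x, V x -> J x \in unitmx.
Hypothesis gE : forall x, V x -> g x = J x *m (J x)^T.

Lemma pullback_smooth i j : smooth_on V (fun x => g x i j).
Proof.
move=> k; apply: (@Ck_on_ext _ _ k V (fun x => \sum_a pd i (fun z => phi z 0 a) x * pd j (fun z => phi z 0 a) x)) => //.
  by move=> z Vz; rewrite gE // mxE; apply: eq_bigr => a _; rewrite [X in _ = _ * X]mxE !JE.
by apply: Ck_on_sum => // a _; apply: Ck_onM => //; exact: (Ck_on_pd _ (phi_smooth a k.+1)).
Qed.

Lemma pullback_unit x : V x -> g x \in unitmx.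
Proof. by move=> Vx; rewrite gE // unitmx_mul unitmx_tr J_unit. Qed.

Lemma HC x i j : V x -> H x i j = H x j i.
Proof.
move=> Vx; apply/rowP => c.
rewrite !HE.
exact (pdC i j oV (phi_smooth c 2%N) Vx).
Qed.

Lemma is_derive_J x l i a : V x -> is_derive x (delta_mx 0 l) (fun z => J z i a) (H x l i 0 a).
Proof.
move=> Vx; rewrite HE.
have -> : (fun z => J z i a) = pd i (fun z => phi z 0 a) by apply/funext => z; rewrite JE.
exact: (Ck_on_is_derive l (Ck_on_pd i (phi_smooth a 2%N))).
Qed.

Lemma pd_pullback x l i j : V x ->
  pd l (fun z => g z i j) x = \sum_a (H x l i 0 a * J x j a + J x i a * H x l j 0 a).
Proof.
move=> Vx; transitivity (pd l (fun z => \sum_a J z i a * J z j a) x).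
  apply: (pd_ext _ oV) => // z Vz; rewrite gE // [LHS]mxE; apply: eq_bigr => a _.
  by rewrite [X in _ * X]mxE.
apply: is_derive_pd; apply: is_derive_sum1 => a _.
by apply: is_deriveM1; exact: is_derive_J.
Qed.

Lemma christoffel_first_kind x i j l : V x ->
  pd i (fun z => g z j l) x + pd j (fun z => g z i l) x - pd l (fun z => g z i j) x
  = 2 * \sum_a H x i j 0 a * J x l a.
Proof.
move=> Vx; rewrite !pd_pullback // -big_split -sumrB mulr_sumr /=; apply: eq_bigr => a _.
by rewrite (HC j i Vx) (HC l i Vx) (HC l j Vx); ring.
Qed.

Lemma christoffel_row x i j : V x ->
  (\row_k christoffel g k i j x) *m J x = H x i j.
Proof.
move=> Vx.
have gT : (invmx (g x))^T = invmx (g x) by rewrite trmx_inv gE // trmx_mul trmxK.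
have -> : \row_k christoffel g k i j x = H x i j *m (J x)^T *m invmx (g x).
  apply/rowP => k; rewrite [LHS]mxE /christoffel [RHS]mxE mulr_sumr; apply: eq_bigr => l _.
  have gs : invmx (g x) k l = invmx (g x) l k by rewrite -{1}gT mxE.
  rewrite christoffel_first_kind // gs [X in _ = X * _]mxE.
  rewrite (_ : \sum_a _ = \sum_j0 H x i j 0 j0 * (J x)^T j0 l); first by field.
  by apply: eq_bigr => a _; rewrite [X in _ = _ * X]mxE.
have X1 : (J x)^T *m invmx (g x) *m J x = 1%:M.
  apply: (can_inj (mulKmx (J_unit Vx))); rewrite mulmx1 !mulmxA -gE //.
  by rewrite mulmxV ?mul1mx // pullback_unit.
by rewrite -!mulmxA in X1 *; rewrite X1 mulmx1.
Qed.

(** For a metric g = J J^T with J the Jacobian of phi, the Christoffel symbols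
    expand the second derivatives of phi on the first ones. *)
Lemma christoffel_sum x i j c : V x ->
  \sum_k christoffel g k i j x * J x k c = H x i j 0 c.
Proof.
move=> Vx; rewrite -christoffel_row // [RHS]mxE; apply: eq_bigr => k _.
by rewrite [X in _ = X * _]mxE.
Qed.

Lemma christoffel_smooth k i j : smooth_on V (christoffel g k i j).
Proof.
move=> N; apply: Ck_onM => //; first exact: Ck_on_cst.
have hpd i' j' l' : Ck_on N V (fun x => pd i' (fun z => g z j' l') x).
  exact: (Ck_on_pd _ (pullback_smooth j' l' N.+1)).
apply: Ck_on_sum => // l _; apply: Ck_onM => //.
  by apply: Ck_on_invmx => // [i' j'|]; [exact: pullback_smooth|exact: pullback_unit].
apply: (@Ck_on_ext _ _ N V (fun x => (pd i (fun z => g z j l) x + pd j (fun z => g z i l) x)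
  + (-1) * pd l (fun z => g z i j) x)) => //; first by move=> x _; rewrite mulN1r.
apply: Ck_onD => //; first exact: Ck_onD.
by apply: Ck_onM => //; exact: Ck_on_cst.
Qed.

Lemma pd_christoffel_sum x m i j c : V x ->
  \sum_k (pd m (christoffel g k i j) x
     + \sum_s christoffel g k m s x * christoffel g s i j x) * J x k c
  = pd m (pd i (pd j (fun z => phi z 0 c))) x.
Proof.
move=> Vx.
have h : is_derive x (delta_mx 0 m) (fun z => \sum_k christoffel g k i j z * J z k c)
   (\sum_k (pd m (christoffel g k i j) x * J x k c + christoffel g k i j x * H x m k 0 c)).
  apply: is_derive_sum1 => k _; apply: is_deriveM1; last exact: is_derive_J.
  exact: (Ck_on_is_derive m (christoffel_smooth k i j 1%N)).
transitivity (pd m (fun z => \sum_k christoffel g k i j z * J z k c) x); last first.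
  by apply: (pd_ext _ oV) => // z Vz; rewrite christoffel_sum // HE.
rewrite (is_derive_pd h).
under [RHS]eq_bigr do rewrite -christoffel_sum //.
rewrite [RHS]big_split /=.
under eq_bigr do rewrite mulrDl mulr_suml.
rewrite big_split /=; congr (_ + _); rewrite exchange_big /=.
apply: eq_bigr => s _; rewrite mulr_sumr; apply: eq_bigr => k _.
by rewrite mulrA (mulrC (christoffel g s i j x)).
Qed.

(** Differentiating [christoffel_sum] once more expresses the curvature, multiplied
    by the invertible J, as the difference of two third derivatives of phi that
    differ only in the order of differentiation. *)
Lemma pullback_curvature x l k i j : V x -> riemann_curvature g l k i j x = 0.
Proof.
move=> Vx.
suff E : (\row_l riemann_curvature g l k i j x) = 0.
  by have := congr1 (fun r : 'rV[R]_n => r 0 l) E; rewrite !mxE.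
apply: (can_inj (mulmxK (J_unit Vx))); rewrite mul0mx; apply/rowP => c.
rewrite [LHS]mxE [RHS]mxE.
have := pd_christoffel_sum i j k c Vx; have := pd_christoffel_sum j i k c Vx.
have -> : pd i (pd j (pd k (fun z => phi z 0 c))) x = pd j (pd i (pd k (fun z => phi z 0 c))) x.
  exact (pdC i j oV (Ck_on_pd k (phi_smooth c 3%N)) Vx).
move=> e1 e2; have /eqP := etrans e2 (esym e1); rewrite -subr_eq0 => /eqP e.
rewrite -[RHS]e -sumrB; apply: eq_bigr => s _.
rewrite [X in X * _]mxE /riemann_curvature -mulrBl sumrB; congr (_ * _).
by rewrite opprD addrACA.
Qed.

(** b is the differential of the coordinate phi^a, whose Hessian is
    Gamma^k_ij d_k phi^a by [christoffel_sum]. *)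
Lemma pullback_parallel (b : 'rV[R]_n -> 'rV[R]_n) a x i j :
  (forall z, V z -> forall i, b z 0 i = J z i a) -> V x ->
  pd j (fun z => b z 0 i) x - \sum_k christoffel g k i j x * b x 0 k = 0.
Proof.
move=> hb Vx.
have -> : pd j (fun z => b z 0 i) x = H x j i 0 a.
  transitivity (pd j (fun z => J z i a) x); last exact: (is_derive_pd (is_derive_J j i a Vx)).
  by apply: (pd_ext _ oV) => // z Vz; exact: hb.
under eq_bigr do rewrite hb //.
by rewrite christoffel_sum // (HC j i Vx) subrr.
Qed.

End PulledBackFlatMetric.

(** * The normalised tensors on the manifold *)

Section NormalizedFields.
Variables (R : realType) (n : nat) (m : R) (M : manifold R n).
Variables (alpha : riemannian M) (beta : oneform M).
Hypothesis beta_neq0 : nowhere_zero beta.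
Implicit Types (c d : chart R n M) (q : M).

Lemma cran_cmap c q : cdom c q -> cran c (cmap c q).
Proof. by move=> cq; exists q. Qed.

Lemma cran_cmapE c x : cran c x -> exists2 q, cdom c q & x = cmap c q.
Proof. by move=> [q cq <-]; exists q. Qed.

Lemma open_cran c : open (cran c). Proof. exact: cran_open. Qed.

Lemma alpha_sym c x : matlas c -> cran c x -> forall i j, alpha c x i j = alpha c x j i.
Proof. by move=> cA cx i j; have := Defs.metric_sym alpha cA cx => {1}<-; rewrite mxE. Qed.

Let Bc c x := sqnorm (alpha c x) (beta c x).

Lemma Bc_gt0 c x : matlas c -> cran c x -> 0 < Bc c x.
Proof.
move=> cA cx; apply: sqnorm_gt0; first exact: alpha_sym.
  by move=> y y0; exact: metric_pos.
exact: beta_neq0.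
Qed.

Lemma alpha_unit c x : matlas c -> cran c x -> alpha c x \in unitmx.
Proof. by move=> cA cx; apply: posdef_unitmx => y y0; exact: metric_pos. Qed.

Lemma transition_jacobian_unit c d q : chart_at q c -> chart_at q d ->
  'J (transition c d) (cmap c q) \in unitmx.
Proof.
move=> hc hd; have := alpha_unit (proj1 hc) (cran_cmap (proj2 hc)).
by rewrite (metric_transform alpha hc hd) !unitmx_mul => /andP[/andP[]].
Qed.

(** The norm of b in the metric a does not depend on the coordinates, so rescaling
    by its powers preserves the transformation laws. *)
Lemma Bc_invariant c d q : chart_at q c -> chart_at q d ->
  Bc c (cmap c q) = Bc d (cmap d q).
Proof.
move=> hc hd; have uJ := transition_jacobian_unit hc hd.
rewrite /Bc /sqnorm (metric_transform alpha hc hd) (form_transform beta hc hd).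
have ua := alpha_unit (proj1 hd) (cran_cmap (proj2 hd)).
move: uJ ua; set J := 'J _ _; set a := alpha d _; set b := beta d _ => uJ ua.
have uJT : J^T \in unitmx by rewrite unitmx_tr.
have X : J^T *m invmx (J *m a *m J^T) *m J = invmx a.
  have uA : J *m a *m J^T \in unitmx by rewrite !unitmx_mul uJ ua uJT.
  apply: (can_inj (mulKmx ua)); apply: (can_inj (mulKmx uJ)).
  by rewrite mulmxV // mulmx1 !mulmxA mulmxV // mul1mx.
rewrite trmx_mul trmxK; congr (fun_of_matrix _ 0 0).
by rewrite -X !mulmxA.
Qed.

Fact normal_metric_sm c i j : matlas c ->
  smooth_on (cran c) (fun x => normal_metric m (alpha c) (beta c) x i j).
Proof.
move=> cA; apply: normal_metric_smooth; first exact: open_cran.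
- by move=> i' j'; exact: metric_smooth.
- by move=> i'; exact: form_smooth.
- by move=> x cx; exact: alpha_sym.
- by move=> x cx y y0; exact: metric_pos.
- by move=> x cx; exact: beta_neq0.
Qed.

Fact normal_metric_symm c x : matlas c -> cran c x ->
  (normal_metric m (alpha c) (beta c) x)^T = normal_metric m (alpha c) (beta c) x.
Proof.
by move=> cA cx; apply/matrixP => i j; rewrite !mxE (alpha_sym cA cx i j).
Qed.

Fact normal_metric_posd c x y : matlas c -> cran c x -> y != 0 ->
  0 < quad (normal_metric m (alpha c) (beta c) x) y.
Proof.
move=> cA cx y0; apply: (@normal_metric_pos R n m (cran c)) => //.
- by move=> z cz; exact: alpha_sym.
- by move=> z cz v v0; exact: metric_pos.
- by move=> z cz; exact: beta_neq0.
Qed.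

Fact normal_metric_transf c d q : chart_at q c -> chart_at q d ->
  normal_metric m (alpha c) (beta c) (cmap c q) =
  'J (transition c d) (cmap c q) *m normal_metric m (alpha d) (beta d) (cmap d q)
    *m ('J (transition c d) (cmap c q))^T.
Proof.
move=> hc hd; rewrite /normal_metric -!/(Bc _ _) (Bc_invariant hc hd).
by rewrite (metric_transform alpha hc hd) -scalemxAr -scalemxAl.
Qed.

Definition normal_riemannian : riemannian M :=
  Riemannian normal_metric_sm normal_metric_symm normal_metric_posd normal_metric_transf.

Fact normal_form_sm c i : matlas c ->
  smooth_on (cran c) (fun x => normal_form m (alpha c) (beta c) x 0 i).
Proof.
move=> cA; apply: normal_form_smooth; first exact: open_cran.
- by move=> i' j'; exact: metric_smooth.
- by move=> i'; exact: form_smooth.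
- by move=> x cx; exact: alpha_sym.
- by move=> x cx y y0; exact: metric_pos.
- by move=> x cx; exact: beta_neq0.
Qed.

Fact normal_form_transf c d q : chart_at q c -> chart_at q d ->
  normal_form m (alpha c) (beta c) (cmap c q) =
  normal_form m (alpha d) (beta d) (cmap d q) *m ('J (transition c d) (cmap c q))^T.
Proof.
move=> hc hd; rewrite /normal_form -!/(Bc _ _) (Bc_invariant hc hd).
by rewrite (form_transform beta hc hd) -scalemxAl.
Qed.

Definition normal_oneform : oneform M := Oneform normal_form_sm normal_form_transf.

(** Computed in an arbitrarily chosen chart around q; by [norm_atE] every chart
    gives the same value. *)
Definition norm_at q : R :=
  let c := s2val (cid2 (matlas_cover q)) in Bc c (cmap c q).

Lemma norm_atE q c : chart_at q c -> norm_at q = Bc c (cmap c q).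
Proof.
move=> hc; rewrite /norm_at; case: cid2 => d dA dq /=.
exact: (@Bc_invariant d c).
Qed.

Definition normal_factor_eta q : R := norm_at q `^ ((1 - m) / 2).

Lemma norm_at_gt0 q : 0 < norm_at q.
Proof.
have [c cA cq] := matlas_cover q.
by rewrite (@norm_atE q c) //; apply: Bc_gt0 => //; exact: cran_cmap.
Qed.

Lemma eta_gt0 q : 0 < normal_factor_eta q.
Proof. by rewrite powR_gt0 // norm_at_gt0. Qed.

Lemma eta_smooth : smooth_fun normal_factor_eta.
Proof.
move=> c cA k; apply: (@Ck_on_ext _ _ k (cran c) (fun x => Bc c x `^ ((1 - m) / 2))).
- exact: open_cran.
- move=> x cx; have [h1 h2] := cinvK cx.
  have hc : chart_at (cinv c x) c by split.
  by rewrite /normal_factor_eta (norm_atE hc) h2.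
apply: Ck_on_powR; [exact: open_cran|by move=> x cx; exact: Bc_gt0|].
apply: B_smooth; first exact: open_cran.
- by move=> i' j'; exact: metric_smooth.
- by move=> i'; exact: form_smooth.
- by move=> x cx y y0; exact: metric_pos.
Qed.

Lemma alpha_val_normal c x y :
  alpha_val normal_riemannian c x y = Bc c x `^ (m / 2) * alpha_val alpha c x y.
Proof.
rewrite /alpha_val /= quad_scale sqrtrM ?powR_ge0 // -powR12_sqrt ?powR_ge0 //.
by rewrite -powRrM.
Qed.

Lemma beta_val_normal c x y :
  beta_val normal_oneform c x y = Bc c x `^ ((m - 1) / 2) * beta_val beta c x y.
Proof.
rewrite /beta_val /= /normal_form /lin mulr_sumr; apply: eq_bigr => i _.
by rewrite mxE mulrA.
Qed.

Lemma normal_same_metric : same_metric (kropina m alpha beta) (kropina m normal_riemannian normal_oneform).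
Proof.
move=> c x y cA cx; have B0 := Bc_gt0 cA cx.
have Bn (k : R) : 0 < Bc c x `^ k by rewrite powR_gt0.
split; rewrite /= beta_val_normal; first by split; rewrite ?(pmulr_rgt0 _ (Bn _)).
move=> b0; rewrite alpha_val_normal !powRM ?powR_ge0 ?sqrtr_ge0 ?ltW //.
rewrite -!powRrM mulrACA -powRD; last by rewrite (gt_eqF B0) implybT.
rewrite (_ : (m - 1) / 2 * m + m / 2 * (1 - m) = 0) ?powRr0 ?mul1r //.
by field.
Qed.

Lemma normal_related : m != 1 ->
  kropina_related m normal_factor_eta alpha beta normal_riemannian normal_oneform.
Proof.
move=> m1 q c y hc; rewrite alpha_val_normal beta_val_normal /normal_factor_eta (norm_atE hc).
have B0 := Bc_gt0 (proj1 hc) (cran_cmap (proj2 hc)).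
have m10 : m - 1 != 0 by rewrite subr_eq0.
have BD (k l : R) z : k + l = 0 -> z = Bc c (cmap c q) `^ k * (Bc c (cmap c q) `^ l * z).
  move=> kl; rewrite mulrA -powRD; last by rewrite (gt_eqF B0) implybT.
  by rewrite kl powRr0 mul1r.
rewrite -powRrM; split; apply: BD; last by field.
by field; rewrite m10.
Qed.

End NormalizedFields.

Section NormalForm.
Variables (R : realType) (n : nat) (m : R) (M : manifold R n.+1).
Variables (alpha : riemannian M) (beta : oneform M).
Hypotheses (m_neq0 : m != 0) (m_neq1 : m != 1).
Hypothesis beta_neq0 : nowhere_zero beta.
Hypothesis proj_flat : locally_projectively_flat_K0 (kropina m alpha beta).
Implicit Types (c d : chart R n.+1 M) (q : M).

Let alpha' := normal_riemannian m alpha beta_neq0.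
Let beta' := normal_oneform m alpha beta_neq0.

(** The chart is the given projectively flat one followed by the projective map of
    [straightening].  Its Jacobian J satisfies g = J J^T and w = e0 J^T, and these
    are the transformation laws of the Euclidean metric and of y^1; cancelling J
    gives the components in the new chart. *)
Lemma euclidean_chart q : exists d, [/\ chart_at q d,
  forall z, cran d z -> alpha' d z = 1%:M & forall z, cran d z -> beta' d z = delta_mx 0 0].
Proof.
have [c [P [[cA cq] hproj hflag]]] := proj_flat q.
have oc : open (cran c) by exact: open_cran.
have sa i j : smooth_on (cran c) (fun x => alpha c x i j) by exact: metric_smooth.
have sb i : smooth_on (cran c) (fun x => beta c x 0 i) by exact: form_smooth.
have sy x : cran c x -> forall i j, alpha c x i j = alpha c x j i by move=> cx; exact: alpha_sym.
have po x : cran c x -> forall y, y != 0 -> 0 < quad (alpha c x) y.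
  by move=> cx y y0; exact: metric_pos.
have b0 x : cran c x -> beta c x != 0 by move=> cx; exact: beta_neq0.
have h1 x y : cran c x -> 0 < lin (beta c x) y ->
  fundamental (kropinaF m (alpha c) (beta c)) x y \in unitmx ->
  forall i, spray (kropinaF m (alpha c) (beta c)) i x y = P x y * y 0 i.
  by move=> cx by0 fu; apply: hproj; split.
have h2 x y : cran c x -> 0 < lin (beta c x) y ->
  fundamental (kropinaF m (alpha c) (beta c)) x y \in unitmx ->
  flag_curvature (kropinaF m (alpha c) (beta c)) P x y = 0.
  by move=> cx by0 fu; apply: hflag; split.
pose g := normal_metric m (alpha c) (beta c); pose b := normal_form m (alpha c) (beta c).
pose p := normal_factor m (alpha c) (beta c).
have NS := normal_structure m_neq0 m_neq1 oc sa sb sy po b0 h1 h2.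
have ND := normal_factor_derivative m_neq0 m_neq1 oc sa sb sy po b0 h1 h2.
pose x0 := cmap c q; have cx0 : cran c x0 by exact: cran_cmap.
have gsym i j : g x0 i j = g x0 j i by rewrite !mxE sy.
have gpos y : y != 0 -> 0 < quad (g x0) y by move=> y0; exact: (normal_metric_pos m sy po b0 cx0 y0).
have [E [EE E0]] := adapted_coframe gsym gpos (normal_form_unit m sy po b0 cx0).
have pdg x : cran c x -> forall l i j, pd l (fun z => g z i j) x =
    p x 0 i * g x j l + p x 0 j * g x i l + 2 * p x 0 l * g x i j.
  by move=> cx; have [] := NS x cx.
have pdb x : cran c x -> forall l i, pd l (fun z => b z 0 i) x =
    p x 0 i * b x 0 l + p x 0 l * b x 0 i.
  by move=> cx; have [] := NS x cx.
have pdp x : cran c x -> forall k j, pd k (fun z => p z 0 j) x = p x 0 k * p x 0 j.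
  by move=> cx k j; exact: ND.
have [r r0 hr] := straightening oc (normal_metric_smooth m oc sa sb sy po b0)
  (normal_form_smooth m oc sa sb sy po b0) (normal_factor_smooth m oc sa sb sy po b0)
  pdg pdb pdp cx0 EE E0.
have uE : E \in unitmx.
  have : g x0 \in unitmx by exact: posdef_unitmx.
  by rewrite -EE unitmx_mul => /andP[].
pose W : set 'rV[R]_n.+1 := ball x0 r.
pose psi := proj_map x0 (p x0) E; pose psi' := proj_inv x0 (p x0) E.
have oW : open W by exact: ball_open.
have u0 x : W x -> pden x0 (p x0) x != 0 by move=> /hr [_ /lt0r_neq0].
have Wc : W `<=` cran c by move=> x /hr [].
have psiK x : W x -> psi' (psi x) = x by move=> Wx; apply: proj_invK => //; exact: u0.
have oV : open [set z | qden (p x0) E z != 0].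
  have cq' : {in setT, continuous (qden (p x0) E)}.
    by apply: (@Ck_on_cont _ _ 0); apply: Ck_on_qden; exact: openT.
  have := open_setI_preimage openT cq' (@open_neq R 0).
  by rewrite setTI.
have cpsi' : {in [set z | qden (p x0) E z != 0], continuous psi'}.
  move=> z Vz; apply: continuous_row => j.
  by apply: (Ck_on_cont (k := 0) (U := [set z | qden (p x0) E z != 0])) => //; exact: Ck_on_proj_inv.
have ZE : psi @` W = [set z | qden (p x0) E z != 0] `&` psi' @^-1` W.
  apply/seteqP; split=> [_ [x Wx <-]|z [Vz Wz]].
    split; rewrite /= ?psiK // qden_proj_map ?invr_eq0 //; exact: u0.
  by exists (psi' z) => //; exact: proj_mapK.
have oZ : open (psi @` W) by rewrite ZE; exact: open_setI_preimage.
have spsi j : smooth_on W (fun x => psi x 0 j).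
  by move=> k; apply: Ck_on_proj_map => // x Wx; exact: u0.
have spsi' j : smooth_on (psi @` W) (fun x => psi' x 0 j).
  by move=> k; apply: Ck_on_proj_inv => // z; rewrite ZE => -[].
have [d [dA dd md vd]] := atlas_precompose cA oW Wc oZ psiK spsi spsi'.
have dq' q' : cdom d q' -> cdom c q' /\ W (cmap c q') by rewrite dd => -[].
have JE q' : cdom d q' -> 'J (transition c d) (cmap c q') = pjac x0 (p x0) E (cmap c q').
  move=> dq; have [cq' Wq] := dq' _ dq; apply/matrixP => i j.
  rewrite transition_jacobian //.
  rewrite (@pd_ext R n.+1 W (fun z => transition c d z 0 j) (fun z => psi z 0 j)) //.
    by apply: is_derive_pd; apply: is_derive_proj_map; exact: u0.
  move=> z Wz; rewrite /transition md /=; have [_ ->] // := cinvK (Wc _ Wz).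
have uJ q' : cdom d q' -> pjac x0 (p x0) E (cmap c q') \in unitmx.
  move=> dq; have [cq' Wq] := dq' _ dq; rewrite -JE //.
  exact: (transition_jacobian_unit alpha (conj cA cq') (conj dA dq)).
exists d; split.
- split=> //; rewrite dd; split=> //; exact: ballxx.
- move=> z /cran_cmapE[q' dq ->]; have [cq' Wq] := dq' _ dq.
  have := metric_transform alpha' (conj cA cq') (conj dA dq).
  have [_ _ gE _] := hr _ Wq; rewrite JE // => E1.
  have E2 : pjac x0 (p x0) E (cmap c q') *m (pjac x0 (p x0) E (cmap c q'))^T =
     pjac x0 (p x0) E (cmap c q') *m alpha' d (cmap d q') *m (pjac x0 (p x0) E (cmap c q'))^T.
    by rewrite -E1 -gE.
  have uJ' := uJ _ dq.
  have uJT : (pjac x0 (p x0) E (cmap c q'))^T \in unitmx by rewrite unitmx_tr.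
  have := can_inj (mulmxK uJT) E2; rewrite -{1}[pjac _ _ _ _]mulmx1.
  by move/(can_inj (mulKmx uJ')) => <-.
- move=> z /cran_cmapE[q' dq ->]; have [cq' Wq] := dq' _ dq.
  have := form_transform beta' (conj cA cq') (conj dA dq).
  have [_ _ _ bE] := hr _ Wq; rewrite JE // => E1.
  have uJT : (pjac x0 (p x0) E (cmap c q'))^T \in unitmx by rewrite unitmx_tr uJ.
  apply: (can_inj (mulmxK uJT)); rewrite -E1.
  apply/rowP => i; rewrite -rowE [RHS]mxE [RHS]mxE; exact: bE.
Qed.

(** Every chart sees the normalised tensors near a point as the pullbacks of the
    Euclidean ones by its transition to a chart of [euclidean_chart]. *)
Lemma normal_flat_parallel : flat alpha' /\ parallel alpha' beta'.
Proof.
have key c x : matlas c -> cran c x -> exists (V : set 'rV[R]_n.+1) (phi : 'rV[R]_n.+1 -> 'rV[R]_n.+1)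
   (J : 'rV[R]_n.+1 -> 'M[R]_n.+1) (H : 'rV[R]_n.+1 -> 'I_n.+1 -> 'I_n.+1 -> 'rV[R]_n.+1),
  [/\ open V /\ V x, (forall a, smooth_on V (fun x => phi x 0 a)) /\
      (forall x i a, J x i a = pd i (fun z => phi z 0 a) x),
      forall x i j k, H x i j 0 k = pd i (pd j (fun z => phi z 0 k)) x,
      (forall x, V x -> J x \in unitmx) /\ (forall x, V x -> alpha' c x = J x *m (J x)^T) &
      forall z, V z -> forall i, beta' c z 0 i = J z i 0].
  move=> cA /cran_cmapE[q cq ->].
  have [d [[dA dq] ad bd]] := euclidean_chart q.
  pose V := cmap c @` (cdom c `&` cdom d).
  pose J x : 'M[R]_n.+1 := \matrix_(i, a) pd i (fun z => transition c d z 0 a) x.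
  have JE q' : cdom c q' -> cdom d q' -> 'J (transition c d) (cmap c q') = J (cmap c q').
    move=> cq' dq'; apply/matrixP => i j; rewrite transition_jacobian //.
    by rewrite [RHS]mxE.
  exists V, (transition c d), J, (fun x i j => \row_k pd i (pd j (fun z => transition c d z 0 k)) x).
  split.
  - split; first by apply: chart_image_open; exact: cdom_open.
    by exists q.
  - split; first by have [] := matlas_compatible cA dA.
    by move=> z i a; rewrite [LHS]mxE.
  - by move=> z i j k; rewrite [LHS]mxE.
  - split=> _ [q' [cq' dq'] <-]; rewrite -JE //.
      exact: (transition_jacobian_unit alpha (conj cA cq') (conj dA dq')).
    rewrite (metric_transform alpha' (conj cA cq') (conj dA dq')) ad ?mulmx1 //.
    exact: cran_cmap.
  - move=> _ [q' [cq' dq'] <-] i; rewrite -JE //.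
    rewrite (form_transform beta' (conj cA cq') (conj dA dq')) bd; last exact: cran_cmap.
    by rewrite -rowE [LHS]mxE [LHS]mxE.
split.
  move=> c x l k i j cA cx; have [V [phi [J [H [[oV Vx] [sphi JE] HE [uJ gE] _]]]]] := key c x cA cx.
  exact: (pullback_curvature oV sphi JE HE uJ gE l k i j Vx).
move=> c x i j cA cx; have [V [phi [J [H [[oV Vx] [sphi JE] HE [uJ gE] bE]]]]] := key c x cA cx.
exact: (pullback_parallel oV sphi JE HE uJ gE i j bE Vx).
Qed.

Lemma quad1 (y : 'rV[R]_n.+1) : quad 1%:M y = \sum_i y 0 i ^+ 2.
Proof.
rewrite quadE bilE mulmx1 mxE; apply: eq_bigr => i _; by rewrite mxE expr2.
Qed.

Lemma lin_e0 (y : 'rV[R]_n.+1) : lin (delta_mx 0 0) y = y 0 0.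
Proof.
rewrite /lin (bigD1 ord0) //= mxE !eqxx mul1r big1 ?addr0 // => i i0.
by rewrite mxE eqxx (negbTE i0) mul0r.
Qed.

Lemma euclidean_chart_values d x y : alpha' d x = 1%:M -> beta' d x = delta_mx 0 0 ->
  alpha_val alpha' d x y = enorm y /\ beta_val beta' d x y = y 0 0.
Proof.
move=> ad bd; split; first by rewrite /alpha_val ad quad1.
by rewrite /beta_val bd lin_e0.
Qed.

Lemma normal_local_form : local_normal_form alpha' beta'.
Proof.
move=> q; have [d [hd ad bd]] := euclidean_chart q; exists d => // x y dx.
have [h1 h2] := euclidean_chart_values y (ad x dx) (bd x dx).
split=> // i1 i10; rewrite h2; congr (y 0 _).
exact/esym/val_inj.
Qed.

Lemma kropina_minkowskian : locally_minkowskian (kropina m alpha beta).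
Proof.
move=> q; have [d [[dA dq] ad bd]] := euclidean_chart q; exists d; [by split|move=> x x' y dx dx'].
have [h1 h2] := normal_same_metric m alpha beta_neq0 y dA dx.
have [h1' h2'] := normal_same_metric m alpha beta_neq0 y dA dx'.
have [va vb] := euclidean_chart_values y (ad x dx) (bd x dx).
have [va' vb'] := euclidean_chart_values y (ad x' dx') (bd x' dx').
move=> fx; have fx' : fin_dom (kropina m alpha beta) d x' y.
  by apply/h1'; move/h1: fx; rewrite /= -/alpha' -/beta' vb vb'.
split; first exact: fx'.
rewrite (h2 fx) (h2' fx') /fin_val /= -/alpha' -/beta'.
by rewrite va vb va' vb'.
Qed.

End NormalForm.

(** * A metric that is not flat-parallel *)

Section EuclideanSpace.
Variables (R : realType) (n : nat).

(** The balls with rational centre and radius 1 / (k + 1) form a countable basis. *)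
Lemma row_second_countable : @second_countable 'rV[R]_n.
Proof.
pose B (s : 'rV[rat]_n * nat) : set 'rV[R]_n := ball (map_mx ratr s.1 : 'rV[R]_n) (s.2.+1%:R^-1).
exists (B @` setT).
  exact: (card_le_trans (card_image_le B setT) (countableP _)).
split=> [_ [s _ <-]|x A]; first exact: ball_open.
rewrite nbhs_ballP => -[e /= e0 xA].
have e20 : 0 < e / 2 by rewrite divr_gt0.
have [k _ hk] := @near_infty_natSinv_lt R (PosNum e20).
have {}hk := hk k (leqnn k); rewrite /= in hk.
have k0 : 0 < k.+1%:R^-1 :> R by rewrite invr_gt0 ltr0n.
have ex (i : 'I_n) : exists q : rat, `|x 0 i - ratr q| < k.+1%:R^-1.
  have lt : x 0 i - k.+1%:R^-1 < x 0 i + k.+1%:R^-1.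
    by rewrite ltrD2l (lt_trans _ k0) // oppr_lt0.
  have [q] := rat_in_itvoo lt; rewrite in_itv /= => /andP[q1 q2].
  by exists q; rewrite ltr_distlC q1 q2.
pose q : 'rV[rat]_n := \row_i xget 0 [set q | `|x 0 i - ratr q| < k.+1%:R^-1].
have qx i : `|x 0 i - ratr (q 0 i)| < k.+1%:R^-1.
  by rewrite mxE; case: xgetP => [t -> //|h]; have [t /h] := ex i.
have xq : ball (map_mx ratr q : 'rV[R]_n) (k.+1%:R^-1) x.
  split=> [//|i j]; rewrite ord1 mxE -ball_normE /= distrC; exact: qx.
exists (B (q, k)); first by split=> //; exists (q, k).
move=> z /= qz; apply: xA; have -> : e = e / 2 + e / 2 by field.
apply: (@ball_triangle _ _ (map_mx ratr q : 'rV[R]_n)).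
  by apply: ball_sym; apply: (le_ball (ltW hk)).
exact: (le_ball (ltW hk)).
Qed.

End EuclideanSpace.

Section EuclideanManifold.
Variables (R : realType) (n : nat).
Implicit Types (c d : chart R n 'rV[R]_n) (x y z : 'rV[R]_n).

Fact id_open : open ((fun x : 'rV[R]_n => x) @` setT).
Proof. by rewrite image_id; exact: openT. Qed.

Fact id_continuous_in (A : set 'rV[R]_n) : {in A, continuous (@id 'rV[R]_n)}.
Proof. by move=> x _; exact: cvg_id. Qed.

Definition id_chart : chart R n 'rV[R]_n :=
  @Chart R n _ setT id id openT id_open (fun _ _ => erefl)
    (@id_continuous_in _) (@id_continuous_in _).

Lemma compatible_id c : compatible c id_chart <->
  (forall j, smooth_on (cran c) (fun x => cinv c x 0 j)) /\
  (forall j, smooth_on (cdom c) (fun x => cmap c x 0 j)).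
Proof.
by rewrite /compatible /smooth_transition /= setTI setIT image_id.
Qed.

Lemma id_compatible : compatible id_chart id_chart.
Proof.
rewrite compatible_id /cran /= image_id.
by split=> j k; apply: Ck_on_coord; exact: openT.
Qed.

Lemma id_compatible_trans c d :
  compatible c id_chart -> compatible d id_chart -> smooth_transition c d.
Proof.
move=> /compatible_id[ci _] /compatible_id[_ dm] j k.
apply: (@Ck_on_comp _ _ _ k _ (cdom d) (fun x => cmap d x 0 j) (cinv c)).
- by apply: chart_image_open; exact: cdom_open.
- exact: cdom_open.
- by move=> _ [q [cq dq] <-]; rewrite cmapK ?inE.
- by move=> i; apply: Ck_on_sub (ci i k) => _ [q [cq dq] <-]; exists q.
- exact: dm.
Qed.

(** The charts compatible with the identity; they are compatible with each other
    through it, which also makes the atlas maximal. *)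
Definition euclidean_space : manifold R n.
Proof.
apply: (@Manifold R n 'rV[R]_n [set c | compatible c id_chart]).
- exact: norm_hausdorff.
- exact: row_second_countable.
- by move=> p; exists id_chart => //; exact: id_compatible.
- by move=> c d cA dA; split; exact: id_compatible_trans.
- by move=> c cA; apply: cA; exact: id_compatible.
Defined.

End EuclideanManifold.

Section ConformalExample.
Variables (R : realType) (n : nat) (k : R).
Implicit Types (c d : chart R n.+1 'rV[R]_n.+1) (x y z : 'rV[R]_n.+1).

Let E := euclidean_space R n.+1.
Let ok c := @matlas R n.+1 E c.

(** The Jacobian from the coordinates of c to the standard ones. *)
Definition chart_jac c x : 'M[R]_n.+1 := \matrix_(i, j) pd i (fun z => cinv c z 0 j) x.

Lemma chart_jacE c x i j : chart_jac c x i j = pd i (fun z => cinv c z 0 j) x.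
Proof. by rewrite mxE. Qed.

Lemma cinv_smooth c j : ok c -> smooth_on (cran c) (fun x => cinv c x 0 j).
Proof. by move=> /compatible_id[h _]; exact: h. Qed.

Lemma chart_jac_smooth c i j : ok c -> smooth_on (cran c) (fun x => chart_jac c x i j).
Proof.
move=> cA N; apply: (@Ck_on_ext _ _ N _ (pd i (fun z => cinv c z 0 j))).
- exact: cran_open.
- by move=> z _; rewrite chart_jacE.
- by apply: Ck_on_pd; exact: (cinv_smooth j cA).
Qed.

Lemma chart_jac_transition c d (p : E) : chart_at p c -> chart_at p d ->
  chart_jac c (cmap c p) = 'J (transition c d) (cmap c p) *m chart_jac d (cmap d p).
Proof.
move=> [cA cp] [dA dp]; apply/matrixP => i j; rewrite chart_jacE [RHS]mxE.
have oV : open (cmap c @` (cdom c `&` cdom d)) by apply: chart_image_open; exact: cdom_open.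
have Vp : (cmap c @` (cdom c `&` cdom d)) (cmap c p) by exists p.
have [tcd _] := @matlas_compatible _ _ E c d cA dA.
transitivity (pd i (fun z => cinv d (transition c d z) 0 j) (cmap c p)).
  apply: (pd_ext _ oV) => // _ [q [cq dq] <-].
  by rewrite transitionE // !cmapK ?inE.
apply: is_derive_pd.
have h l : is_derive (cmap c p) (delta_mx 0 i) (fun z => transition c d z 0 l)
    (pd i (fun z => transition c d z 0 l) (cmap c p)).
  exact: (Ck_on_is_derive i (tcd l 1%N)).
have := is_derive_chain (@cran_open _ _ _ d) (cinv_smooth j dA 1%N) _ h.
rewrite transitionE // => /(_ (ex_intro2 _ _ p dp erefl)) hh.
apply: is_derive_eq hh _; apply: eq_bigr => l _.
by rewrite (@transition_jacobian R n.+1 E) // chart_jacE.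
Qed.

Lemma id_jac x : chart_jac (id_chart R n.+1) x = 1%:M.
Proof.
apply/matrixP => i j; rewrite chart_jacE [RHS]mxE.
rewrite (is_derive_pd (is_derive_coord _ _ _)) mxE eqxx /=.
by rewrite eq_sym.
Qed.

Lemma id_chart_ok : ok (id_chart R n.+1).
Proof. exact: id_compatible. Qed.

Lemma chart_jac_unit c x : ok c -> cran c x -> chart_jac c x \in unitmx.
Proof.
move=> cA [p cp <-].
have hi : @chart_at R n.+1 E p (id_chart R n.+1) by split; first exact: id_chart_ok.
have hc : @chart_at R n.+1 E p c by [].
have := chart_jac_transition hi hc; rewrite id_jac => /esym/mulmx1_unit[_].
by [].
Qed.

(** exp (k x^1) |y|^2 and exp (x^1) y^1, transported from the standard
    coordinates to those of c. *)
Definition conformal_metric c x : 'M[R]_n.+1 :=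
  expR (k * cinv c x 0 0) *: (chart_jac c x *m (chart_jac c x)^T).

Definition conformal_form c x : 'rV[R]_n.+1 :=
  expR (cinv c x 0 0) *: (delta_mx 0 0 *m (chart_jac c x)^T).

Fact conformal_metric_smooth c i j : ok c -> smooth_on (cran c) (fun x => conformal_metric c x i j).
Proof.
move=> cA N; have oc := @cran_open _ _ _ c.
apply: (@Ck_on_ext _ _ N _ (fun x => expR (k * cinv c x 0 0) *
   \sum_l chart_jac c x i l * chart_jac c x j l)) => //.
  move=> z _; rewrite [RHS]mxE [X in _ = _ * X]mxE; congr (_ * _); apply: eq_bigr => l _.
  by rewrite [X in _ = _ * X]mxE.
apply: Ck_onM => //.
  apply: Ck_on_expR => //; apply: Ck_onM => //; first exact: Ck_on_cst.
  exact: cinv_smooth.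
by apply: Ck_on_sum => // l _; apply: Ck_onM => //; exact: chart_jac_smooth.
Qed.

Fact conformal_metric_sym c x : ok c -> cran c x -> (conformal_metric c x)^T = conformal_metric c x.
Proof. by move=> _ _; rewrite /conformal_metric linearZ /= trmx_mul trmxK. Qed.

Fact conformal_metric_pos c x y : ok c -> cran c x -> y != 0 -> 0 < quad (conformal_metric c x) y.
Proof.
move=> cA cx y0; rewrite quad_scale mulr_gt0 ?expR_gt0 //.
have -> : quad (chart_jac c x *m (chart_jac c x)^T) y = \sum_i (y *m chart_jac c x) 0 i ^+ 2.
  rewrite -quad1 !quadE !bilE mulmx1; rewrite trmx_mul !mulmxA.
  by [].
rewrite lt0r sumr_ge0 ?andbT => [|i _]; last exact: sqr_ge0.
apply: contra y0 => /eqP h; have uJ := chart_jac_unit cA cx.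
suff : y *m chart_jac c x = 0 *m chart_jac c x by move/(can_inj (mulmxK uJ)) ->.
rewrite mul0mx; apply/rowP => i; rewrite [RHS]mxE; apply/eqP; rewrite -sqrf_eq0.
apply/eqP; move/psumr_eq0P: h; apply=> // j _; exact: sqr_ge0.
Qed.

Fact conformal_metric_transform c d (p : E) : chart_at p c -> chart_at p d ->
  conformal_metric c (cmap c p) = 'J (transition c d) (cmap c p) *m conformal_metric d (cmap d p)
    *m ('J (transition c d) (cmap c p))^T.
Proof.
move=> hc hd; have [_ cp] := hc; have [_ dp] := hd.
rewrite /conformal_metric !cmapK ?inE // (chart_jac_transition hc hd).
by rewrite -scalemxAr -scalemxAl trmx_mul !mulmxA.
Qed.

Definition conformal_riemannian : riemannian E :=
  @Riemannian R n.+1 E conformal_metric conformal_metric_smooth conformal_metric_sym conformal_metric_pos conformal_metric_transform.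

Fact conformal_form_smooth c i : ok c -> smooth_on (cran c) (fun x => conformal_form c x 0 i).
Proof.
move=> cA N; have oc := @cran_open _ _ _ c.
apply: (@Ck_on_ext _ _ N _ (fun x => expR (cinv c x 0 0) * chart_jac c x i 0)) => //.
  by move=> z _; rewrite [RHS]mxE -rowE [X in _ = _ * X]mxE [X in _ = _ * X]mxE.
apply: Ck_onM => //; last exact: chart_jac_smooth.
by apply: Ck_on_expR => //; exact: cinv_smooth.
Qed.

Fact conformal_form_transform c d (p : E) : chart_at p c -> chart_at p d ->
  conformal_form c (cmap c p) = conformal_form d (cmap d p) *m ('J (transition c d) (cmap c p))^T.
Proof.
move=> hc hd; have [_ cp] := hc; have [_ dp] := hd.
rewrite /conformal_form !cmapK ?inE // (chart_jac_transition hc hd).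
by rewrite -scalemxAl trmx_mul !mulmxA.
Qed.

Definition conformal_oneform : oneform E := @Oneform R n.+1 E conformal_form conformal_form_smooth conformal_form_transform.

Lemma conformal_nowhere_zero : nowhere_zero conformal_oneform.
Proof.
move=> c x cA cx /=; rewrite scaler_eq0 (gt_eqF (expR_gt0 _)) /=.
have uJ : (chart_jac c x)^T \in unitmx by rewrite unitmx_tr; exact: chart_jac_unit.
apply/eqP => h; have := congr1 (mulmx^~ (invmx (chart_jac c x)^T)) h.
rewrite mulmxK // mul0mx => /rowP/(_ 0); rewrite !mxE !eqxx => /eqP.
by rewrite oner_eq0.
Qed.

Lemma conformal_metric_id x : conformal_metric (id_chart R n.+1) x = expR (k * x 0 0) *: 1%:M.
Proof. by rewrite /conformal_metric id_jac trmx1 mulmx1. Qed.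

Lemma conformal_form_id x : conformal_form (id_chart R n.+1) x = expR (x 0 0) *: delta_mx 0 0.
Proof. by rewrite /conformal_form id_jac trmx1 mulmx1. Qed.

Lemma lin_scale r (b : 'rV[R]_n.+1) y : lin (r *: b) y = r * lin b y.
Proof. by rewrite /lin mulr_sumr; apply: eq_bigr => i _; rewrite mxE mulrA. Qed.

End ConformalExample.

Section KropinaExample.
Variables (R : realType) (n : nat) (m : R).
Hypotheses (m_neq0 : m != 0) (m_neq1 : m != 1).
Implicit Types (x y z : 'rV[R]_n.+1).

Let k := 2 * m / (m - 1).
Let alpha := conformal_riemannian n k.
Let beta := conformal_oneform R n.
Let F := kropina m alpha beta.
Let e := id_chart R n.+1.

Lemma conformal_fin_dom x y : fin_dom F e x y <-> 0 < y 0 0.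
Proof.
rewrite /F /= /beta_val /= conformal_form_id lin_scale lin_e0.
by rewrite pmulr_rgt0 ?expR_gt0.
Qed.

(** k is chosen so that exp (k x^1 / 2)^(1 - m) exp (x^1)^m = 1. *)
Lemma conformal_fin_val x y : 0 < y 0 0 -> fin_val F e x y = y 0 0 `^ m * enorm y `^ (1 - m).
Proof.
move=> y0; rewrite /F /= /beta_val /alpha_val /= conformal_form_id conformal_metric_id lin_scale lin_e0.
rewrite quad_scale quad1 sqrtrM ?expR_ge0 // -/(enorm y) -(powR12_sqrt (expR_ge0 _)).
rewrite !powRM ?powR_ge0 ?sqrtr_ge0 ?expR_ge0 ?ltW // -powRrM mulrACA.
rewrite -[RHS]mul1r; congr (_ * _); rewrite -!expRM -expRD.
rewrite (_ : _ + _ = 0) ?expR0 // /k.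
by field; rewrite subr_eq0.
Qed.

Lemma half_space_open : open [set v : 'rV[R]_n.+1 | 0 < v 0 0].
Proof.
have c0 : {in setT, continuous (fun v : 'rV[R]_n.+1 => v 0 0)}.
  by move=> v _; exact: coord_continuous.
by have := open_setI_preimage openT c0 (@open_gt R 0); rewrite setTI.
Qed.

Lemma conformal_pd_energy x y i : 0 < y 0 0 -> pd i (fun z => fin_val F e z y ^+ 2) x = 0.
Proof.
move=> y0; rewrite (_ : (fun z => _) = cst (fin_val F e 0 y ^+ 2)).
  by apply: is_derive_pd; exact: is_derive_cst.
by apply/funext => z; rewrite !conformal_fin_val.
Qed.

(** In the standard coordinates F^2 does not depend on x, so G = 0 and P = 0. *)
Lemma conformal_projectively_flat : locally_projectively_flat_K0 F.
Proof.
move=> p; exists e, (fun _ _ => 0); split.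
- by split => //; exact: id_compatible.
- move=> x y [_ /conformal_fin_dom y0 _] i; rewrite mul0r /spray big1 ?mulr0 // => l _.
  rewrite conformal_pd_energy // subr0 big1 ?mulr0 // => j _.
  rewrite (_ : pd l _ y = 0) ?mul0r //.
  transitivity (pd l (cst 0 : 'rV[R]_n.+1 -> R) y).
    by apply: (pd_ext _ half_space_open) => // v v0; exact: conformal_pd_energy.
  by apply: is_derive_pd; exact: is_derive_cst.
- move=> x y [_ /conformal_fin_dom y0 _]; rewrite /flag_curvature big1 ?expr0n ?subr0 ?mul0r // => j _.
  rewrite (_ : pd j _ x = 0) ?mul0r //.
  by apply: is_derive_pd; exact: is_derive_cst.
Qed.

(** At the origin the (1, 1) component of the covariant derivative of beta is
    1 - k / 2, and k = 2 would mean m = m - 1. *)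
Lemma conformal_not_parallel : ~ parallel alpha beta.
Proof.
have e0 : cran e 0 by exists 0.
move=> /(_ e 0 0 0 (id_chart_ok R n) e0) /=.
have hc : is_derive (0 : 'rV[R]_n.+1) (delta_mx 0 0) (fun z : 'rV[R]_n.+1 => z 0 0) 1.
  apply: is_derive_eq (is_derive_coord _ _ _) _; by rewrite mxE eqxx.
have hm : pd 0 (fun z => conformal_metric k e z 0 0) 0 = k.
  rewrite (_ : (fun z => _) = (fun z => expR (k * z 0 0))).
    rewrite (is_derive_pd (is_derive_expR1 (is_deriveZ1 k hc))).
    by rewrite mxE mulr0 expR0 mul1r mulr1.
  by apply/funext => z; rewrite conformal_metric_id !mxE eqxx mulr1.
have hb : pd 0 (fun z => conformal_form e z 0 0) 0 = 1.
  rewrite (_ : (fun z => _) = (fun z => expR (z 0 0))).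
    by rewrite (is_derive_pd (is_derive_expR1 hc)) mxE expR0 mul1r.
  by apply/funext => z; rewrite conformal_form_id !mxE !eqxx mulr1.
have a0 : conformal_metric k e 0 = 1%:M by rewrite conformal_metric_id mxE mulr0 expR0 scale1r.
have b0 : conformal_form e 0 = delta_mx 0 0 by rewrite conformal_form_id mxE expR0 scale1r.
rewrite hb b0 (bigD1 ord0) //= big1 ?addr0 => [|i i0]; last first.
  by rewrite mxE eqxx (negbTE i0) mulr0.
rewrite mxE !eqxx mulr1 /christoffel a0 invmx1 (bigD1 ord0) //= big1 ?addr0 => [|i i0]; last first.
  by rewrite mxE eq_sym (negbTE i0) mul0r.
rewrite mxE eqxx mul1r hm => h.
have {h hm hb a0 b0 e0 hc} h : k = 2.
  move: (k) h => k' {hm hb a0 b0 e0 hc} h.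
  have -> : k' = 2 * (1 - (1 - 2^-1 * (k' + k' - k'))) by field.
  by rewrite h subr0 mulr1.
have m1 : m - 1 != 0 by rewrite subr_eq0.
have : k * (m - 1) = 2 * m by rewrite /k divfK.
rewrite h mulrBr mulr1 => /eqP; rewrite -subr_eq0 addrAC subrr sub0r oppr_eq0.
by rewrite pnatr_eq0.
Qed.

End KropinaExample.

(** * The classification *)

Theorem theorem1p2 (R : realType) (n : nat) (m : R)
    (n_ge2 : (2 <= n)%N) (m_neq0 : m != 0) (m_neq1 : m != 1) :
  (forall (M : manifold R n) (alpha : riemannian M) (beta : oneform M),
     nowhere_zero beta ->
     locally_projectively_flat_K0 (kropina m alpha beta) ->
     (exists (alpha' : riemannian M) (beta' : oneform M) (eta : M -> R),
        [/\ same_metric (kropina m alpha beta) (kropina m alpha' beta'),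
            flat alpha' /\ parallel alpha' beta',
            local_normal_form alpha' beta',
            smooth_fun eta /\ (forall p, 0 < eta p)
          & kropina_related m eta alpha beta alpha' beta']) /\
     locally_minkowskian (kropina m alpha beta)) /\
  (exists (M : manifold R n) (alpha : riemannian M) (beta : oneform M),
     [/\ nowhere_zero beta,
         locally_projectively_flat_K0 (kropina m alpha beta)
       & ~ flat_parallel alpha beta]).
Proof.
case: n n_ge2 => [//|n] n_ge2; split.
  move=> M alpha beta beta_neq0 proj_flat; split.
    exists (normal_riemannian m alpha beta_neq0), (normal_oneform m alpha beta_neq0).
    exists (normal_factor_eta m alpha beta); split.
    - exact: normal_same_metric.
    - exact: normal_flat_parallel.
    - exact: normal_local_form.
    - by split; [exact: eta_smooth|exact: eta_gt0].
    - exact: normal_related.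
  exact: (kropina_minkowskian m_neq0 m_neq1 beta_neq0).
exists (euclidean_space R n.+1), (conformal_riemannian n (2 * m / (m - 1))), (conformal_oneform R n).
split; [exact: conformal_nowhere_zero|exact: conformal_projectively_flat|].
by move=> [_]; exact: conformal_not_parallel.
Qed.
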